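(* Let $\theta\in(0,1)$, let $0<\Delta t<C_{\Delta t}$, and let $(u_n)_{n\ge0}\subset V$ be the velocity approximations of the fully implicit DLN scheme. With $\epsilon$, $h_{11}$, $h_{22}$, $C_h(\theta)$, $C_\epsilon(\theta)$ the quantities described in the context and $\|\cdot\|_{H(\theta)}$ the associated norm: (i) For all $N=2,3,\dots$, $$\left\|\begin{matrix}u_N\\ u_{N-1}\end{matrix}\right\|_{H(\theta)}^2\le\frac1{(1+\epsilon)^{N-1}}\left\|\begin{matrix}u_1\\ u_0\end{matrix}\right\|_{H(\theta)}^2+\frac{C_\epsilon(\theta)}{2\nu^2\lambda_1^2}\|f\|_\infty^2 .$$ (ii) $\|u_N\|\le K_2$ for all $N=2,3,\dots$. (iii) For any $N\ge1$ and $i=1,\dots,N-1$, $$\nu\Delta t\sum_{n=i}^{N-1}\|\nabla u_{n,\beta}\|^2\le2\left\|\begin{matrix}u_i\\ u_{i-1}\end{matrix}\right\|_{G(\theta)}^2+\frac{(N-i)\Delta t}{\nu\lambda_1}\|f\|_\infty^2 .$$ (iv) For any $N\ge1$ and $i=1,\dots,N-1$, $$\Delta t\frac{\nu(2\beta_2-1)}{8}\sum_{j=i}^{N-1}\|\nabla u_{j+1}\|^2+\left\|\begin{matrix}u_N\\ u_{N-1}\end{matrix}\right\|_{G(\theta)}^2+\Delta t\,\nu\Big[\frac14\|\nabla u_N\|^2+\Big(\frac{\beta_0}2+\frac{2\beta_2-1}8\Big)\|\nabla u_{N-1}\|^2\Big]$$ $$+\sum_{j=i}^{N-1}\Big(\frac\theta2\|u_{j+1}-u_j\|^2+\frac14(1-\theta)\|u_{j+1}-u_{j-1}\|^2\Big)+\nu\Delta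 t\sum_{j=i}^{N-1}\Big(\frac{\beta_1}2\|\nabla u_{j+1}+\nabla u_j\|^2+\frac{\beta_0}2\|\nabla u_{j+1}+\nabla u_{j-1}\|^2\Big)$$ $$\le\Big(1+\frac{K_2^4(\beta_0^2+\beta_1^2)^2}{\nu^4(2\beta_2-1)^3}\Big)\left\|\begin{matrix}u_i\\ u_{i-1}\end{matrix}\right\|_{G(\theta)}^2+\Delta t\,\nu\Big[\frac14\|\nabla u_i\|^2+\Big(\frac{\beta_0}2+\frac{2\beta_2-1}8\Big)\|\nabla u_{i-1}\|^2\Big]$$ $$+\frac{(N-i)\Delta t}{\nu(2\beta_2-1)\lambda_1}\Big(2+\frac{K_2^4(\beta_0^2+\beta_1^2)^2}{2\nu^4(2\beta_2-1)^2}\Big)\|f\|_\infty^2 .$$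
   Context: Setting. $\Omega\subset\mathbb{R}^2$ is a domain with boundary of class $C^2$, $\nu>0$, $(\cdot,\cdot)$ and $\|\cdot\|$ are the $L^2(\Omega)$ inner product and norm. $H=\{v\in L^2(\Omega)^2:\nabla\cdot v=0,\ v\cdot\vec n|_{\partial\Omega}=0\}$, $V=\{v\in H_0^1(\Omega)^2:\nabla\cdot v=0\}$ with norm $\|\nabla\cdot\|$. $f\in L^\infty(\mathbb{R}_+;H)$, $\|f\|_\infty=\|f\|_{L^\infty(\mathbb{R}_+;H)}$, and the values $f(t)$ used satisfy $\|f(t)\|\le\|f\|_\infty$. The Stokes operator $A:V\to V'$ is $\langle Au,v\rangle=(\nabla u,\nabla v)$; $\lambda_1>0$ is its smallest eigenvalue, so $\|u\|\le\lambda_1^{-1/2}\|\nabla u\|$ on $V$. $b(u,v,w)=(u\cdot\nabla v,w)$. DLN coefficients: $\alpha_2=\frac{\theta+1}{2}$, $\alpha_1=-\theta$, $\alpha_0=\frac{\theta-1}{2}$; $\beta_2=\frac{2+\theta-\theta^2}{4}$, $\beta_1=\frac{\theta^2}{2}$, $\beta_0=\frac{2-\theta-\theta^2}{4}$. For a sequence $(z_n)$, $z_{n,\beta}=\sum_{\ell=0}^2\beta_\ell z_{n-1+\ell}$; $t_n=n\Delta t$. DLN scheme: given $u_0,u_1\in V$, for $n\ge1$, $u_{n+1}\in V$ satisfies, for all $v\in V$, $\frac1{\Delta t}\big(\sum_{\ell=0}^2\alpha_\ell u_{n-1+\ell},v\big)+\nu(\nabla u_{n,\beta},\nabla v)+b(u_{n,\beta},u_{n,\beta},v)=(f(t_{n,\beta}),v)$.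 $G$-norm: $\left\|\begin{matrix}u\\ v\end{matrix}\right\|_{G(\theta)}^2=\frac{1+\theta}{4}\|u\|^2+\frac{1-\theta}{4}\|v\|^2$. Let $a_1=-\sqrt{\theta(1-\theta^2)/2}$, $a_2=a_0=-\frac12a_1$. Time step bound: $C_{\Delta t}=\frac1{\nu\lambda_1}\min\big\{\frac{8\theta(1-\theta^2)}{8-6\theta^2+3\theta^4},2(1-\theta)\big\}$. Auxiliary quantities (the paper establishes that they exist when $\Delta t<C_{\Delta t}$): $C_h(\theta),C_\epsilon(\theta)>0$ depend only on $\theta$, and $\epsilon>0$, $a,b,c\in\mathbb{R}$, $h_{11},h_{22}>0$ (independent of $n$) are such that, with $\left\|\begin{matrix}u\\ v\end{matrix}\right\|_{H(\theta)}^2=h_{11}\|u\|^2+h_{22}\|v\|^2$, for all $n\ge1$ $\left\|\begin{matrix}u_{n+1}\\ u_n\end{matrix}\right\|_{G(\theta)}^2-\left\|\begin{matrix}u_n\\ u_{n-1}\end{matrix}\right\|_{G(\theta)}^2+\|\sum_{\ell=0}^2a_\ell u_{n-1+\ell}\|^2+\frac{\nu\Delta t\lambda_1}{2}\|u_{n,\beta}\|^2=(1+\epsilon)\left\|\begin{matrix}u_{n+1}\\ u_n\end{matrix}\right\|_{H(\theta)}^2-\left\|\begin{matrix}u_n\\ u_{n-1}\end{matrix}\right\|_{H(\theta)}^2+\|au_{n+1}+bu_n+cu_{n-1}\|^2$, and $h_{11}>\frac{\theta^3}{2}[1-\frac12\theta(1-\theta)]$, $h_{22}>\frac1{16}\theta(1-\theta)^2(1+\theta)(2+\theta)$,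 $\max\{h_{11},h_{22}\}<C_h(\theta)$, $\frac14<\frac1\epsilon<\frac{C_\epsilon(\theta)}{\nu\lambda_1\Delta t}$. Constants: $K_1=C_h(\theta)(\|u_1\|^2+\|u_0\|^2)+\frac{C_\epsilon(\theta)}{2\nu^2\lambda_1^2}\|f\|_\infty^2$, $\quad K_2=\Big\{\frac{K_1}{\frac{\theta^3}{2}[1-\frac12\theta(1-\theta)]}\Big\}^{1/2}$. *)

(* Defs.v *)
From HB Require Import structures.
From mathcomp Require Import all_boot all_order all_algebra.
From mathcomp Require Import all_classical all_reals all_analysis.
From mathcomp Require Import ess_sup_inf.

Set Implicit Arguments.
Unset Strict Implicit.
Unset Printing Implicit Defensive.

Import Order.TTheory GRing.Theory Num.Theory.
Import numFieldNormedType.Exports.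

Local Open Scope classical_set_scope.
Local Open Scope ring_scope.

(* The plane is the product type R * R, which carries both the product
   topology / normed structure and the product of two Lebesgue measures.
   Scalar and vector fields on a domain Omega are total functions on the plane
   of which only the values on Omega matter; elements of L^2, H^1, ... are
   represented by (Borel) functions, equality almost everywhere being left
   implicit. *)
Notation plane R := (R * R)%type.
Notation sfield R := (plane R -> R).
Notation vfield R := (plane R -> 'rV[R]_2).

Section plane.
Context {R : realType}.
Implicit Types (Omega : set (plane R)) (phi p g : sfield R) (v w : vfield R).

Definition leb2 : {measure set (measurableTypeR R * measurableTypeR R) -> \bar R} :=
  (@lebesgue_measure R \x @lebesgue_measure R)%E.

Definition basis_vec (i : 'I_2) : plane R := if i == ord0 then (1, 0) else (0, 1).

Definition partial (i : 'I_2) p : sfield R := fun x => 'D_(basis_vec i) p x.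

(* C^infinity: all iterated partial derivatives exist and are continuous. *)
Definition smooth p : Prop := forall s : seq 'I_2,
  continuous (foldr partial p s) /\
  forall x i, derivable (foldr partial p s) x (basis_vec i).

(* C_c^infinity(Omega), extended by zero *)
Definition test_function Omega phi : Prop :=
  [/\ smooth phi, compact (closure [set x | phi x != 0])
    & closure [set x | phi x != 0] `<=` Omega].

(* C^2 boundary: near every boundary point, in rotated Cartesian coordinates,
   Omega is the strict epigraph of a C^2 function. *)
Definition C2 (gamma : R -> R) : Prop :=
  [/\ forall s, derivable gamma s 1, forall s, derivable (derive1 gamma) s 1
    & continuous (derive1n 2 gamma)].

Definition boundary Omega : set (plane R) := closure Omega `\` interior Omega.

Definition C2_boundary Omega : Prop := forall x0, boundary Omega x0 ->
  exists r a b : R, exists gamma : R -> R,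
    [/\ 0 < r, a ^+ 2 + b ^+ 2 = 1, C2 gamma &
      forall x, ball x0 r x ->
        Omega x <-> gamma (a * x.1 + b * x.2) < a * x.2 - b * x.1].

Definition C2_domain Omega : Prop :=
  [/\ open Omega, connected Omega, Omega !=set0 & C2_boundary Omega].

Definition sL2 Omega p : Prop :=
  measurable_fun Omega p /\ leb2.-integrable Omega (fun x => (p x ^+ 2)%:E).

(* Inner product and norm of L^2(Omega) for fields with values in matrices
   (in particular row vectors), with the Euclidean (Frobenius) product. *)
Definition l2dot Omega {m n : nat} (F G : plane R -> 'M[R]_(m, n)) : R :=
  \int[leb2]_(x in Omega) \sum_(i < m) \sum_(j < n) F x i j * G x i j.

Definition l2norm Omega {m n : nat} (F : plane R -> 'M[R]_(m, n)) : R :=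
  Num.sqrt (l2dot Omega F F).

Definition coord_fun v (j : 'I_2) : sfield R := fun x => v x ord0 j.

Definition vL2 Omega v : Prop := forall j, sL2 Omega (coord_fun v j).

(* g is the weak derivative of p in direction i, among square integrable
   functions. *)
Definition is_wpartial Omega (i : 'I_2) p g : Prop :=
  sL2 Omega g /\ forall phi, test_function Omega phi ->
    \int[leb2]_(x in Omega) (p x * partial i phi x) =
    - \int[leb2]_(x in Omega) (g x * phi x).

(* A choice of the (almost everywhere unique) weak derivative; 0 if there is
   none in L^2. *)
Definition wpartial Omega (i : 'I_2) p : sfield R :=
  xget 0 [set g | is_wpartial Omega i p g].

Definition H1 Omega p : Prop :=
  sL2 Omega p /\ forall i, exists g, is_wpartial Omega i p g.

Definition H1norm Omega p : R :=
  Num.sqrt (\int[leb2]_(x in Omega)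
    (p x ^+ 2 + \sum_(i < 2) wpartial Omega i p x ^+ 2)).

(* H^1_0(Omega) is the closure of the test functions in H^1(Omega). *)
Definition H10 Omega p : Prop :=
  H1 Omega p /\ forall e : R, 0 < e ->
    exists2 phi, test_function Omega phi & H1norm Omega (p - phi) < e.

(* Entry (i, j) of the gradient is the i-th derivative of the j-th component,
   so that v x *m grad w x is the row vector (v . grad) w at x. *)
Definition grad Omega v : plane R -> 'M[R]_2 :=
  fun x => \matrix_(i, j) wpartial Omega i (coord_fun v j) x.

(* div v = 0 in the sense of distributions *)
Definition div_free Omega v : Prop := forall phi, test_function Omega phi ->
  l2dot Omega v (fun x => \row_i partial i phi x) = 0.

(* For a divergence-free v in L^2, the normal trace v . n is the functional
   p |-> (v, grad p) + (div v, p) = (v, grad p) on (traces of) H^1(Omega). *)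
Definition zero_normal_trace Omega v : Prop := forall p, H1 Omega p ->
  l2dot Omega v (fun x => \row_i wpartial Omega i p x) = 0.

Definition in_H Omega v : Prop :=
  [/\ vL2 Omega v, div_free Omega v & zero_normal_trace Omega v].

Definition in_V Omega v : Prop :=
  (forall j, H10 Omega (coord_fun v j)) /\ div_free Omega v.

Definition trilin Omega (u v w : vfield R) : R :=
  l2dot Omega (fun x => u x *m grad Omega v x) w.

(* <A u, v> *)
Definition stokes Omega (u v : vfield R) : R :=
  l2dot Omega (grad Omega u) (grad Omega v).

Definition stokes_eigenvalue Omega (lambda : R) : Prop :=
  exists w, [/\ in_V Omega w, l2norm Omega w != 0 &
    forall v, in_V Omega v -> stokes Omega w v = lambda * l2dot Omega w v].

Definition smallest_stokes_eigenvalue Omega (lambda : R) : Prop :=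
  stokes_eigenvalue Omega lambda /\
  forall mu, stokes_eigenvalue Omega mu -> lambda <= mu.

(* Strong (Bochner) measurability on [0, +oo[ with values in H *)
Definition simple_in_H Omega (s : R -> vfield R) : Prop :=
  exists (m : nat) (B : 'I_m -> set R) (h : 'I_m -> vfield R),
    (forall i, measurable (B i) /\ in_H Omega (h i)) /\
    forall t, s t = \sum_(i < m) (\1_(B i) t : R) *: h i.

Definition strongly_measurable Omega (f : R -> vfield R) : Prop :=
  exists s : nat -> R -> vfield R, (forall k, simple_in_H Omega (s k)) /\
    {ae @lebesgue_measure R, forall t, 0 <= t ->
      l2norm Omega (s k t - f t) @[k --> \oo] --> (0 : R)}.

Definition Linfty_esssup Omega (f : R -> vfield R) : \bar R :=
  ess_sup (@lebesgue_measure R)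
    ((fun t => (l2norm Omega (f t))%:E) \_ `[0, +oo[).

Definition Linfty_norm Omega (f : R -> vfield R) : R :=
  fine (Linfty_esssup Omega f).

Definition Linfty_H Omega (f : R -> vfield R) : Prop :=
  [/\ forall t, 0 <= t -> in_H Omega (f t), strongly_measurable Omega f
    & (Linfty_esssup Omega f < +oo)%E].

End plane.

Section dln.
Context {R : realType}.
Implicit Types (theta dt : R) (Omega : set (plane R)).

Definition alpha2 theta : R := (theta + 1) / 2.
Definition alpha1 theta : R := - theta.
Definition alpha0 theta : R := (theta - 1) / 2.

Definition beta2 theta : R := (2 + theta - theta ^+ 2) / 4.
Definition beta1 theta : R := theta ^+ 2 / 2.
Definition beta0 theta : R := (2 - theta - theta ^+ 2) / 4.

Definition a1 theta : R := - Num.sqrt (theta * (1 - theta ^+ 2) / 2).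
Definition a2 theta : R := - (a1 theta / 2).
Definition a0 theta : R := - (a1 theta / 2).

(* \sum_(l < 3) c_l z_(n - 1 + l), used for n >= 1 only *)
Definition three_step {Z : lmodType R} (c0 c1 c2 : R) (z : nat -> Z) (n : nat) : Z :=
  c0 *: z n.-1 + c1 *: z n + c2 *: z n.+1.

Definition at_alpha {Z : lmodType R} theta :=
  @three_step Z (alpha0 theta) (alpha1 theta) (alpha2 theta).
Definition at_beta {Z : lmodType R} theta :=
  @three_step Z (beta0 theta) (beta1 theta) (beta2 theta).
Definition at_a {Z : lmodType R} theta :=
  @three_step Z (a0 theta) (a1 theta) (a2 theta).

Definition t_beta theta dt (n : nat) : R :=
  at_beta theta (fun k => k%:R * dt : R^o) n.

Definition dln_scheme Omega (nu theta dt : R) (f : R -> vfield R)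
    (u : nat -> vfield R) : Prop :=
  forall n, (1 <= n)%N -> forall v, in_V Omega v ->
    dt^-1 * l2dot Omega (at_alpha theta u n) v
    + nu * l2dot Omega (grad Omega (at_beta theta u n)) (grad Omega v)
    + trilin Omega (at_beta theta u n) (at_beta theta u n) v
    = l2dot Omega (f (t_beta theta dt n)) v.

Definition Gnorm2 Omega theta (u v : vfield R) : R :=
  (1 + theta) / 4 * l2norm Omega u ^+ 2 + (1 - theta) / 4 * l2norm Omega v ^+ 2.

Definition Hnorm2 Omega (h11 h22 : R) (u v : vfield R) : R :=
  h11 * l2norm Omega u ^+ 2 + h22 * l2norm Omega v ^+ 2.

Definition C_dt (nu lambda1 theta : R) : R :=
  1 / (nu * lambda1) *
  Num.min (8 * theta * (1 - theta ^+ 2) / (8 - 6 * theta ^+ 2 + 3 * theta ^+ 4))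
          (2 * (1 - theta)).

Definition h11_bound theta : R := theta ^+ 3 / 2 * (1 - theta * (1 - theta) / 2).
Definition h22_bound theta : R :=
  1 / 16 * theta * (1 - theta) ^+ 2 * (1 + theta) * (2 + theta).

(* The auxiliary quantities attached to the solution u; Ch and Ceps stand for
   the values of C_h and C_epsilon at theta. *)
Definition auxiliary_quantities Omega (nu lambda1 theta dt : R)
    (u : nat -> vfield R) (Ch Ceps eps a b c h11 h22 : R) : Prop :=
  [/\ [/\ 0 < Ch, 0 < Ceps, 0 < eps, 0 < h11 & 0 < h22],
      [/\ h11_bound theta < h11, h22_bound theta < h22 & Num.max h11 h22 < Ch],
      1 / 4 < 1 / eps < Ceps / (nu * lambda1 * dt) &
      forall n, (1 <= n)%N ->
        Gnorm2 Omega theta (u n.+1) (u n) - Gnorm2 Omega theta (u n) (u n.-1)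
        + l2norm Omega (at_a theta u n) ^+ 2
        + nu * dt * lambda1 / 2 * l2norm Omega (at_beta theta u n) ^+ 2
        = (1 + eps) * Hnorm2 Omega h11 h22 (u n.+1) (u n)
          - Hnorm2 Omega h11 h22 (u n) (u n.-1)
          + l2norm Omega (a *: u n.+1 + b *: u n + c *: u n.-1) ^+ 2].

Definition K1 Omega (nu lambda1 Ch Ceps : R) (f : R -> vfield R)
    (u : nat -> vfield R) : R :=
  Ch * (l2norm Omega (u 1%N) ^+ 2 + l2norm Omega (u 0%N) ^+ 2)
  + Ceps / (2 * nu ^+ 2 * lambda1 ^+ 2) * Linfty_norm Omega f ^+ 2.

Definition K2 Omega (nu lambda1 theta Ch Ceps : R) (f : R -> vfield R)
    (u : nat -> vfield R) : R :=
  Num.sqrt (K1 Omega nu lambda1 Ch Ceps f u / h11_bound theta).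

End dln.

(* Main.v *)
Require Import Defs.
From HB Require Import structures.
From mathcomp Require Import all_boot all_order all_algebra.
From mathcomp Require Import all_classical all_reals all_analysis.
From mathcomp Require Import measurable_realfun ring lra.

Set Implicit Arguments.
Unset Strict Implicit.
Unset Printing Implicit Defensive.

Import Order.TTheory GRing.Theory Num.Theory.
Import numFieldNormedType.Exports.

Local Open Scope classical_set_scope.
Local Open Scope ring_scope.

(** Why the theorem is true.  Write |.| for the L^2 norm, delta = 2 beta2 - 1
and w_n for the beta-average of u_(n-1), u_n, u_(n+1).  The estimates come from
two choices of test function in the scheme.

Testing with w_n itself kills the convection term, because b(w, w, w) = 0 for a
divergence-free w that vanishes on the boundary, and the G-stability identity
of the DLN coefficients ([G_stability]) turns the discrete time derivative into
the increment of the G-norm plus a square.  The forcing is absorbed by half of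
the viscous term through the Poincare inequality.  Summing gives (iii); using
the auxiliary identity instead, which rewrites the same left-hand side as
(1 + eps) H_(n+1) - H_n plus a square, gives the contraction
(1 + eps) H_(n+1) <= H_n + c and hence (i) by a discrete Gronwall argument
([discrete_gronwall], [H_decay]).  Bound (ii) is (i) together with
h11 > h11_bound; the same constant K2 also bounds u_0 and u_1
([norm_le_K2]).

Testing with u_(n+1) gives (iv).  The polarised identities ([alpha_identity],
[grad_identity]) produce all the squares on the left of (iv), and leave a
dissipation of total weight nu delta.  By skew-symmetry,
b(w, w, u_(n+1)) = - b(w, u_(n+1), z) with z = beta1 u_n + beta0 u_(n-1), since
w - z is a multiple of u_(n+1).  The two-dimensional bound
b(u, v, z)^2 <= 1/2 |grad v|^2 |u| |grad u| |z| |grad z|  ([trilin_bound]), the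
bound |u_n| <= K2 and two applications of Young's inequality dominate this by
part of the dissipation plus a multiple of |grad w_n|^2
([convection_bound]); the sum of the latter is controlled by (iii).  The
forcing uses another eighth of the dissipation.  What remains telescopes
([step_gradient], [gradient_le]).

These estimates are purely algebraic consequences of the bilinear and trilinear
structure, collected in [energy_space].  The other half of the work is to show
that the Stokes form and the convection form on V really have this structure:

- the weak gradient is linear up to null sets, by uniqueness of weak
  derivatives, that is, by the fundamental lemma of the calculus of variations
  ([test_ae0]): bump functions built from exp(-1/t) approximate indicators of
  boxes, and boxes form a pi-system that generates the Borel sets;

- Ladyzhenskaya's inequality  int p^4 <= 1/2 |p|^2 |grad p|^2  holds in H^1_0:
  for a test function, 2 p(x, y)^2 is at most the integral of |2 p d_1 p| along
  the horizontal line and of |2 p d_2 p| along the vertical one, the product of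
  the two bounds is integrated by Tonelli ([test_ladyzhenskaya]), and the
  inequality passes to the closure by truncation ([H10_quartic]); it makes
  products of H^1_0 functions square integrable, so that b makes sense;

- b(w, v, z) = - b(w, z, v): for test functions this is div w = 0 tested against
  the product, again a test function, and both sides are continuous in the
  H^1 norm ([transport_antisym]). *)

(** * Square-integrable functions *)

(** The discriminant criterion; when [c = 0] the trinomial is affine, hence
constant. *)
Lemma sqr_le_of_quadratic_ge0 (R : realType) (a b c : R) :
  (forall t : R, 0 <= a + 2 * b * t + c * t ^+ 2) -> 0 <= c -> b ^+ 2 <= a * c.
Proof.
move=> h; rewrite le_eqVlt => /predU1P[c0|c0].
  rewrite -c0 mulr0; have [->|b0] := eqVneq b 0; first by rewrite expr0n.
  have := h (- (a + 1) / (2 * b)); rewrite -c0 mul0r addr0.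
  by rewrite mulrC mulfVK ?mulf_neq0// ?pnatr_eq0//; lra.
have := h (- b / c); have -> : a + 2 * b * (- b / c) + c * (- b / c) ^+ 2 =
   (a * c - b ^+ 2) / c by field; rewrite gt_eqF.
by rewrite pmulr_lge0 ?invr_gt0// subr_ge0.
Qed.

Section L2.
Context d (T : measurableType d) (R : realType).
Variables (mu : {measure set T -> \bar R}) (D : set T).
Hypothesis mD : measurable D.
Implicit Types p q r : T -> R.

Definition L2 p :=
  measurable_fun D p /\ mu.-integrable D (fun x => (p x ^+ 2)%:E).

Definition ip p q : R := \int[mu]_(x in D) (p x * q x).

(** From 2 |p q| <= p^2 + q^2. *)
Lemma L2_integrableM p q : L2 p -> L2 q ->
  mu.-integrable D (EFin \o (fun x => p x * q x)).
Proof.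
move=> [mp ip] [mq iq].
apply: (le_integrable mD) (integrableD mD ip iq).
  by apply/measurable_EFinP; exact: measurable_funM.
move=> x Dx /=; rewrite lee_fin normrM.
rewrite [leRHS]ger0_norm ?addr_ge0 ?sqr_ge0// -(real_normK (num_real (p x))) -(real_normK (num_real (q x))).
have := sqr_ge0 (`|p x| - `|q x|); have := normr_ge0 (p x); have := normr_ge0 (q x).
nra.
Qed.

Lemma L2Z (k : R) p : L2 p -> L2 (fun x => k * p x).
Proof.
move=> [mp ip]; split; first exact: measurable_funM.
have -> : (fun x => ((k * p x) ^+ 2)%:E) = (fun x => (k ^+ 2)%:E * (p x ^+ 2)%:E)%E.
  by apply/funext => x; rewrite exprMn EFinM.
exact: integrableZl.
Qed.

Lemma L2D p q : L2 p -> L2 q -> L2 (fun x => p x + q x).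
Proof.
move=> Lp Lq; have [mp i1] := Lp; have [mq i2] := Lq.
split; first exact: measurable_funD.
have i3 := L2_integrableM (L2Z 2 Lp) Lq.
have -> : (fun x => ((p x + q x) ^+ 2)%:E) =
   (fun x => (p x ^+ 2)%:E + (q x ^+ 2)%:E + (2 * p x * q x)%:E)%E.
  apply/funext => x; rewrite -!EFinD; congr EFin; ring.
apply: integrableD => //; exact: integrableD.
Qed.

Lemma L2N p : L2 p -> L2 (fun x => - p x).
Proof.
by move=> /(L2Z (-1)); under eq_fun do rewrite mulN1r.
Qed.

Lemma L2B p q : L2 p -> L2 q -> L2 (fun x => p x - q x).
Proof. by move=> Lp /L2N; exact: L2D. Qed.

Lemma L2_0 : L2 (fun=> 0).
Proof.
split; first exact: measurable_cst.
under eq_fun do rewrite expr0n/=; exact: integrable0.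
Qed.

Lemma ipC p q : ip p q = ip q p.
Proof. by apply: eq_Rintegral => x _; rewrite mulrC. Qed.

Lemma ipZl k p q : L2 p -> L2 q -> ip (fun x => k * p x) q = k * ip p q.
Proof.
move=> Lp Lq; rewrite /ip -RintegralZl//; last exact: L2_integrableM.
by apply: eq_Rintegral => x _; rewrite mulrA.
Qed.

Lemma ipDl p1 p2 q : L2 p1 -> L2 p2 -> L2 q ->
  ip (fun x => p1 x + p2 x) q = ip p1 q + ip p2 q.
Proof.
move=> L1 L3 Lq; rewrite /ip -RintegralD//; try exact: L2_integrableM.
by apply: eq_Rintegral => x _; rewrite mulrDl.
Qed.

Lemma ipNl p q : L2 p -> L2 q -> ip (fun x => - p x) q = - ip p q.
Proof.
by move=> Lp Lq; rewrite -mulN1r -ipZl//; apply: eq_Rintegral => x _; rewrite mulN1r.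
Qed.

Lemma ipBl p1 p2 q : L2 p1 -> L2 p2 -> L2 q ->
  ip (fun x => p1 x - p2 x) q = ip p1 q - ip p2 q.
Proof. by move=> L1 L3 Lq; rewrite ipDl ?ipNl//; exact: L2N. Qed.

Lemma ip_ge0 p : 0 <= ip p p.
Proof. by apply: Rintegral_ge0 => x _; exact: sqr_ge0. Qed.

Lemma ip_CS_sqr p q : L2 p -> L2 q -> ip p q ^+ 2 <= ip p p * ip q q.
Proof.
move=> Lp Lq; apply: sqr_le_of_quadratic_ge0 (ip_ge0 q) => t.
have := ip_ge0 (fun x => p x + t * q x).
have Ltq := L2Z t Lq.
have Ls := L2D Lp Ltq.
rewrite ipDl// ipZl// 2!(ipC _ (fun x => p x + t * q x)) !ipDl// !ipZl//.
by rewrite (ipC q p); congr (0 <= _); ring.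
Qed.

Lemma ip_CS p q : L2 p -> L2 q ->
  `|ip p q| <= Num.sqrt (ip p p) * Num.sqrt (ip q q).
Proof.
move=> Lp Lq; rewrite -sqrtrM ?ip_ge0// -sqrtr_sqr ler_wsqrtr//.
exact: ip_CS_sqr.
Qed.

Lemma ip_minkowski p q : L2 p -> L2 q ->
  Num.sqrt (ip (fun x => p x + q x) (fun x => p x + q x)) <=
  Num.sqrt (ip p p) + Num.sqrt (ip q q).
Proof.
move=> Lp Lq; have Lpq := L2D Lp Lq.
rewrite -(ger0_norm (addr_ge0 (sqrtr_ge0 (ip p p)) (sqrtr_ge0 (ip q q)))) -sqrtr_sqr ler_wsqrtr//.
rewrite ipDl// 2!(ipC _ (fun x => p x + q x)) !ipDl// (ipC q p).
have := ip_CS Lp Lq; have := sqr_sqrtr (ip_ge0 p); have := sqr_sqrtr (ip_ge0 q).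
set s1 := Num.sqrt _; set s2 := Num.sqrt _ => h1 h2 /ler_normlP[_].
rewrite -h1 -h2; nra.
Qed.

Lemma ae_ipl p1 p2 q : measurable_fun D p1 -> measurable_fun D p2 ->
  measurable_fun D q -> ae_eq mu D p1 p2 -> ip p1 q = ip p2 q.
Proof.
move=> m1 m2 mq h; rewrite /ip /Rintegral; congr fine.
apply: ae_eq_integral => //; try by apply/measurable_EFinP; exact: measurable_funM.
by apply: filterS h => x h Dx; rewrite h.
Qed.

Lemma ip_self_L2E p : L2 p -> (\int[mu]_(x in D) (p x ^+ 2)%:E = (ip p p)%:E)%E.
Proof.
move=> Lp; rewrite /ip /Rintegral fineK//.
by apply: integrable_fin_num => //; have := L2_integrableM Lp Lp.
Qed.

Lemma L2_lt_pinfty p : measurable_fun D p ->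
  (\int[mu]_(x in D) (p x ^+ 2)%:E < +oo)%E -> L2 p.
Proof.
move=> mp h; split=> //; apply/integrableP; split.
  by apply/measurable_EFinP; exact: measurable_funX.
by under eq_integral do rewrite gee0_abs ?lee_fin ?sqr_ge0//.
Qed.

Lemma L2_le p q : measurable_fun D p -> L2 q -> (forall x, D x -> `|p x| <= `|q x|) ->
  L2 p.
Proof.
move=> mp [mq iq] pq; split=> //; apply: (le_integrable mD) iq.
  by apply/measurable_EFinP; exact: measurable_funX.
move=> x Dx; rewrite /= lee_fin !normrX; apply: lerXn2r; rewrite ?nnegrE//.
exact: pq.
Qed.

End L2.

(** Monotonicity of the almost-everywhere filter, for an arbitrary measure. *)
Lemma ae_imp d (T : measurableType d) (R : realType) (mu : {measure set T -> \bar R})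
  (P Q : T -> Prop) : {ae mu, forall x, P x} -> (forall x, P x -> Q x) ->
  {ae mu, forall x, Q x}.
Proof. by move=> h PQ; apply: filterS h. Qed.

Lemma ae_imp2 d (T : measurableType d) (R : realType) (mu : {measure set T -> \bar R})
  (P P' Q : T -> Prop) : {ae mu, forall x, P x} -> {ae mu, forall x, P' x} ->
  (forall x, P x -> P' x -> Q x) -> {ae mu, forall x, Q x}.
Proof. by move=> h h' PQ; apply: filterS2 h h'. Qed.

(** * Open sets and boxes of the plane *)

Section planar.
Context {R : realType}.
Implicit Types (x : plane R) (p : sfield R).

Definition box (a b c d : R) : set (plane R) :=
  [set x | (a < x.1 < b) && (c < x.2 < d)].

Lemma boxE a b c d : box a b c d = `]a, b[%classic `*` `]c, d[%classic.
Proof.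
by apply/seteqP; split => -[x y]; rewrite /box /= !in_itv/= => /andP.
Qed.

Notation mplane := (measurableTypeR R * measurableTypeR R)%type.

Lemma box_measurable a b c d : measurable (box a b c d : set mplane).
Proof. by rewrite boxE; apply: measurableX; exact: measurable_itv. Qed.

(** The box is chosen inside a ball, with room to spare: that its closure stays in
[A] is what makes compactly supported bumps available on it. *)
Lemma open_rat_box (A : set (plane R)) x : open A -> A x ->
  exists q : rat * rat * (rat * rat),
    let B := box (ratr q.1.1) (ratr q.1.2) (ratr q.2.1) (ratr q.2.2) in
    B x /\ closure B `<=` A.
Proof.
move=> oA Ax; have /nbhs_ballP[e /= e0 eA] := open_nbhs_nbhs (conj oA Ax).
have rb (t : R) : exists q : rat * rat, [&& t - e < ratr q.1 :> R, ratr q.1 < t, t < ratr q.2 & ratr q.2 < t + e].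
  have [q1] := rat_in_itvoo (ltac:(lra) : t - e < t).
  have /rat_in_itvoo[q2]: t < t + e by rewrite ltrDl.
  rewrite !in_itv/= => /andP[h1 h2] /andP[h3 h4]; exists (q1, q2).
  by rewrite h1 h2 h3 h4.
have [[q1 q2] /=/and4P[a1 a2 a3 a4]] := rb x.1.
have [[q3 q4] /=/and4P[b1 b2 b3 b4]] := rb x.2.
exists ((q1, q2), (q3, q4)); split => /=.
  by rewrite /box /= a2 a3 b2 b3.
have cB : closed (`[ratr q1 : R, ratr q2]%classic `*` `[ratr q3 : R, ratr q4]%classic).
  apply: closedI; apply: preimage_closed; try exact: itv_closed.
    by move=> y _; exact: cvg_fst.
  by move=> y _; exact: cvg_snd.
apply: subset_trans eA.
apply: (@subset_trans _ (`[ratr q1 : R, ratr q2]%classic `*` `[ratr q3 : R, ratr q4]%classic)).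
  rewrite [X in _ `<=` X](closure_id _).1//; apply: closureS.
  move=> y; rewrite /box /= !in_itv/= => /andP[/andP[h1 h2] /andP[h3 h4]].
  by split; apply/andP; split; exact: ltW.
move=> y [/=]; rewrite !in_itv/= => /andP[h1 h2] /andP[h3 h4].
by split; rewrite /= -ball_normE /ball_ /= ltr_distl; apply/andP; split; lra.
Qed.

(** By [open_rat_box], an open set is a countable union of boxes. *)
Lemma open_measurable2 (A : set (plane R)) : open A -> measurable (A : set mplane).
Proof.
move=> oA.
pose B (q : rat * rat * (rat * rat)) := box (ratr q.1.1) (ratr q.1.2) (ratr q.2.1) (ratr q.2.2) : set (plane R).
have -> : A = \bigcup_q (if `[< B q `<=` A >] then B q else set0).
  apply/seteqP; split => [x /(open_rat_box oA)[q [Bx BA]]|x [q _]].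
    by exists q => //; rewrite asboolT//; apply: subset_trans BA; exact: subset_closure.
  by case: asboolP => // BA; exact: BA.
apply: countable_bigcupT_measurable => // q; case: ifP => _ //.
exact: box_measurable.
Qed.

Lemma continuous_measurable2 p : continuous p -> measurable_fun setT (p : mplane -> R).
Proof.
move=> cp; apply: (measurability _ (RGenOpens.measurableE R)).
move=> _ [_ [a [b ->] <-]]; rewrite setTI; apply: open_measurable2.
by move/continuousP : cp; apply; exact: interval_open.
Qed.

End planar.

(** * Smooth functions of two variables *)

Section smoothness.
Context {R : realType}.
Implicit Types (x : plane R) (p q : sfield R) (i : 'I_2).

Definition C0_derivable p := continuous p /\ forall x i, derivable p x (basis_vec i).

(** [Cn n] asks for [n] further partial derivatives; unlike [smooth], which
quantifies over words of derivations, it lends itself to induction. *)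
Fixpoint Cn n p := C0_derivable p /\
  if n is m.+1 then forall i, Cn m (partial i p) else True.

Lemma Cn_C0_derivable n p : Cn n p -> C0_derivable p.
Proof. by case: n => [|n] []. Qed.

Lemma Cn_partial n p i : Cn n.+1 p -> Cn n (partial i p).
Proof. by case=> _; exact. Qed.

Lemma CnS n p : Cn n.+1 p -> Cn n p.
Proof.
elim: n p => [|n IH] p hp; first by split=> //; exact: Cn_C0_derivable hp.
by split; [exact: Cn_C0_derivable hp|move=> i; apply/IH/Cn_partial].
Qed.

Lemma smoothE p : smooth p <-> forall n, Cn n p.
Proof.
split=> [sp n|sp s].
  elim: n p sp => [|n IH] p sp; first by split=> //; exact: (sp [::]).
  split; first exact: (sp [::]).
  by move=> i; apply: IH => s; have := sp (rcons s i); rewrite foldr_rcons.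
elim/last_ind: s p sp => [p sp|s j IH p sp]; first exact: Cn_C0_derivable (sp 0%N).
by rewrite foldr_rcons; apply: IH => n; exact/Cn_partial/sp.
Qed.

Lemma C0_derivableD p q : C0_derivable p -> C0_derivable q -> C0_derivable (p \+ q).
Proof.
by move=> [cp dp] [cq dq]; split=> [x|x i]; [apply: cvgD; [exact: cp|exact: cq]|exact: derivableD].
Qed.

Lemma C0_derivableM p q : C0_derivable p -> C0_derivable q -> C0_derivable (p \* q).
Proof.
by move=> [cp dp] [cq dq]; split=> [x|x i]; [apply: cvgM; [exact: cp|exact: cq]|exact: derivableM].
Qed.

Lemma CnD n p q : Cn n p -> Cn n q -> Cn n (p \+ q).
Proof.
elim: n p q => [|n IH] p q hp hq; have gp := Cn_C0_derivable hp; have gq := Cn_C0_derivable hq;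
  (split; first exact: C0_derivableD) => // i.
have -> : partial i (p \+ q) = partial i p \+ partial i q.
  by apply/funext => x; rewrite /partial deriveD//; [apply gp|apply gq].
by apply: IH; exact: Cn_partial.
Qed.

(** The Leibniz rule expresses a derivative of a product as a sum of two products
of the same kind, of lower order. *)
Lemma CnM n p q : Cn n p -> Cn n q -> Cn n (p \* q).
Proof.
elim: n p q => [|n IH] p q hp hq; have gp := Cn_C0_derivable hp; have gq := Cn_C0_derivable hq;
  (split; first exact: C0_derivableM) => // i.
have -> : partial i (p \* q) = (p \* partial i q) \+ (q \* partial i p).
  by apply/funext => x; rewrite /partial deriveM//; [apply gp|apply gq].
by apply: CnD; apply: IH; by [exact: CnS|exact: Cn_partial].
Qed.

Lemma Cn_cst n (k : R) : Cn n (cst k).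
Proof.
have gk (k' : R) : C0_derivable (cst k').
  by split=> [x|x i]; [exact: cvg_cst|exact: derivable_cst].
elim: n k => [|n IH] k; split => // i.
have -> : partial i (cst k) = cst 0 :> sfield R.
  by apply/funext => x; rewrite /partial derive_cst.
exact: IH.
Qed.

Lemma smoothD p q : smooth p -> smooth q -> smooth (p \+ q).
Proof. by move=> /smoothE hp /smoothE hq; apply/smoothE => n; exact: CnD. Qed.

Lemma smoothM p q : smooth p -> smooth q -> smooth (p \* q).
Proof. by move=> /smoothE hp /smoothE hq; apply/smoothE => n; exact: CnM. Qed.

Lemma smooth_cst (k : R) : smooth (cst k : sfield R).
Proof. by apply/smoothE => n; exact: Cn_cst. Qed.

Lemma smooth_partial i p : smooth p -> smooth (partial i p).
Proof. by move=> /smoothE hp; apply/smoothE => n; exact/Cn_partial/hp. Qed.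

Lemma smooth_continuous p : smooth p -> continuous p.
Proof. by case/(_ [::]). Qed.

Lemma smooth_derivable p x i : smooth p -> derivable p x (basis_vec i).
Proof. by case/(_ [::]). Qed.

Lemma partialD i p q : smooth p -> smooth q ->
  partial i (p \+ q) = partial i p \+ partial i q.
Proof.
by move=> sp sq; apply/funext => x; rewrite /partial deriveD//; exact: smooth_derivable.
Qed.

Lemma partialM i p q : smooth p -> smooth q ->
  partial i (p \* q) = (p \* partial i q) \+ (q \* partial i p).
Proof.
by move=> sp sq; apply/funext => x; rewrite /partial deriveM//; exact: smooth_derivable.
Qed.

(** The one-variable analogue of [Cn]; continuity is implied by derivability. *)
Fixpoint Cn1 n (H : R -> R) := (forall t, derivable H t 1) /\
  if n is m.+1 then Cn1 m (derive1 H) else True.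

Lemma derive_fst0 (H : R -> R) x : derivable H x.1 1 ->
  derivable (fun y : plane R => H y.1) x (basis_vec ord0) /\
  partial ord0 (fun y => H y.1) x = derive1 H x.1.
Proof. by rewrite derive1E; split. Qed.

Lemma derive_snd1 (H : R -> R) x : derivable H x.2 1 ->
  derivable (fun y : plane R => H y.2) x (basis_vec ord_max) /\
  partial ord_max (fun y => H y.2) x = derive1 H x.2.
Proof. by rewrite derive1E; split. Qed.

Lemma derive_fst1 (H : R -> R) x :
  derivable (fun y : plane R => H y.1) x (basis_vec ord_max) /\
  partial ord_max (fun y => H y.1) x = 0.
Proof.
have [h1 h2] : is_derive x (basis_vec ord_max : plane R) (fun y : plane R => H y.1) 0.
  split.
    rewrite /derivable; apply/cvg_ex; exists 0.
    apply: cvg_near_cst; near=> h; rewrite /= scaler0 add0r subrr scaler0//.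
  rewrite /derive; apply: cvg_lim => //.
  apply: cvg_near_cst; near=> h; rewrite /= scaler0 add0r subrr scaler0//.
by [].
Unshelve. all: by end_near. Qed.

Lemma derive_snd0 (H : R -> R) x :
  derivable (fun y : plane R => H y.2) x (basis_vec ord0) /\
  partial ord0 (fun y => H y.2) x = 0.
Proof.
have [h1 h2] : is_derive x (basis_vec ord0 : plane R) (fun y : plane R => H y.2) 0.
  split.
    rewrite /derivable; apply/cvg_ex; exists 0.
    apply: cvg_near_cst; near=> h; rewrite /= scaler0 add0r subrr scaler0//.
  rewrite /derive; apply: cvg_lim => //.
  apply: cvg_near_cst; near=> h; rewrite /= scaler0 add0r subrr scaler0//.
by [].
Unshelve. all: by end_near. Qed.

Lemma ord2P (P : 'I_2 -> Prop) : P ord0 -> P ord_max -> forall i, P i.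
Proof.
by move=> P0 P1 [[|[|//]] h]; [move: P0|move: P1]; congr P; apply/val_inj.
Qed.

Lemma Cn1_derivable n H : Cn1 n H -> forall t, derivable H t 1.
Proof. by case: n => [|n] []. Qed.

Lemma Cn1_derive n H : Cn1 n.+1 H -> Cn1 n (derive1 H).
Proof. by case. Qed.

Lemma smooth_fst (H : R -> R) : (forall n, Cn1 n H) -> smooth (fun y : plane R => H y.1).
Proof.
move=> hH; apply/smoothE => n; move: (hH n) => {hH}; elim: n H => [|n IH] H hH;
  have dH := Cn1_derivable hH.
all: split; first by
  split=> [x|x i]; [apply: continuous_comp; [exact: cvg_fst|
   apply/differentiable_continuous/derivable1_diffP; exact: dH] |
   elim/ord2P: i; [apply derive_fst0|apply derive_fst1]].
all: rewrite //.
elim/ord2P.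
  have -> : partial ord0 (fun y : plane R => H y.1) = (fun y => derive1 H y.1).
    by apply/funext => x; apply derive_fst0.
  exact/IH/Cn1_derive.
have -> : partial ord_max (fun y : plane R => H y.1) = cst 0.
  by apply/funext => x; apply derive_fst1.
exact: Cn_cst.
Qed.

Lemma smooth_snd (H : R -> R) : (forall n, Cn1 n H) -> smooth (fun y : plane R => H y.2).
Proof.
move=> hH; apply/smoothE => n; move: (hH n) => {hH}; elim: n H => [|n IH] H hH;
  have dH := Cn1_derivable hH.
all: split; first by
  split=> [x|x i]; [apply: continuous_comp; [exact: cvg_snd|
   apply/differentiable_continuous/derivable1_diffP; exact: dH] |
   elim/ord2P: i; [apply derive_snd0|apply derive_snd1]].
all: rewrite //.
elim/ord2P.
  have -> : partial ord0 (fun y : plane R => H y.2) = cst 0.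
    by apply/funext => x; apply derive_snd0.
  exact: Cn_cst.
have -> : partial ord_max (fun y : plane R => H y.2) = (fun y => derive1 H y.2).
  by apply/funext => x; apply derive_snd1.
exact/IH/Cn1_derive.
Qed.

(** With this and [vertical_derive] the one-variable calculus applies to a
function of two variables along lines. *)
Lemma horizontal_derive p x : derivable p x (basis_vec ord0) ->
  derivable (fun t => p (t, x.2)) x.1 1 /\
  derive1 (fun t => p (t, x.2)) x.1 = partial ord0 p x.
Proof.
rewrite derive1E /partial /derivable /derive /=.
have -> : (fun h : R => h^-1 *: ((p \o shift x) (h *: basis_vec ord0) - p x)) =
  (fun h : R => h^-1 *: (((fun t => p (t, x.2)) \o shift x.1) (h *: (1 : R)) - p (x.1, x.2))).
  apply/funext => h /=; rewrite -surjective_pairing; congr (_ *: (p _ - _)).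
  by case: x => a b; congr pair; rewrite /= scaler0 add0r.
by split.
Qed.

Lemma vertical_derive p x : derivable p x (basis_vec ord_max) ->
  derivable (fun t => p (x.1, t)) x.2 1 /\
  derive1 (fun t => p (x.1, t)) x.2 = partial ord_max p x.
Proof.
rewrite derive1E /partial /derivable /derive /=.
have -> : (fun h : R => h^-1 *: ((p \o shift x) (h *: basis_vec ord_max) - p x)) =
  (fun h : R => h^-1 *: (((fun t => p (x.1, t)) \o shift x.2) (h *: (1 : R)) - p (x.1, x.2))).
  apply/funext => h /=; rewrite -surjective_pairing; congr (_ *: (p _ - _)).
  by case: x => a b; congr pair; rewrite /= scaler0 add0r.
by split.
Qed.

End smoothness.

(** * A smooth function that vanishes on a half-line *)

Section flat.
Context {R : realType}.
Implicit Types (t k a b : R) (H : R -> R).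

Lemma Cn1D n (H K : R -> R) : Cn1 n H -> Cn1 n K -> Cn1 n (H \+ K).
Proof.
elim: n H K => [|n IH] H K hH hK; have dH := Cn1_derivable hH; have dK := Cn1_derivable hK;
  (split; first by move=> t; exact: derivableD) => //.
have -> : derive1 (H \+ K) = derive1 H \+ derive1 K.
  by apply/funext => t; rewrite /= !derive1E deriveD.
by apply: IH; exact: Cn1_derive.
Qed.

Lemma Cn1Z n k (H : R -> R) : Cn1 n H -> Cn1 n (k \*: H).
Proof.
elim: n H => [|n IH] H hH; have dH := Cn1_derivable hH;
  (split; first by move=> t; exact: derivableZ) => //.
have -> : derive1 (k \*: H) = k \*: derive1 H.
  by apply/funext => t; rewrite /= !derive1E deriveZ.
by apply: IH; exact: Cn1_derive.
Qed.

Lemma Cn1_affine n k b H : Cn1 n H -> Cn1 n (fun t => H (k * t + b)).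
Proof.
have key (H' : R -> R) t : derivable H' (k * t + b) 1 ->
    is_derive t (1 : R) (fun t => H' (k * t + b)) (k * derive1 H' (k * t + b)).
  move=> dH; rewrite derive1E.
  have h1 : is_derive t (1 : R) (fun t => k * t + b) k.
    apply: (@is_derive_eq _ _ _ ((k \*: (id : R -> R)) + cst b : R -> R)).
    by rewrite addr0 /GRing.scale/= mulr1.
  have h2 : is_derive (k * t + b) (1 : R) H' ('D_1 H' (k * t + b)).
    exact: derivableP.
  have := @is_derive1_comp R H' (fun t => k * t + b) t _ _ h2 h1.
  by rewrite mulrC.
elim: n H => [|n IH] H hH; have dH := Cn1_derivable hH;
  (split; first by move=> t; have [] := key H t (dH _)) => //.
have -> : derive1 (fun t => H (k * t + b)) = k \*: (fun t => derive1 H (k * t + b)).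
  by apply/funext => t; rewrite derive1E; have [_ ->] := key H t (dH _).
by apply/Cn1Z/IH/Cn1_derive.
Qed.

(** The functions t^-m exp(-1/t), extended by 0: their linear span is stable under
derivation, so all its members are infinitely differentiable. *)
Definition flat (m : nat) t : R :=
  if 0 < t then t^-1 ^+ m * expR (- t^-1) else 0.

(** With x = 1/t this reads x^(m+1) <= (m+1)! exp(x), a term of the exponential
series.  It gives continuity, and derivability with derivative 0, at the origin. *)
Lemma flat_le m t : 0 <= t -> 0 <= flat m t <= m.+1`!%:R * t.
Proof.
rewrite /flat le_eqVlt => /predU1P[<-|t0]; first by rewrite ltxx mulr0 lexx.
rewrite t0 mulr_ge0 ?expR_ge0 ?exprn_ge0 ?invr_ge0 ?(ltW t0)//=.
have ti : 0 < t^-1 by rewrite invr_gt0.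
have := expR_ge1Dxn m (ltW ti) => h.
have {h}: t^-1 ^+ m.+1 / m.+1`!%:R <= expR t^-1 by apply: le_trans h; rewrite lerDr.
have f0 : 0 < m.+1`!%:R :> R by rewrite ltr0n fact_gt0.
rewrite ler_pdivrMr// expRN => h.
rewrite ler_pdivrMr ?expR_gt0//.
rewrite -(ler_pM2l ti) mulrA -exprS (le_trans h)// -subr_ge0 le_eqVlt; apply/orP; left.
by apply/eqP; field; rewrite gt_eqF.
Qed.

Lemma is_derive_flat m t : is_derive t (1 : R) (flat m) (flat m.+2 t - m%:R * flat m.+1 t).
Proof.
have [t0|t0|->] := ltgtP t 0.
- have -> : flat m.+2 t - m%:R * flat m.+1 t = 0.
    by rewrite /flat ltNge ltW//= mulr0 subr0.
  apply: (@near_eq_is_derive _ _ _ (cst 0)).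
  near=> s; rewrite /flat ltNge ltW//=; near: s; exact: lt_nbhsl.
- apply: (@near_eq_is_derive _ _ _ (fun t => t^-1 ^+ m * expR (- t^-1))).
    near=> s; rewrite /flat ifT//; near: s; exact: lt_nbhsr.
  have h1 : is_derive t (1 : R) (fun s => s^-1) (- t ^- 2).
    apply: (is_derive_eq (is_deriveV _ (is_derive_id t (1 : R)))); first by rewrite gt_eqF.
    by rewrite /GRing.scale/= mulr1.
  have h2 : is_derive t (1 : R) (fun s => - s^-1) (t ^- 2).
    by apply: is_derive_eq; rewrite opprK.
  have h3 := @is_derive1_comp R expR (fun s => - s^-1) t _ _ (is_derive_expR (- t^-1)) h2.
  have h4 : is_derive t (1 : R) (fun s => s^-1 ^+ m) ((m%:R * t^-1 ^+ m.-1) * (- t ^- 2)).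
    have -> : (fun s : R => s^-1 ^+ m) = (fun s => s^-1) ^+ m.
      by apply/funext => s; rewrite exprfctE.
    apply: is_derive_eq.
    by rewrite /GRing.scale/= mulr_natl.
  apply: (is_derive_eq (is_deriveM h4 h3)).
  rewrite /flat t0 /GRing.scale /=.
  case: m {h4} => [|m]; rewrite ?expr0 /=; rewrite !exprS ?expr0; field; rewrite gt_eqF//.
- have -> : flat m.+2 0 - m%:R * flat m.+1 0 = 0.
    by rewrite /flat ltxx mulr0 subr0.
  have l0 : (fun h : R => h^-1 *: ((flat m \o shift 0) (h *: (1 : R)) - flat m 0)) @ 0^' --> (0 : R).
    apply/cvgrPdist_le => e e0; near=> h.
    rewrite /= sub0r normrN addr0 /GRing.scale/= mulr1.
    rewrite {2}/flat ltxx subr0.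
    have [h0|h0] := ltP 0 h; last by rewrite /flat ltNge h0/= mulr0 normr0 ltW.
    have -> : h^-1 * flat m h = flat m.+1 h by rewrite /flat h0 exprS mulrA.
    have /andP[f1 f2] := flat_le m.+1 (ltW h0).
    rewrite ger0_norm// (le_trans f2)// mulrC -ler_pdivlMr ?ltr0n ?fact_gt0//.
    rewrite (le_trans (ler_norm _))//; near: h.
    apply: dnbhs0_le; rewrite divr_gt0// ltr0n fact_gt0//.
  by split; [apply/cvg_ex; exists 0|exact: cvg_lim].
Unshelve. all: by end_near. Qed.

Lemma Cn1_flat n m : Cn1 n (flat m).
Proof.
elim: n m => [|n IH] m; (split; first by move=> t; have [] := is_derive_flat m t) => //.
have -> : derive1 (flat m) = flat m.+2 \+ ((- m%:R) \*: flat m.+1).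
  by apply/funext => t; rewrite derive1E; have [_ ->] := is_derive_flat m t;
  rewrite /= /GRing.scale/= mulNr.
by apply: Cn1D => //; exact: Cn1Z.
Qed.

End flat.

(** * Integrals over boxes determine a function *)

Section dynkin_zero.
Local Open Scope ereal_scope.
Context d d' (T : measurableType d) (T' : measurableType d') (R : realType).
Variables (mu : {measure set T -> \bar R}) (K : set T) (g : T -> \bar R).
Hypotheses (mK : measurable K) (ig : mu.-integrable K g).

(** The sets with vanishing integral form a lambda-system, so that Dynkin's theorem
applies; the map [pi] lets the same argument serve for one coordinate and for
the plane. *)
Lemma integral_eq0_pi (pi : T -> T') (G : set (set T')) :
  measurable_fun setT pi -> @measurable _ T' = <<s G >> -> setI_closed G ->
  \int[mu]_(x in K) g x = 0 ->
  (forall E, G E -> \int[mu]_(x in K `&` pi @^-1` E) g x = 0) ->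
  forall E, measurable E -> \int[mu]_(x in K `&` pi @^-1` E) g x = 0.
Proof.
move=> mpi GE GI K0 G0 E mE.
have mp (A : set T') : measurable A -> measurable (K `&` pi @^-1` A).
  by move=> mA; rewrite -[X in measurable (_ `&` X)]setTI; apply: measurableI => //; exact: mpi.
apply: (dynkin_induction (P := fun E => \int[mu]_(x in K `&` pi @^-1` E) g x = 0) GE GI) => //.
- by rewrite preimage_setT setIT.
- move=> S mS S0.
  have := @integral_setU _ _ _ mu (K `&` pi @^-1` S) (K `&` pi @^-1` (~` S)) g (mp _ mS) (mp _ (measurableC mS)).
  rewrite -setIUr preimage_setC setUv setIT K0 S0 add0e => -> //.
    exact: measurable_int ig.
  apply/disj_setPS => x [[_ a] [_ b]]; exact: b.
- move=> F mF tF F0.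
  rewrite preimage_bigcup setI_bigcupr integral_bigcup//; last 3 first.
  + move/trivIsetP : tF => tF; apply/trivIsetP => i j _ _ ij.
    rewrite -subset0 => x [[_ a] [_ b]]; have := tF i j I I ij.
    by rewrite -subset0; apply; split; [exact: a|exact: b].
  + by move=> k; exact: mp.
  + apply: integrableS ig => //; first by apply: bigcup_measurable => k _; exact: mp.
    by move=> x [k _ []].
  by rewrite eseries0.
- by rewrite -GE.
Qed.

End dynkin_zero.

Section planar_zero.
Context {R : realType}.
Notation mplane := (measurableTypeR R * measurableTypeR R)%type.
Notation mu := (@leb2 R).

(** One coordinate at a time: from boxes to Borel sets times intervals, then to
products of Borel sets, which generate the Borel sets of the plane. *)
Lemma integral_boxes_eq0 (a b c d : R) (g : mplane -> \bar R) :
  mu.-integrable (box a b c d) g ->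
  (forall a' b' c' d' : R,
    (\int[mu]_(x in box a b c d `&` box a' b' c' d') g x = 0)%E) ->
  ae_eq mu (box a b c d) g (cst 0%E).
Proof.
move=> ig g0.
set Q := box a b c d; have mQ : measurable (Q : set mplane) := box_measurable a b c d.
pose itvs : set (set (measurableTypeR R)) := [set A | exists x y, A = `]x, y[%classic].
have itvsE : @measurable _ (measurableTypeR R) = <<s itvs >> by exact: (RGenOpens.measurableE R).
have itvsI : setI_closed itvs.
  move=> _ _ [x [y ->]] [x' [y' ->]]; exists (Num.max x x'), (Num.min y y').
  apply/seteqP; split => z /=; rewrite !in_itv/= gt_max lt_min.
    by move=> [/andP[-> ->] /andP[-> ->]].
  by move=> /andP[/andP[-> ->] /andP[-> ->]].
have mI (A : set (measurableTypeR R)) : itvs A -> measurable A.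
  by move=> [x [y ->]]; exact: measurable_itv.
have mfst (A : set (measurableTypeR R)) : measurable A -> measurable (Q `&` (fst : mplane -> _) @^-1` A).
  move=> mA; apply: measurableI => //; rewrite -[X in measurable X]setTI; exact: measurable_fst.
have msnd (A : set (measurableTypeR R)) : measurable A -> measurable (Q `&` (snd : mplane -> _) @^-1` A).
  move=> mA; apply: measurableI => //; rewrite -[X in measurable X]setTI; exact: measurable_snd.
have igS (A : set mplane) : measurable (Q `&` A) -> mu.-integrable (Q `&` A) g.
  by move=> mA; apply: integrableS ig => //; exact: subIsetl.
have boxI x y x' y' : Q `&` ((fst : mplane -> R) @^-1` `]x, y[ `&` (snd : mplane -> R) @^-1` `]x', y'[) =
    Q `&` box x y x' y'.
  congr (_ `&` _); apply/seteqP; split => z /=; rewrite /box /= !in_itv/=; first by move=> [-> ->].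
  by move/andP.
have QQ : Q = Q `&` box a b c d by rewrite setIid.
(* The second coordinate stays in an interval while the first one ranges over Borel
   sets. *)
have step1 J : itvs J -> forall A, measurable A ->
    (\int[mu]_(x in (Q `&` snd @^-1` J) `&` fst @^-1` A) g x = 0)%E.
  move=> iJ A mA.
  have mJ := mI _ iJ.
  have H := @integral_eq0_pi _ _ _ (measurableTypeR R) R mu _ g (msnd _ mJ) (igS _ (msnd _ mJ)) fst itvs (@measurable_fst _ _ _ _) itvsE itvsI.
  apply: H => //.
    move: iJ => [x [y ->]].
    have -> : Q `&` (snd : mplane -> R) @^-1` `]x, y[ = Q `&` box a b x y.
      rewrite -boxI; apply/seteqP; split => z /=; last by move=> [Qz []].
      by move=> [Qz ->]; split => //; split => //; move: Qz; rewrite /Q /box/= in_itv/= => /andP[].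
    exact: g0.
  move=> _ [x' [y' ->]]; move: iJ => [x [y ->]].
  by rewrite -setIA [X in Q `&` X]setIC boxI; exact: g0.
(* Now the first coordinate is fixed in a Borel set. *)
have step2 A : measurable A -> forall B, measurable B ->
    (\int[mu]_(x in (Q `&` fst @^-1` A) `&` snd @^-1` B) g x = 0)%E.
  move=> mA B mB.
  have H := @integral_eq0_pi _ _ _ (measurableTypeR R) R mu _ g (mfst _ mA) (igS _ (mfst _ mA)) snd itvs (@measurable_snd _ _ _ _) itvsE itvsI.
  apply: H => //.
    have := step1 `]c, d[%classic (ex_intro _ c (ex_intro _ d erefl)) A mA.
    congr (integral _ _ _ = _); congr (_ `&` _); apply/seteqP; split=> z /=; first by case.
    by move=> Qz; split=> //; move: Qz; rewrite /Q /box/= in_itv/= => /andP[].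
  by move=> J iJ; rewrite -setIA [X in Q `&` X]setIC setIA; exact: step1.
have step3 (E : set mplane) : measurable E -> (\int[mu]_(x in Q `&` id @^-1` E) g x = 0)%E.
  have H := @integral_eq0_pi _ _ mplane mplane R mu _ g mQ ig id _ (@measurable_id _ _ _) (measurable_prod_measurableType _ _).
  apply: H.
  - move=> _ _ [A mA [B mB <-]] [A' mA' [B' mB' <-]].
    exists (A `&` A'); first exact: measurableI.
    exists (B `&` B'); first exact: measurableI.
    by rewrite setXI.
  - by rewrite QQ; exact: g0.
  - move=> _ [A mA [B mB <-]]; have := step2 A mA B mB.
    by rewrite -setIA.
apply: (integral_ae_eq mQ ig) => // E EQ mE.
by rewrite integral0 -(setIidr EQ); exact: step3.
Qed.

End planar_zero.

(** * Test functions and bumps *)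

Section tests.
Context {R : realType}.
Variable Omega : set (plane R).
Hypothesis oO : open Omega.
Implicit Types (x : plane R) (p q phi psi : sfield R).
Notation mplane := (measurableTypeR R * measurableTypeR R)%type.
Notation mu := (@leb2 R).

Let mO : measurable (Omega : set mplane) := open_measurable2 oO.

Lemma test_sub phi (K : set (plane R)) : smooth phi -> compact K ->
  K `<=` Omega -> (forall x, ~ K x -> phi x = 0) -> test_function Omega phi.
Proof.
move=> sphi cK KO phi0.
have clK : closed K by apply: compact_closed => //; exact: norm_hausdorff.
have sK : closure [set x | phi x != 0] `<=` K.
  rewrite (closure_id K).1//; apply: closureS => x /= /eqP; apply: contra_notP; exact: phi0.
split=> //; last exact: subset_trans KO.
by apply: subclosed_compact sK => //; exact: closed_closure.
Qed.

Lemma test_supp0 phi x : ~ closure [set x | phi x != 0] x -> phi x = 0.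
Proof. by apply: contra_notP => /eqP ?; exact: subset_closure. Qed.

Lemma testM phi psi : test_function Omega phi -> test_function Omega psi ->
  test_function Omega (phi \* psi).
Proof.
move=> [s1 c1 o1] [s2 c2 o2]; apply: (test_sub _ c1 o1); first exact: smoothM.
by move=> x /test_supp0 /= ->; rewrite mul0r.
Qed.

Lemma testD phi psi : test_function Omega phi -> test_function Omega psi ->
  test_function Omega (phi \+ psi).
Proof.
move=> [s1 c1 o1] [s2 c2 o2]; apply: (test_sub _ (compactU c1 c2)); first exact: smoothD.
  by move=> x [/o1|/o2].
by move=> x /not_orP[/test_supp0 /= -> /test_supp0 ->]; rewrite addr0.
Qed.

Lemma testZ (k : R) phi : test_function Omega phi ->
  test_function Omega (fun x => k * phi x).
Proof.
move=> [s1 c1 o1]; apply: (test_sub _ c1 o1); first by apply: smoothM => //; exact: smooth_cst.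
by move=> x /test_supp0 /= ->; rewrite mulr0.
Qed.

(** Outside the support, which is closed, the function vanishes near the point. *)
Lemma test_partial i phi : test_function Omega phi ->
  test_function Omega (partial i phi).
Proof.
move=> [s1 c1 o1]; apply: (test_sub _ c1 o1); first exact: smooth_partial.
move=> x nx; rewrite /partial (@near_eq_derive _ _ _ _ (cst 0)) ?derive_cst//.
have : nbhs x (~` closure [set x | phi x != 0]).
  by apply: open_nbhs_nbhs; split => //; apply: closed_openC; exact: closed_closure.
by apply: filterS => y /test_supp0.
Qed.

Lemma test_box phi : test_function Omega phi ->
  exists2 M : R, 0 < M & forall x, ~~ ((- M < x.1 < M) && (- M < x.2 < M)) -> phi x = 0.
Proof.
move=> [s1 c1 o1]; have [M [_ hM]] := compact_bounded c1.
exists (`|M| + 2); first by rewrite ltr_wpDl.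
move=> x; apply: contraNP => /eqP phi0.
have /= : `|x| <= `|M| + 1.
  apply: hM; last exact: subset_closure.
  by rewrite (le_lt_trans (ler_norm _))// ltrDl.
rewrite prod_normE ge_max => /andP[h1 h2].
move: h1 h2; rewrite !ler_norml => /andP[a1 a2] /andP[b1 b2].
by apply/andP; split; apply/andP; split; lra.
Qed.

Lemma test_bounded phi : test_function Omega phi ->
  exists2 C : R, 0 < C & forall x, `|phi x| <= C.
Proof.
move=> [s1 c1 o1].
have /compact_bounded[M [_ hM]] : compact (phi @` closure [set x | phi x != 0]).
  apply: continuous_compact => //; apply: continuous_subspaceT.
  exact: smooth_continuous.
exists (`|M| + 1); first by rewrite ltr_wpDl.
move=> x; have [xS|/test_supp0 ->] := pselect (closure [set x | phi x != 0] x); last first.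
  by rewrite normr0 addr_ge0.
apply: hM; last by exists x.
by rewrite (le_lt_trans (ler_norm _))// ltrDl.
Qed.

Lemma box_finite (a b c d : R) : (mu (box a b c d : set mplane) < +oo)%E.
Proof.
have -> : (mu (box a b c d : set mplane) = lebesgue_measure (`]a, b[%classic : set R) * lebesgue_measure (`]c, d[%classic : set R))%E.
  by rewrite boxE; apply: product_measure1E; exact: measurable_itv.
rewrite !lebesgue_measure_itv /=; do 2 (case: ifP => _); by rewrite ?mul0e ?mule0 -?EFinB -?EFinM ltry.
Qed.

(** Domination by a constant multiple of the indicator of a box. *)
Lemma continuous_box_L2 p (M C : R) : continuous p -> (forall x, `|p x| <= C) ->
  (forall x, ~~ ((- M < x.1 < M) && (- M < x.2 < M)) -> p x = 0) ->
  L2 mu (setT : set mplane) p.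
Proof.
move=> cp bp sp; have mp := continuous_measurable2 cp.
have C0 : 0 <= C := le_trans (normr_ge0 _) (bp (0, 0)).
apply: L2_lt_pinfty => //.
apply: (@le_lt_trans _ _ (\int[mu]_(x in [set: mplane]) ((C ^+ 2 * \1_(box (- M) M (- M) M) x)%:E))%E).
  apply: ge0_le_integral => //.
  - by move=> x _; rewrite lee_fin sqr_ge0.
  - by apply/measurable_EFinP; exact: measurable_funX.
  - apply/measurable_EFinP; apply: measurable_funM => //.
    apply: measurable_indic; exact: box_measurable.
  move=> x _; rewrite lee_fin indicE.
  have [xB|xB] := boolP (x \in box (- M) M (- M) M).
    by rewrite mulr1 -real_normK ?num_real// lerXn2r ?nnegrE.
  rewrite sp ?expr0n ?mulr0//=.
  by apply: contra xB => xB; rewrite inE.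
under eq_integral do rewrite EFinM.
rewrite ge0_integralZl//.
- rewrite integral_indic//; last exact: box_measurable.
  by rewrite setIT lte_mul_pinfty// ?lee_fin ?sqr_ge0// box_finite.
- by apply/measurable_EFinP/measurable_indic; exact: box_measurable.
- by rewrite lee_fin sqr_ge0.
Qed.

Lemma test_L2T phi : test_function Omega phi -> L2 mu (setT : set mplane) phi.
Proof.
move=> tphi; have [M _ sM] := test_box tphi; have [C _ bC] := test_bounded tphi.
apply: continuous_box_L2 bC sM; by case: tphi => /smooth_continuous.
Qed.

Lemma L2_subset p (A B : set mplane) : measurable A -> measurable B -> B `<=` A -> L2 mu A p -> L2 mu B p.
Proof.
move=> mA mB BA [mp ip]; split; first exact: measurable_funS mp.
exact: integrableS ip.
Qed.

Lemma test_L2 phi : test_function Omega phi -> L2 mu Omega phi.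
Proof. by move=> tphi; exact: L2_subset (test_L2T tphi). Qed.

Lemma test_eq0 phi x : test_function Omega phi -> ~ Omega x -> phi x = 0.
Proof. by move=> [_ _ o1] nx; apply: test_supp0 => /o1. Qed.

Lemma integral_testT phi (h : R -> R) : test_function Omega phi -> h 0 = 0 ->
  (\int[mu]_(x in Omega) (h (phi x))%:E = \int[mu]_(x in [set: mplane]) (h (phi x))%:E)%E.
Proof.
move=> tphi h0; rewrite integral_mkcond; apply: eq_integral => x _.
rewrite patchE; case: ifPn => // /negP; rewrite inE => nx.
by rewrite (test_eq0 tphi nx) h0.
Qed.

Lemma integral_testMT phi psi : test_function Omega phi ->
  \int[mu]_(x in Omega) (phi x * psi x) = \int[mu]_(x in [set: mplane]) (phi x * psi x).
Proof.
move=> tphi; rewrite Rintegral_mkcond; apply: eq_Rintegral => x _.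
rewrite patchE; case: ifPn => // /negP; rewrite inE => nx.
by rewrite (test_eq0 tphi nx) mul0r.
Qed.

(** By scaling the arguments of [flat], these functions, supported by the box,
increase to its indicator as [k] grows. *)
Definition box_bump (a b c d : R) (k : nat) : sfield R := fun x =>
  flat 0 (k.+1%:R * x.1 + - (k.+1%:R * a)) * flat 0 (- k.+1%:R * x.1 + k.+1%:R * b) *
  (flat 0 (k.+1%:R * x.2 + - (k.+1%:R * c)) * flat 0 (- k.+1%:R * x.2 + k.+1%:R * d)).

Lemma flat01 (t : R) : 0 <= flat 0 t <= 1.
Proof.
rewrite /flat; case: ifPn => t0; rewrite ?lexx ?ler01// expr0 mul1r expR_ge0/=.
by rewrite expR_le1 lerNl oppr0 invr_ge0 ltW.
Qed.

Lemma smooth_box_bump a b c d k : smooth (box_bump a b c d k).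
Proof.
have hf (u v : R) n : Cn1 n (fun t : R => flat 0 (u * t + v)) by apply/Cn1_affine/Cn1_flat.
apply: smoothM; apply: smoothM.
- by apply: (@smooth_fst _ (fun t => flat 0 (_ * t + _))) => n; exact: hf.
- by apply: (@smooth_fst _ (fun t => flat 0 (_ * t + _))) => n; exact: hf.
- by apply: (@smooth_snd _ (fun t => flat 0 (_ * t + _))) => n; exact: hf.
- by apply: (@smooth_snd _ (fun t => flat 0 (_ * t + _))) => n; exact: hf.
Qed.

Lemma box_bump_norm_le1 a b c d k x : `|box_bump a b c d k x| <= 1.
Proof.
have h t : `|flat 0 t| <= 1 :> R by have /andP[? ?] := flat01 t; rewrite ger0_norm.
by rewrite /box_bump !normrM !mulr_ile1// mulr_ge0.
Qed.

Lemma box_bump_eq0 a b c d k x : ~ box a b c d x -> box_bump a b c d k x = 0.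
Proof.
move=> nx; have k0 : 0 < k.+1%:R :> R by rewrite ltr0n.
have f0 (t : R) : t <= 0 -> flat 0 t = 0 by move=> t0; rewrite /flat ltNge t0.
have [h1|h1] := leP x.1 a.
  by rewrite /box_bump [flat 0 (_ * x.1 + - _)]f0 ?mul0r// -mulrBr pmulr_rle0// subr_le0.
have [h2|h2] := leP b x.1.
  by rewrite /box_bump [flat 0 (- _ * x.1 + _)]f0 ?mul0r ?mulr0 ?mul0r// mulNr addrC -mulrBr pmulr_rle0// subr_le0.
have [h3|h3] := leP x.2 c.
  by rewrite /box_bump [flat 0 (_ * x.2 + - _)]f0 ?mul0r ?mulr0// -mulrBr pmulr_rle0// subr_le0.
have [h4|h4] := leP d x.2.
  by rewrite /box_bump [flat 0 (- _ * x.2 + _)]f0 ?mul0r ?mulr0// mulNr addrC -mulrBr pmulr_rle0// subr_le0.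
by case: nx; rewrite /box /= h1 h2 h3 h4.
Qed.

Lemma flat_cvg1 (t : R) : 0 < t -> flat 0 (k.+1%:R * t) @[k --> \oo] --> (1 : R).
Proof.
move=> t0.
have -> : (fun k : nat => flat 0 (k.+1%:R * t)) = (fun k => expR (- (t^-1 * k.+1%:R^-1))).
  apply/funext => k; rewrite /flat mulr_gt0 ?ltr0n// expr0 mul1r invfM.
  by rewrite mulrC.
rewrite -[X in _ --> X]expR0 -[X in _ --> expR X]oppr0 -[X in _ --> expR (- X)](mulr0 t^-1).
apply: (@cvg_comp _ _ _ _ expR _ (nbhs (- (t^-1 * 0)))); last exact: continuous_expR.
apply: cvgN; apply: cvgM; first exact: cvg_cst.
exact: cvg_harmonic.
Qed.

Lemma box_bump_cvg1 a b c d x : box a b c d x ->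
  box_bump a b c d k x @[k --> \oo] --> (1 : R).
Proof.
move=> /andP[/andP[h1 h2] /andP[h3 h4]].
suff : box_bump a b c d k x @[k --> \oo] --> (1 * 1 * (1 * 1) : R) by rewrite !mulr1.
have e1 (y z : R) : (fun k : nat => flat 0 (k.+1%:R * y + - (k.+1%:R * z))) = (fun k => flat 0 (k.+1%:R * (y - z))).
  by apply/funext => k; rewrite mulrBr.
have e2 (y z : R) : (fun k : nat => flat 0 (- k.+1%:R * y + k.+1%:R * z)) = (fun k => flat 0 (k.+1%:R * (z - y))).
  by apply/funext => k; rewrite mulrBr mulNr addrC.
by rewrite /box_bump; apply: cvgM; apply: cvgM; rewrite ?e1 ?e2; apply: flat_cvg1; rewrite subr_gt0.
Qed.

Lemma box_bump_test a b c d k : closure (box a b c d) `<=` Omega ->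
  test_function Omega (box_bump a b c d k).
Proof.
move=> cO; apply: (test_sub (smooth_box_bump a b c d k) _ cO).
  apply: (@subclosed_compact _ _ (`[a, b] `*` `[c, d])) => //.
  - exact: closed_closure.
  - by apply: compact_setX; exact: segment_compact.
  - have cl : closed (`[a, b]%classic `*` `[c, d]%classic : set (plane R)).
      by apply: compact_closed; [exact: norm_hausdorff|apply: compact_setX; exact: segment_compact].
    rewrite [X in _ `<=` X](closure_id _).1//; apply: closureS.
    move=> y /andP[/andP[h1 h2] /andP[h3 h4]]; rewrite /= !in_itv/=.
    by rewrite !ltW.
by move=> x nx; apply: box_bump_eq0 => bx; apply: nx; exact: subset_closure.
Qed.

End tests.

(** * The fundamental theorem of calculus on a line *)

Section line.
Context {R : realType}.
Notation lam := (@lebesgue_measure R).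
Implicit Types (H dH : R -> R).

Lemma integral_derive H dH (a b : R) : (forall t, is_derive t (1 : R) H (dH t)) ->
  continuous dH -> a <= b ->
  (\int[lam]_(t in `[a, b]) (dH t)%:E = (H b - H a)%:E)%E.
Proof.
move=> dHE cdH; rewrite le_eqVlt => /predU1P[->|ab].
  by rewrite set_itv1 integral_set1 subrr.
have cH : continuous H.
  by move=> t; apply/differentiable_continuous/derivable1_diffP; have [] := dHE t.
rewrite EFinB; apply: continuous_FTC2 => //.
- exact: continuous_subspaceT.
- split; first by move=> t _; have [] := dHE t.
  + by apply: cvg_at_right_filter; exact: cH.
  + by apply: cvg_at_left_filter; exact: cH.
- by move=> t _; rewrite derive1E; have [_ ->] := dHE t.
Qed.

Lemma le_abs_integral_derive H dH (a b : R) : (forall t, is_derive t (1 : R) H (dH t)) ->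
  continuous dH -> a <= b ->
  (`|H b - H a|%:E <= \int[lam]_(t in `[a, b]) `|dH t|%:E)%E.
Proof.
move=> dHE cdH ab; rewrite -abse_EFin -(integral_derive dHE cdH ab).
apply: (le_abse_integral lam) => //; apply/measurable_EFinP.
by apply: measurable_funTS; exact: continuous_measurable_fun.
Qed.

Lemma integral_derive_compact H dH (M : R) : (forall t, is_derive t (1 : R) H (dH t)) ->
  continuous dH -> 0 < M -> (forall t, ~~ (- M < t < M) -> H t = 0 /\ dH t = 0) ->
  (\int[lam]_t (dH t)%:E = 0)%E.
Proof.
move=> dHE cdH M0 sH.
have MM : - M <= M by lra.
have := integral_derive dHE cdH MM.
have [-> _] : H M = 0 /\ dH M = 0 by apply: sH; rewrite ltxx andbF.
have [-> _] : H (- M) = 0 /\ dH (- M) = 0 by apply: sH; rewrite ltxx.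
rewrite subrr => h; apply: etrans h; rewrite [RHS]integral_mkcond; apply: eq_integral => t _.
rewrite patchE; case: ifPn => //; rewrite notin_setE /= in_itv/= => /negP tM.
have [|_ -> //] := sH t.
by apply: contra tM => /andP[? ?]; rewrite !ltW.
Qed.

(** H(t)^2 is the integral of 2 H H' from the left end to [t], and minus its
integral from [t] to the right end.  Averaging the two gains a factor 2, which
the constants of the theorem need. *)
Lemma sqr_le_integral_derive H dH (M : R) : (forall t, is_derive t (1 : R) H (dH t)) ->
  continuous dH -> 0 < M -> (forall t, ~~ (- M < t < M) -> H t = 0) ->
  forall t, ((H t ^+ 2)%:E <= \int[lam]_s `|H s * dH s|%:E)%E.
Proof.
move=> dHE cdH M0 sH t.
have cH : continuous H.
  by move=> s; apply/differentiable_continuous/derivable1_diffP; have [] := dHE s.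
have mHdH : measurable_fun setT (fun s => `|H s * dH s|%:E).
  apply/measurable_EFinP; apply: measurableT_comp => //; apply: continuous_measurable_fun => s.
  by apply: cvgM; [exact: cH|exact: cdH].
have [tM|/sH ->] := boolP (- M < t < M); last first.
  by rewrite expr0n/=; apply: integral_ge0 => s _; rewrite lee_fin.
have /andP[t1 t2] := tM.
have dK s : is_derive s (1 : R) (fun s => H s ^+ 2) (2 * (H s * dH s)).
  have dHs := dHE s.
  have -> : (fun s : R => H s ^+ 2) = H ^+ 2 by apply/funext => r; rewrite exprfctE.
  by apply: is_derive_eq; rewrite /GRing.scale/=; ring.
have cdK : continuous (fun s => 2 * (H s * dH s)).
  by move=> s; apply: cvgM; [exact: cvg_cst|apply: cvgM; [exact: cH|exact: cdH]].
have l1 := le_abs_integral_derive dK cdK (ltW t1).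
have l2 := le_abs_integral_derive dK cdK (ltW t2).
have HM : H M = 0 by apply: sH; rewrite ltxx andbF.
have HNM : H (- M) = 0 by apply: sH; rewrite ltxx.
move: l1 l2; rewrite HM HNM expr0n/= subr0 sub0r normrN ger0_norm ?sqr_ge0//.
rewrite -(@integral_itv_obnd_cbnd _ t (BRight M)); last first.
  apply/measurable_EFinP; apply: measurable_funTS; apply: measurableT_comp => //.
  exact: continuous_measurable_fun.
move=> l1 l2; have := leeD l1 l2.
rewrite -ge0_integral_setU//=; last 2 first.
- apply/measurable_EFinP; apply: measurable_funTS; apply: measurableT_comp => //.
  exact: continuous_measurable_fun.
- apply/disj_setPS => s [/=]; rewrite !in_itv/= => /andP[_ st] /andP[ts _].
  by rewrite ltNge st in ts.
set A := _ `|` _ => l3.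
have mA : measurable A by apply: measurableU.
have : (\int[lam]_(x in A) `|2 * (H x * dH x)|%:E <= \int[lam]_x `|2 * (H x * dH x)|%:E)%E.
  apply: ge0_subset_integral => //.
  apply/measurable_EFinP; apply: measurableT_comp => //; exact: continuous_measurable_fun.
have -> : (\int[lam]_x `|2 * (H x * dH x)|%:E = 2%:E * \int[lam]_x `|H x * dH x|%:E)%E.
  rewrite -ge0_integralZl//.
  by apply: eq_integral => s _; rewrite normrM EFinM ger0_norm.
by move/(le_trans l3); rewrite -EFinD -mulr2n -(mulr_natl (H t ^+ 2)) EFinM lee_pmul2l// lte_fin.
Qed.

End line.

(** * The fundamental lemma of the calculus of variations *)

Section weak.
Context {R : realType}.
Variable Omega : set (plane R).
Hypothesis oO : open Omega.
Implicit Types (x : plane R) (p q phi psi : sfield R).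
Notation mplane := (measurableTypeR R * measurableTypeR R)%type.
Notation mu := (@leb2 R).

Let mO : measurable (Omega : set mplane) := open_measurable2 oO.

Lemma L2_indic_box (a b c d : R) : L2 mu (setT : set mplane) (\1_(box a b c d) : mplane -> R).
Proof.
have mB : measurable (box a b c d : set mplane) := box_measurable a b c d.
apply: L2_lt_pinfty; first exact: measurable_indic.
have -> : (fun x : mplane => ((\1_(box a b c d) x : R) ^+ 2)%:E) = (fun x => (\1_(box a b c d) x)%:E).
  by apply/funext => x; rewrite indicE; case: (_ \in _); rewrite ?expr1n ?expr0n.
by rewrite integral_indic// setIT box_finite.
Qed.

(** Dominated convergence along the bumps of the box. *)
Lemma integral_box_eq0 (g : mplane -> R) (a b c d : R) :
  L2 mu Omega g -> (forall phi, test_function Omega phi -> ip mu Omega g phi = 0) ->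
  closure (box a b c d) `<=` Omega ->
  (\int[mu]_(x in box a b c d) (g x)%:E = 0)%E.
Proof.
move=> Lg g0 cO.
have mB : measurable (box a b c d : set mplane) := box_measurable a b c d.
have L1 : L2 mu Omega (\1_(box a b c d) : mplane -> R).
  exact: (L2_subset measurableT mO _ (L2_indic_box a b c d)).
have tb k := box_bump_test k cO.
pose f_ k (x : mplane) := (g x * box_bump a b c d k x)%:E.
pose f (x : mplane) := (g x * \1_(box a b c d) x)%:E.
have mf_ k : measurable_fun Omega (f_ k).
  apply/measurable_EFinP; apply: measurable_funM; first by case: Lg.
  by case: (test_L2 oO (tb k)).
have mf : measurable_fun Omega f.
  by apply/measurable_EFinP; apply: measurable_funM; [case: Lg|case: L1].
have Labs : L2 mu Omega (fun x => `|g x|).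
  apply: (L2_le mO _ Lg); last by move=> x _; rewrite normr_id.
  by apply: measurableT_comp => //; case: Lg.
have ig := L2_integrableM mO Labs L1.
have cvf : {ae mu, forall x, Omega x -> f_ ^~ x @ \oo --> f x}.
  apply: nearW => x Ox; apply: cvg_EFin; first exact: nearW.
  rewrite /f_ /f /=.
  apply: cvgM; first exact: cvg_cst.
  rewrite indicE; have [xB|xB] := boolP (x \in box a b c d).
    by apply: box_bump_cvg1; rewrite inE in xB.
  rewrite notin_setE in xB.
  by under eq_fun do rewrite (box_bump_eq0 _ xB); exact: cvg_cst.
have dom : {ae mu, forall (x : mplane) k, Omega x -> (`|f_ k x| <= (`|g x| * \1_(box a b c d) x)%:E)%E}.
  apply: nearW => x k Ox; rewrite /f_ /= lee_fin normrM ler_wpM2l//.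
  rewrite indicE; have [xB|xB] := boolP (x \in box a b c d).
    exact: box_bump_norm_le1.
  by rewrite notin_setE in xB; rewrite (box_bump_eq0 _ xB) normr0.
have [_ _ ] := @dominated_convergence _ _ R mu Omega mO f_ f _ mf_ mf cvf ig dom.
have -> : (fun k => \int[mu]_(x in Omega) f_ k x)%E = cst 0%E.
  apply/funext => k /=.
  rewrite -[LHS]fineK; last first.
    by apply: integrable_fin_num => //; exact: (L2_integrableM mO Lg (test_L2 oO (tb k))).
  by congr EFin; exact: g0.
move=> h; have := cvg_lim (@ereal_hausdorff R) h.
rewrite lim_cst; last exact: ereal_hausdorff.
move=> h1; have BO : box a b c d `<=` Omega by apply: subset_trans cO; exact: subset_closure.
rewrite -(setIidr BO) integral_mkcondr.
transitivity (\int[mu]_(x in Omega) f x)%E; last by rewrite h1.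
by apply: eq_integral => x _; rewrite patchE /f indicE; case: ifPn; rewrite ?mulr1 ?mulr0.
Qed.

(** On a box whose closure lies in the domain, the previous lemma applies to all
sub-boxes, hence [g] vanishes there almost everywhere; countably many such boxes
cover the domain. *)
Lemma test_ae0 (g : mplane -> R) : L2 mu Omega g ->
  (forall phi, test_function Omega phi -> ip mu Omega g phi = 0) ->
  ae_eq mu Omega g (cst 0).
Proof.
move=> Lg g0.
pose B (q : rat * rat * (rat * rat)) :=
  box (ratr q.1.1) (ratr q.1.2) (ratr q.2.1) (ratr q.2.2) : set (plane R).
have Bae (q : rat * rat * (rat * rat)) : closure (B q) `<=` Omega -> {ae mu, forall x, B q x -> g x = 0}.
  move=> cO; have BO : B q `<=` Omega by apply: subset_trans cO; exact: subset_closure.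
  have iB : mu.-integrable (B q) (EFin \o g).
    have LB : L2 mu (B q) g by apply: L2_subset Lg => //; exact: box_measurable.
    have L1 : L2 mu (B q) (\1_(B q) : mplane -> R).
      by apply: L2_subset (L2_indic_box _ _ _ _) => //; exact: box_measurable.
    have := L2_integrableM (box_measurable _ _ _ _) LB L1.
    apply: eq_integrable; first exact: box_measurable.
    by move=> x xB; rewrite /= indicE xB mulr1.
  have h : ae_eq mu (B q) (EFin \o g) (cst 0%E).
    apply: integral_boxes_eq0 iB _ => a' b' c' d'.
    have -> : box (ratr q.1.1) (ratr q.1.2) (ratr q.2.1) (ratr q.2.2) `&` box a' b' c' d' =
      box (Num.max (ratr q.1.1) a') (Num.min (ratr q.1.2) b')
          (Num.max (ratr q.2.1) c') (Num.min (ratr q.2.2) d').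
      apply/seteqP; split => x; rewrite /box /= !gt_max !lt_min.
        by move=> [/andP[/andP[-> ->] /andP[-> ->]] /andP[/andP[-> ->] /andP[-> ->]]].
      by move=> /andP[/andP[/andP[-> ->] /andP[-> ->]] /andP[/andP[-> ->] /andP[-> ->]]].
    apply: integral_box_eq0 => //; apply: subset_trans cO; apply: closureS.
    move=> x; rewrite /B /box /= !gt_max !lt_min.
    by move=> /andP[/andP[/andP[-> _] /andP[-> _]] /andP[/andP[-> _] /andP[-> _]]].
  by apply: filterS h => x h Bx; have [] := h Bx.
pose P (q : rat * rat * (rat * rat)) : set mplane :=
  [set x | closure (B q) `<=` Omega -> B q x -> g x = 0].
have Pae (q : rat * rat * (rat * rat)) : {ae mu, forall x, P q x}.
  have [cO|ncO] := pselect (closure (B q) `<=` Omega); last by apply: nearW => x cO; case: (ncO cO).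
  by apply: (ae_imp (Bae q cO)) => x h _.
(* Boxes without the closure condition satisfy [P] vacuously, so that the countable
   intersection may run over all codes of rational boxes. *)
have Pall : {ae mu, forall x, forall k : nat, if unpickle k is Some q then P q x else True}.
  apply/ae_foralln => k; case: (unpickle k) => [q|]; [exact: Pae|exact: nearW].
apply: (ae_imp Pall) => x Px Ox.
have [q [Bx cB]] := open_rat_box oO Ox.
by have := Px (pickle q); rewrite pickleK; apply.
Qed.

End weak.

(** * Weak derivatives *)

Section weak_derivative.
Context {R : realType}.
Variable Omega : set (plane R).
Hypothesis oO : open Omega.
Implicit Types (x : plane R) (p q g h phi psi : sfield R) (i : 'I_2).
Notation mplane := (measurableTypeR R * measurableTypeR R)%type.
Notation mu := (@leb2 R).
Notation lam := (@lebesgue_measure R).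

Let mO : measurable (Omega : set mplane) := open_measurable2 oO.

Lemma test_integrableT phi : test_function Omega phi ->
  mu.-integrable (setT : set mplane) (EFin \o phi).
Proof.
move=> tphi; have [M _ sM] := test_box tphi.
have := L2_integrableM measurableT (test_L2T tphi) (L2_indic_box (- M) M (- M) M).
apply: eq_integrable => // x _; rewrite /= indicE.
have [xB|xB] := boolP (x \in box (- M) M (- M) M); first by rewrite mulr1.
by rewrite mulr0 sM//; apply: contra xB => xB; rewrite inE.
Qed.

Lemma test_horizontal phi (y : R) : smooth phi ->
  (forall t, is_derive t (1 : R) (fun t => phi (t, y)) (partial ord0 phi (t, y))) /\
  continuous (fun t => partial ord0 phi (t, y)).
Proof.
move=> s1; split=> t.
  have [h1 h2] := horizontal_derive (@smooth_derivable _ phi (t, y) ord0 s1).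
  by split => //; rewrite -h2 derive1E.
apply: (@continuous_comp _ _ _ (fun t => (t, y))); last exact/smooth_continuous/smooth_partial.
exact: (cvg_pair cvg_id (cvg_cst y)).
Qed.

Lemma test_vertical phi (y : R) : smooth phi ->
  (forall t, is_derive t (1 : R) (fun t => phi (y, t)) (partial ord_max phi (y, t))) /\
  continuous (fun t => partial ord_max phi (y, t)).
Proof.
move=> s1; split=> t.
  have [h1 h2] := vertical_derive (@smooth_derivable _ phi (y, t) ord_max s1).
  by split => //; rewrite -h2 derive1E.
apply: (@continuous_comp _ _ _ (fun t => (y, t))); last exact/smooth_continuous/smooth_partial.
exact: (cvg_pair (cvg_cst y) cvg_id).
Qed.

(** Fubini, integrating first in the direction of the derivative. *)
Lemma integral_partial phi i : test_function Omega phi ->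
  (\int[mu]_(x in [set: mplane]) (partial i phi x)%:E = 0)%E.
Proof.
move=> tphi; have tdphi := test_partial i tphi.
have idphi := test_integrableT tdphi.
have [M M0 sM] := test_box tphi; have [M' M'0 sM'] := test_box tdphi.
have [s1 _ _] := tphi.
pose N := Num.max M M'.
have N0 : 0 < N by rewrite lt_max M0.
have NM : M <= N by rewrite le_max lexx.
have NM' : M' <= N by rewrite le_max lexx orbT.
have out (K t : R) : K <= N -> ~~ (- N < t < N) -> ~~ (- K < t < K).
  by move=> KN; apply: contra => /andP[a1 a2]; apply/andP; split; lra.
elim/ord2P: i tdphi idphi sM' => tdphi idphi sM'.
  rewrite -(integral21_prod_meas1 idphi) integral0_eq// => y _.
  have [h1 h2] := test_horizontal y s1.
  apply: (integral_derive_compact h1 h2 N0) => t tN.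
  by split; [apply: sM|apply: sM'] => /=; rewrite (negbTE (out _ t _ tN)).
rewrite -(integral12_prod_meas1 idphi) integral0_eq// => y _.
have [h1 h2] := test_vertical y s1.
apply: (integral_derive_compact h1 h2 N0) => t tN.
by split; [apply: sM|apply: sM'] => /=; rewrite (negbTE (out _ t _ tN)) ?andbF.
Qed.

Lemma integral_Omega_partial phi i : test_function Omega phi ->
  \int[mu]_(x in Omega) partial i phi x = 0.
Proof.
move=> tphi; rewrite /Rintegral (integral_testT (h := id) (test_partial i tphi))//.
by rewrite (integral_partial i tphi).
Qed.

(** Integration by parts: the integral of the derivative of a product of test
functions is zero. *)
Lemma test_wpartial phi i : test_function Omega phi ->
  is_wpartial Omega i phi (partial i phi).
Proof.
move=> tphi; split; first exact/(test_L2 oO)/test_partial.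
move=> psi tpsi; apply/eqP; rewrite -addr_eq0 -RintegralD//; last 2 first.
- exact: (L2_integrableM mO (test_L2 oO tphi) (test_L2 oO (test_partial i tpsi))).
- exact: (L2_integrableM mO (test_L2 oO (test_partial i tphi)) (test_L2 oO tpsi)).
apply/eqP; rewrite -[RHS](integral_Omega_partial i (testM tphi tpsi)).
apply: eq_Rintegral => x _; case: tphi => s1 _ _; case: tpsi => s2 _ _.
by rewrite partialM//= [in RHS]mulrC [psi x * _]mulrC mulrC.
Qed.

Lemma is_wpartialD p q g h i : sL2 Omega p -> sL2 Omega q ->
  is_wpartial Omega i p g -> is_wpartial Omega i q h ->
  is_wpartial Omega i (fun x => p x + q x) (fun x => g x + h x).
Proof.
move=> Lp Lq [Lg wg] [Lh wh]; split; first exact: (L2D mO Lg Lh).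
move=> phi tphi; have Lphi := test_L2 oO tphi; have Ldphi := test_L2 oO (test_partial i tphi).
have := ipDl mO Lp Lq Ldphi; rewrite /ip => ->; have := ipDl mO Lg Lh Lphi; rewrite /ip => ->.
by rewrite wg// wh// opprD.
Qed.

Lemma is_wpartialZ k p g i : sL2 Omega p -> is_wpartial Omega i p g ->
  is_wpartial Omega i (fun x => k * p x) (fun x => k * g x).
Proof.
move=> Lp [Lg wg]; split; first exact: (L2Z mO k Lg).
move=> phi tphi; have Lphi := test_L2 oO tphi; have Ldphi := test_L2 oO (test_partial i tphi).
have := ipZl mO k Lp Ldphi; rewrite /ip => ->; have := ipZl mO k Lg Lphi; rewrite /ip => ->.
by rewrite wg// mulrN.
Qed.

Lemma wpartialP p i : H1 Omega p -> is_wpartial Omega i p (wpartial Omega i p).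
Proof. by move=> [Lp] /(_ i)[g wg]; exact: (xgetPex 0 (ex_intro _ g wg)). Qed.

Lemma wpartial_L2 p i : H1 Omega p -> L2 mu Omega (wpartial Omega i p).
Proof. by move=> /(wpartialP i)[]. Qed.

(** Uniqueness of weak derivatives. *)
Lemma wpartial_ae p g i : H1 Omega p -> is_wpartial Omega i p g ->
  ae_eq mu Omega (wpartial Omega i p) g.
Proof.
move=> Hp [Lg wg]; have [Ld wd] := wpartialP i Hp.
have h : ae_eq mu Omega (fun x => wpartial Omega i p x - g x) (cst 0).
  apply: (test_ae0 oO); first exact: L2B.
  move=> phi tphi; rewrite ipBl//; last exact: test_L2.
  apply/eqP; rewrite subr_eq0 -eqr_opp; apply/eqP.
  by rewrite /ip -wd// -wg.
by apply: (ae_imp h) => x hx Ox; apply/eqP; rewrite -subr_eq0; apply/eqP; exact: hx.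
Qed.

Lemma H1D p q : H1 Omega p -> H1 Omega q -> H1 Omega (fun x => p x + q x).
Proof.
move=> Hp Hq; have [Lp _] := Hp; have [Lq _] := Hq; split; first exact: (L2D mO Lp Lq).
by move=> i; eexists; apply: is_wpartialD => //; exact: wpartialP.
Qed.

Lemma H1Z k p : H1 Omega p -> H1 Omega (fun x => k * p x).
Proof.
move=> Hp; have [Lp _] := Hp; split; first exact: (L2Z mO k Lp).
by move=> i; eexists; apply: is_wpartialZ => //; exact: wpartialP.
Qed.

Lemma test_H1 phi : test_function Omega phi -> H1 Omega phi.
Proof. by move=> tphi; split; [exact: test_L2|move=> i; eexists; exact: test_wpartial]. Qed.

Lemma wpartialD p q i : H1 Omega p -> H1 Omega q ->
  ae_eq mu Omega (wpartial Omega i (fun x => p x + q x))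
    (fun x => wpartial Omega i p x + wpartial Omega i q x).
Proof.
move=> Hp Hq; apply: wpartial_ae; first exact: H1D.
by apply: is_wpartialD; [case: Hp|case: Hq|exact: wpartialP|exact: wpartialP].
Qed.

Lemma wpartialZ k p i : H1 Omega p ->
  ae_eq mu Omega (wpartial Omega i (fun x => k * p x))
    (fun x => k * wpartial Omega i p x).
Proof.
move=> Hp; apply: wpartial_ae; first exact: H1Z.
by apply: is_wpartialZ; [case: Hp|exact: wpartialP].
Qed.

Lemma wpartial_test phi i : test_function Omega phi ->
  ae_eq mu Omega (wpartial Omega i phi) (partial i phi).
Proof. by move=> tphi; apply: wpartial_ae; [exact: test_H1|exact: test_wpartial]. Qed.

End weak_derivative.

(** * The L^2 product of matrix fields *)

Section l2dot.
Context {R : realType}.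
Variable Omega : set (plane R).
Hypothesis oO : open Omega.
Notation mplane := (measurableTypeR R * measurableTypeR R)%type.
Notation mu := (@leb2 R).
Let mO : measurable (Omega : set mplane) := open_measurable2 oO.

Lemma Rintegral_sum (I : eqType) (s : seq I) (f : I -> mplane -> R) :
  (forall i, i \in s -> mu.-integrable Omega (EFin \o f i)) ->
  mu.-integrable Omega (EFin \o (fun x => \sum_(i <- s) f i x)) /\
  \int[mu]_(x in Omega) (\sum_(i <- s) f i x) = \sum_(i <- s) \int[mu]_(x in Omega) f i x.
Proof.
elim: s => [|i s IH] h.
  split; first by under eq_fun do rewrite big_nil; exact: integrable0.
  rewrite big_nil; under eq_Rintegral do rewrite big_nil.
  by rewrite /Rintegral integral0.
have hi := h i (mem_head _ _).
have [|h1 h2] := IH; first by move=> j js; apply: h; rewrite in_cons js orbT.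
have -> : (fun x => \sum_(i <- i :: s) f i x) = (fun x => f i x + \sum_(i <- s) f i x).
  by apply/funext => x; rewrite big_cons.
split; last by rewrite RintegralD// h2 big_cons.
set S := (fun x => \sum_(i <- s) f i x) in h1 *.
have -> : EFin \o (fun x => f i x + S x) = ((EFin \o f i) \+ (EFin \o S))%E.
  by apply/funext => x /=; rewrite EFinD.
exact: integrableD.
Qed.

Context {m n : nat}.
Implicit Types F G K : plane R -> 'M[R]_(m, n).

Definition mL2 F := forall i j, L2 mu Omega (fun x => F x i j).

Lemma l2dotE F G : mL2 F -> mL2 G ->
  l2dot Omega F G = \sum_i \sum_j ip mu Omega (fun x => F x i j) (fun x => G x i j).
Proof.
move=> LF LG.
have h1 i := Rintegral_sum (s := index_enum 'I_n) (f := fun j x => F x i j * G x i j)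
   (fun j _ => L2_integrableM mO (LF i j) (LG i j)).
apply: etrans; first exact: (Rintegral_sum (s := index_enum 'I_m) (fun i _ => (h1 i).1)).2.
by apply: eq_bigr => i _; rewrite (h1 i).2.
Qed.

Lemma mL2D F G : mL2 F -> mL2 G -> mL2 (fun x => F x + G x).
Proof.
move=> LF LG i j; under eq_fun do rewrite mxE.
exact: (L2D mO (LF i j) (LG i j)).
Qed.

Lemma mL2Z k F : mL2 F -> mL2 (fun x => k *: F x).
Proof.
move=> LF i j; under eq_fun do rewrite mxE.
exact: (L2Z mO k (LF i j)).
Qed.

Lemma l2dotC F G : l2dot Omega F G = l2dot Omega G F.
Proof.
by apply: eq_Rintegral => x _; apply: eq_bigr => i _; apply: eq_bigr => j _; rewrite mulrC.
Qed.

Lemma l2dotDl F G K : mL2 F -> mL2 G -> mL2 K ->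
  l2dot Omega (fun x => F x + G x) K = l2dot Omega F K + l2dot Omega G K.
Proof.
move=> LF LG LK; have LFG := mL2D LF LG.
rewrite !l2dotE// -big_split; apply: eq_bigr => i _; rewrite -big_split.
apply: eq_bigr => j _ /=; rewrite -(ipDl mO (LF i j) (LG i j) (LK i j)).
by congr ip; apply/funext => x; rewrite mxE.
Qed.

Lemma l2dotZl k F K : mL2 F -> mL2 K ->
  l2dot Omega (fun x => k *: F x) K = k * l2dot Omega F K.
Proof.
move=> LF LK; have LkF := mL2Z k LF.
rewrite !l2dotE// mulr_sumr; apply: eq_bigr => i _; rewrite mulr_sumr.
apply: eq_bigr => j _ /=; rewrite -(ipZl mO k (LF i j) (LK i j)).
by congr ip; apply/funext => x; rewrite mxE.
Qed.

Lemma l2dot_ae F G K : mL2 F -> mL2 G -> mL2 K ->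
  (forall i j, ae_eq mu Omega (fun x => F x i j) (fun x => G x i j)) ->
  l2dot Omega F K = l2dot Omega G K.
Proof.
move=> LF LG LK h; rewrite !l2dotE//; apply: eq_bigr => i _; apply: eq_bigr => j _.
by apply: (ae_ipl mO) (h i j); [case: (LF i j)|case: (LG i j)|case: (LK i j)].
Qed.

Lemma l2dot_ge0 F : 0 <= l2dot Omega F F.
Proof.
apply: Rintegral_ge0 => x _; apply: sumr_ge0 => i _; apply: sumr_ge0 => j _.
exact: sqr_ge0.
Qed.

Lemma l2norm_ge0 F : 0 <= l2norm Omega F.
Proof. exact: sqrtr_ge0. Qed.

Lemma l2norm_sqr F : l2norm Omega F ^+ 2 = l2dot Omega F F.
Proof. by rewrite sqr_sqrtr ?l2dot_ge0. Qed.

Lemma l2dot_CS F G : mL2 F -> mL2 G ->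
  `|l2dot Omega F G| <= l2norm Omega F * l2norm Omega G.
Proof.
move=> LF LG; rewrite -sqrtrM ?l2dot_ge0// -sqrtr_sqr ler_wsqrtr//.
apply: sqr_le_of_quadratic_ge0 (l2dot_ge0 G) => t.
have := l2dot_ge0 (fun x => F x + t *: G x).
have LtG := mL2Z t LG; have LS := mL2D LF LtG.
rewrite l2dotDl// l2dotZl// 2!(l2dotC _ (fun x => F x + t *: G x)) !l2dotDl// !l2dotZl//.
by rewrite (l2dotC G F); congr (0 <= _); ring.
Qed.

Lemma l2dot_sqrD F G : mL2 F -> mL2 G ->
  l2dot Omega (fun x => F x + G x) (fun x => F x + G x) =
  l2dot Omega F F + 2 * l2dot Omega F G + l2dot Omega G G.
Proof.
move=> LF LG; have LS := mL2D LF LG.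
rewrite l2dotDl// 2!(l2dotC _ (fun x => F x + G x)) !l2dotDl// (l2dotC G F); ring.
Qed.

End l2dot.

(** * Ladyzhenskaya's inequality for test functions *)

Lemma sqrt_mul_le_mean (R : realType) (a b : R) : 0 <= a -> 0 <= b ->
  Num.sqrt a * Num.sqrt b <= (a + b) / 2.
Proof.
move=> a0 b0; have := sqr_ge0 (Num.sqrt a - Num.sqrt b).
by rewrite sqrrB !sqr_sqrtr//; lra.
Qed.

Section ladyzhenskaya.
Context {R : realType}.
Variable Omega : set (plane R).
Hypothesis oO : open Omega.
Implicit Types (x : plane R) (p q phi psi : sfield R) (i : 'I_2).
Notation mplane := (measurableTypeR R * measurableTypeR R)%type.
Notation mu := (@leb2 R).
Notation lam := (@lebesgue_measure R).
Let mO : measurable (Omega : set mplane) := open_measurable2 oO.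

(** The bounds of phi(x, y)^2 by integrals along the horizontal and the vertical
line through (x, y) depend on y only and on x only, so that the integral of their
product splits. *)
Lemma integral_test_quartic phi : test_function Omega phi ->
  (\int[mu]_(x in [set: mplane]) (phi x ^+ 4)%:E <=
   (\int[mu]_(x in [set: mplane]) `|phi x * partial ord0 phi x|%:E) *
   (\int[mu]_(x in [set: mplane]) `|phi x * partial ord_max phi x|%:E))%E.
Proof.
move=> tphi; have [s1 _ _] := tphi; have [M M0 sM] := test_box tphi.
pose f0 : mplane -> \bar R := fun x => `|phi x * partial ord0 phi x|%:E.
pose f1 : mplane -> \bar R := fun x => `|phi x * partial ord_max phi x|%:E.
have mf i : measurable_fun setT (fun x : mplane => `|phi x * partial i phi x|%:E).
  apply/measurable_EFinP; apply: measurableT_comp => //; apply: continuous_measurable2 => x.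
  by apply: cvgM; apply: smooth_continuous => //; exact: smooth_partial.
have f00 x : (0 <= f0 x)%E by rewrite lee_fin.
have f10 x : (0 <= f1 x)%E by rewrite lee_fin.
pose A := fubini_G lam f0; pose B := fubini_F lam f1.
have A0 y : (0 <= A y)%E by apply: integral_ge0.
have B0 y : (0 <= B y)%E by apply: integral_ge0.
have mA : measurable_fun setT A by apply: measurable_fun_fubini_tonelli_G => //; exact: mf.
have mB : measurable_fun setT B by apply: measurable_fun_fubini_tonelli_F => //; exact: mf.
have EA : (\int[mu]_(x in [set: mplane]) f0 x = \int[lam]_y A y)%E.
  by apply: fubini_tonelli2 => //; exact: mf.
have EB : (\int[mu]_(x in [set: mplane]) f1 x = \int[lam]_y B y)%E.
  by apply: fubini_tonelli1 => //; exact: mf.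
rewrite -/(f0 _) -/(f1 _).
have mphi4 : measurable_fun setT (fun x : mplane => (phi x ^+ 4)%:E).
  apply/measurable_EFinP; apply: measurable_funX; apply: continuous_measurable2.
  exact: smooth_continuous.
have phi40 (x : mplane) : (0 <= (phi x ^+ 4)%:E)%E by rewrite lee_fin exprn_even_ge0.
have -> : (\int[mu]_(x in [set: mplane]) (phi x ^+ 4)%:E = \int[lam]_x \int[lam]_y (phi (x, y) ^+ 4)%:E)%E.
  by apply: (fubini_tonelli1 (m1 := lam) (m2 := lam) (fun x : mplane => (phi x ^+ 4)%:E)).
(* [A] integrates along horizontal lines, [B] along vertical ones. *)
have key (x y : R) : ((phi (x, y) ^+ 4)%:E <= B x * A y)%E.
  have [h1 h2] := test_horizontal y s1; have [h3 h4] := test_vertical x s1.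
  have q1 := sqr_le_integral_derive h1 h2 M0 _ x.
  have q2 := sqr_le_integral_derive h3 h4 M0 _ y.
  have -> : phi (x, y) ^+ 4 = phi (x, y) ^+ 2 * phi (x, y) ^+ 2 by rewrite -exprD.
  rewrite EFinM; apply: lee_pmul; rewrite ?lee_fin ?sqr_ge0//.
    by apply: q2 => t tM; apply: sM; rewrite /= (negbTE tM) andbF.
  by apply: q1 => t tM; apply: sM; rewrite /= (negbTE tM).
rewrite EA EB.
clearbody A B.
have EZ (x : R) : (\int[lam]_y (B x * A y) = B x * \int[lam]_y A y)%E.
  by apply: ge0_integralZl; [exact: measurableT|exact: mA|move=> y _; exact: A0|exact: B0].
apply: (@le_trans _ _ (\int[lam]_x (B x * \int[lam]_y A y))%E).
  apply: ge0_le_integral => //.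
  - by move=> x _; apply: integral_ge0.
  - by apply: (measurable_fun_fubini_tonelli_F (m2 := lam) (fun x : mplane => (phi x ^+ 4)%:E)).
  - apply: emeasurable_funM => //; exact: measurable_cst.
  - move=> x _; rewrite -EZ.
    apply: ge0_le_integral => //.
    + by apply: measurableT_comp mphi4 _; exact: pair1_measurable.
    + by apply: measurable_funeM.
have IA0 : (0 <= \int[lam]_y A y)%E by apply: integral_ge0 => y _; exact: A0.
have -> : (\int[lam]_x (B x * \int[lam]_y A y) = (\int[lam]_x B x) * \int[lam]_y A y)%E.
  by apply: ge0_integralZr; [exact: measurableT|exact: mB|move=> x _; exact: B0|exact: IA0].
by rewrite muleC.
Qed.

Lemma test_ladyzhenskaya phi : test_function Omega phi ->
  ip mu Omega (phi \* phi) (phi \* phi) <=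
  ip mu Omega phi phi * ((ip mu Omega (partial ord0 phi) (partial ord0 phi) +
     ip mu Omega (partial ord_max phi) (partial ord_max phi)) / 2).
Proof.
move=> tphi; have Lphi := test_L2T tphi.
have t2 := testM tphi tphi; have L2phi := test_L2T t2.
have td i := test_partial i tphi; have Ld i := test_L2T (td i).
have ipT psi : test_function Omega psi -> ip mu Omega psi psi = ip mu setT psi psi.
  by move=> tpsi; exact: integral_testMT.
rewrite !ipT//.
have := integral_test_quartic tphi.
have -> : (\int[mu]_(x in [set: mplane]) (phi x ^+ 4)%:E = (ip mu setT (phi \* phi) (phi \* phi))%:E)%E.
  by rewrite -(ip_self_L2E measurableT L2phi); apply: eq_integral => x _ /=; congr EFin; ring.
have e i : (\int[mu]_(x in [set: mplane]) `|phi x * partial i phi x|%:E <=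
    (Num.sqrt (ip mu setT phi phi) * Num.sqrt (ip mu setT (partial i phi) (partial i phi)))%:E)%E.
  have La p : L2 mu (setT : set mplane) p -> L2 mu (setT : set mplane) (fun x => `|p x|).
    move=> Lp; apply: (L2_le measurableT _ Lp); last by move=> x _; rewrite normr_id.
    by apply: measurableT_comp => //; case: Lp.
  have ipa p : ip mu (setT : set mplane) (fun x => `|p x|) (fun x => `|p x|) = ip mu setT p p.
    by apply: eq_Rintegral => x _; rewrite -!expr2 real_normK ?num_real.
  have := ip_CS measurableT (La _ Lphi) (La _ (Ld i)); rewrite !ipa => /(le_trans (ler_norm _)).
  rewrite -lee_fin; apply: le_trans.
  rewrite /ip /Rintegral fineK; last first.
    by apply: integrable_fin_num => //; exact: (L2_integrableM measurableT (La _ Lphi) (La _ (Ld i))).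
  by rewrite le_eqVlt; apply/orP; left; apply/eqP/eq_integral => x _; rewrite normrM.
move=> h; have := le_trans h (lee_pmul _ _ (e ord0) (e ord_max)).
rewrite -EFinM lee_fin => {}h; apply: le_trans (h _ _) _; try by apply: integral_ge0.
rewrite mulrACA -expr2 (sqr_sqrtr (ip_ge0 _ _ _)); apply: ler_wpM2l; first exact: ip_ge0.
exact: sqrt_mul_le_mean (ip_ge0 _ _ _) (ip_ge0 _ _ _).
Qed.

End ladyzhenskaya.

Local Opaque wpartial Rintegral.

(** * The space H^1_0 *)

Lemma sum3_sqr_lt (R : realType) (e a b c : R) : 0 <= a -> 0 <= b -> 0 <= c ->
  a < e / 2 -> b < e / 2 -> c < e / 2 -> a ^+ 2 + (b ^+ 2 + c ^+ 2) < e ^+ 2.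
Proof.
have sq (t : R) : 0 <= t -> t < e / 2 -> t ^+ 2 <= e ^+ 2 / 4.
  by move=> t0 te; nra.
move=> a0 b0 c0 ha hb hc; have := sq a a0 ha; have := sq b b0 hb; have := sq c c0 hc.
have e0 : 0 < e by lra.
by have := exprn_gt0 2 e0; lra.
Qed.

Lemma ltD_half (R : realType) (e a b : R) : a < e / 2 -> b < e / 2 -> a + b < e.
Proof. lra. Qed.

Section h10.
Context {R : realType}.
Variable Omega : set (plane R).
Hypothesis oO : open Omega.
Implicit Types (x : plane R) (p q g phi psi : sfield R) (i : 'I_2).
Notation mplane := (measurableTypeR R * measurableTypeR R)%type.
Notation mu := (@leb2 R).
Let mO : measurable (Omega : set mplane) := open_measurable2 oO.

Notation ipO := (ip mu Omega).
Definition snorm p : R := Num.sqrt (ipO p p).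
Notation nrm := snorm.
Notation D := (wpartial Omega).

Lemma snorm_ge0 p : 0 <= nrm p. Proof. exact: sqrtr_ge0. Qed.

Lemma snorm_sqr p : nrm p ^+ 2 = ipO p p.
Proof. by rewrite sqr_sqrtr ?ip_ge0. Qed.

Lemma snorm_ae p q : measurable_fun (Omega : set mplane) p -> measurable_fun (Omega : set mplane) q ->
  ae_eq mu Omega p q -> nrm p = nrm q.
Proof.
move=> mp mq pq; rewrite /nrm (ae_ipl mO mp mq mp pq) ipC.
by rewrite (ae_ipl mO mp mq mq pq).
Qed.

Lemma snorm_le p q : L2 mu Omega p -> L2 mu Omega q ->
  (forall x, Omega x -> `|p x| <= `|q x|) -> nrm p <= nrm q.
Proof.
move=> Lp Lq pq; apply: ler_wsqrtr; apply: (le_Rintegral mO).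
- exact: L2_integrableM.
- exact: L2_integrableM.
- move=> x Ox; rewrite -!expr2 -(real_normK (num_real (p x))) -(real_normK (num_real (q x))).
  by rewrite lerXn2r ?nnegrE//; exact: pq.
Qed.

Lemma snormD p q : L2 mu Omega p -> L2 mu Omega q -> nrm (fun x => p x + q x) <= nrm p + nrm q.
Proof. exact: (ip_minkowski mO). Qed.

Lemma snormZ k p : L2 mu Omega p -> nrm (fun x => k * p x) = `|k| * nrm p.
Proof.
move=> Lp; have LkP := L2Z mO k Lp.
by rewrite /nrm ipZl// ipC ipZl// mulrA -expr2 sqrtrM ?sqr_ge0// sqrtr_sqr.
Qed.

Lemma sqr_snorm3 p q g : L2 mu Omega p -> L2 mu Omega q -> L2 mu Omega g ->
  \int[mu]_(x in Omega) (p x * p x + (q x * q x + g x * g x)) =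
  nrm p ^+ 2 + (nrm q ^+ 2 + nrm g ^+ 2).
Proof.
move=> Lp Lq Lg.
have i0 := L2_integrableM mO Lq Lq; have i1 := L2_integrableM mO Lg Lg.
have i01 : mu.-integrable Omega (EFin \o (fun x => q x * q x + g x * g x)).
  exact: (integrableD mO i0 i1).
have E1 := RintegralD mO i0 i1.
have E2 := RintegralD mO (L2_integrableM mO Lp Lp) i01.
rewrite (snorm_sqr p) (snorm_sqr q) (snorm_sqr g).
by apply: etrans E2 _; rewrite E1.
Qed.

Lemma H1norm_sqr p : H1 Omega p ->
  H1norm Omega p ^+ 2 = nrm p ^+ 2 + (nrm (D ord0 p) ^+ 2 + nrm (D ord_max p) ^+ 2).
Proof.
move=> Hp; have Lp : L2 mu Omega p by case: Hp.
rewrite /H1norm sqr_sqrtr; last first.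
  by apply: Rintegral_ge0 => x _; rewrite addr_ge0 ?sqr_ge0// sumr_ge0// => i _; exact: sqr_ge0.
apply: etrans _ (sqr_snorm3 Lp (wpartial_L2 ord0 Hp) (wpartial_L2 ord_max Hp)).
apply: eq_Rintegral => x _; rewrite big_ord_recl big_ord1.
have -> : lift ord0 ord0 = ord_max :> 'I_2 by apply/val_inj.
by move: (p x) (D ord0 p x) (D ord_max p x) => a b c; rewrite !expr2.
Qed.

(** Approximation by test functions with the three errors separated; as weak
derivatives are unique, this is membership in H^1_0 ([H10P]). *)
Definition test_limit p := H1 Omega p /\ forall e : R, 0 < e ->
  exists2 phi, test_function Omega phi &
   nrm (fun x => p x - phi x) < e /\ forall i, nrm (fun x => D i p x - partial i phi x) < e.

Lemma H1_sub_test p phi : H1 Omega p -> test_function Omega phi -> H1 Omega (fun x => p x - phi x).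
Proof.
move=> Hp tphi; have := H1D oO Hp (H1Z oO (-1) (test_H1 oO tphi)).
by have -> : (fun x => p x + -1 * phi x) = (fun x => p x - phi x) by apply/funext => x; rewrite mulN1r.
Qed.

(** The error of a weak derivative is the norm of a weak derivative of the error. *)
Lemma wpartial_sub_test p phi i : H1 Omega p -> test_function Omega phi ->
  nrm (D i (fun x => p x - phi x)) = nrm (fun x => D i p x - partial i phi x).
Proof.
move=> Hp tphi.
have Hs := H1_sub_test Hp tphi.
have Ld := L2B mO (wpartial_L2 i Hp) (test_L2 oO (test_partial i tphi)).
apply: snorm_ae; [by case: (wpartial_L2 i Hs)|by case: Ld|].
apply: (wpartial_ae oO Hs).
have Lp : sL2 Omega p by case: Hp.
have := is_wpartialD oO Lp (L2Z mO (-1) (test_L2 oO tphi)) (wpartialP i Hp)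
   (is_wpartialZ oO (-1) (test_L2 oO tphi) (test_wpartial oO i tphi)).
have -> : (fun x => p x + -1 * phi x) = (fun x => p x - phi x) by apply/funext => x; rewrite mulN1r.
by have -> : (fun x => D i p x + -1 * partial i phi x) = (fun x => D i p x - partial i phi x) by apply/funext => x; rewrite mulN1r.
Qed.

Lemma H1norm_sub_test p phi : H1 Omega p -> test_function Omega phi ->
  H1norm Omega (fun x => p x - phi x) ^+ 2 = nrm (fun x => p x - phi x) ^+ 2 +
   (nrm (fun x => D ord0 p x - partial ord0 phi x) ^+ 2 +
    nrm (fun x => D ord_max p x - partial ord_max phi x) ^+ 2).
Proof.
move=> Hp tphi; apply: etrans (H1norm_sqr (H1_sub_test Hp tphi)) _.
by congr (_ + (_ ^+ 2 + _ ^+ 2)); exact: wpartial_sub_test.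
Qed.

Lemma H10P p : H10 Omega p <-> test_limit p.
Proof.
split=> -[Hp h]; split=> // e e0.
  have [phi tphi he] := h e e0; exists phi => //.
  have Hs := H1_sub_test Hp tphi.
  have E := H1norm_sub_test Hp tphi.
  have he2 : H1norm Omega (fun x => p x - phi x) ^+ 2 < e ^+ 2.
    by rewrite ltr_pXn2r// ?nnegrE ?sqrtr_ge0// ltW.
  have lt1 (a : R) : 0 <= a -> a ^+ 2 <= H1norm Omega (fun x => p x - phi x) ^+ 2 -> a < e.
    move=> a0 ha; have := le_lt_trans ha he2.
    by rewrite ltr_pXn2r// ?nnegrE// ltW.
  split; first by apply: lt1 (snorm_ge0 _) _; rewrite E lerDl addr_ge0 ?sqr_ge0.
  elim/ord2P; apply: lt1 (snorm_ge0 _) _; rewrite E.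
    by rewrite addrCA lerDl addr_ge0 ?sqr_ge0.
  by rewrite addrA lerDr addr_ge0 ?sqr_ge0.
have [phi tphi [h0 hi]] := h (e / 2) (divr_gt0 e0 (ltr0Sn _ _)); exists phi => //.
have Hs := H1_sub_test Hp tphi.
have E := H1norm_sub_test Hp tphi.
have : H1norm Omega (fun x => p x - phi x) ^+ 2 < e ^+ 2.
  by rewrite E; apply: sum3_sqr_lt; first [exact: snorm_ge0|exact: h0|exact: hi].
by rewrite ltr_pXn2r// ?nnegrE ?sqrtr_ge0 ?(ltW e0).
Qed.

Lemma H10_H1 p : H10 Omega p -> H1 Omega p. Proof. by case. Qed.

Lemma H10_L2 p : H10 Omega p -> L2 mu Omega p. Proof. by case=> -[]. Qed.

Lemma H10D p q : H10 Omega p -> H10 Omega q -> H10 Omega (fun x => p x + q x).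
Proof.
move=> /H10P[Hp hp] /H10P[Hq hq]; apply/H10P; split; first exact: H1D.
move=> e e0; have e2 : 0 < e / 2 by rewrite divr_gt0.
have [phi tphi [p1 p2]] := hp _ e2; have [psi tpsi [q1 q2]] := hq _ e2.
have Lp : L2 mu Omega p by case: Hp.
have Lq : L2 mu Omega q by case: Hq.
have Lphi := test_L2 oO tphi; have Lpsi := test_L2 oO tpsi.
exists (phi \+ psi); first exact: testD.
split.
  have -> : (fun x => p x + q x - (phi \+ psi) x) = (fun x => (p x - phi x) + (q x - psi x)).
    by apply/funext => x /=; ring.
  exact: le_lt_trans (snormD (L2B mO Lp Lphi) (L2B mO Lq Lpsi)) (ltD_half p1 q1).
move=> i; have h1 := p2 i; have h2 := q2 i.
have Ldp := wpartial_L2 i Hp; have Ldq := wpartial_L2 i Hq.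
have Ldphi := test_L2 oO (test_partial i tphi); have Ldpsi := test_L2 oO (test_partial i tpsi).
have Hpq := H1D oO Hp Hq.
have -> : nrm (fun x => D i (fun x => p x + q x) x - partial i (phi \+ psi) x) =
   nrm (fun x => (D i p x - partial i phi x) + (D i q x - partial i psi x)).
  have [s1 _ _] := tphi; have [s2 _ _] := tpsi.
  rewrite partialD//; apply: snorm_ae.
  - by have [] := L2B mO (wpartial_L2 i Hpq) (L2D mO Ldphi Ldpsi).
  - by have [] := L2D mO (L2B mO Ldp Ldphi) (L2B mO Ldq Ldpsi).
  - apply: (ae_imp (wpartialD oO i Hp Hq)) => x hx Ox; rewrite hx//=.
    by move: (D i p x) (D i q x) (partial i phi x) (partial i psi x) => a b c d; ring.
exact: le_lt_trans (snormD (L2B mO Ldp Ldphi) (L2B mO Ldq Ldpsi)) (ltD_half h1 h2).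
Qed.

Lemma H10Z k p : H10 Omega p -> H10 Omega (fun x => k * p x).
Proof.
move=> /H10P[Hp hp]; apply/H10P; split; first exact: H1Z.
move=> e e0; have k0 : 0 < `|k| + 1 by rewrite ltr_wpDl.
have [phi tphi [p1 p2]] := hp _ (divr_gt0 e0 k0).
have Lp : L2 mu Omega p by case: Hp.
have Lphi := test_L2 oO tphi.
have tk := testZ k tphi.
have fin (g : sfield R) : L2 mu Omega g -> nrm g < e / (`|k| + 1) -> nrm (fun x => k * g x) < e.
  move=> Lg; rewrite snormZ// ltr_pdivlMr// => h.
  by apply: le_lt_trans h; rewrite mulrC ler_wpM2l ?snorm_ge0// lerDl.
exists (fun x => k * phi x) => //; split.
  have -> : (fun x => k * p x - k * phi x) = (fun x => k * (p x - phi x)).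
    by apply/funext => x /=; ring.
  by apply: fin => //; exact: L2B.
move=> i.
have Ldp := wpartial_L2 i Hp.
have Ldphi := test_L2 oO (test_partial i tphi).
have -> : nrm (fun x => D i (fun x => k * p x) x - partial i (fun x => k * phi x) x) =
   nrm (fun x => k * (D i p x - partial i phi x)).
  have [s1 _ _] := tphi.
  have e1 x : partial i (fun x => k * phi x) x = k * partial i phi x.
    by rewrite /partial -/(k \*: phi) deriveZ//; exact: smooth_derivable.
  apply: snorm_ae.
  - by have [] := L2B mO (wpartial_L2 i (H1Z oO k Hp)) (test_L2 oO (test_partial i tk)).
  - by have [] := L2Z mO k (L2B mO Ldp Ldphi).
  - apply: (ae_imp (wpartialZ oO k i Hp)) => x hx Ox; rewrite hx// e1 /=.
    by move: (D i p x) (partial i phi x) => a b; ring.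
by apply: fin => //; exact: L2B.
Qed.

End h10.

(** * Ladyzhenskaya's inequality in H^1_0 *)

Section real_lemmas.
Context {R : realType}.
Implicit Types a b t s m e : R.

(** Factor the difference of squares; truncation is 1-Lipschitz and bounded by [m]. *)
Lemma truncation_lipschitz (m t s : R) : 0 <= m ->
  `|Num.min `|t| m ^+ 2 - Num.min `|s| m ^+ 2| <= 2 * m * `|t - s|.
Proof.
move=> m0; rewrite subr_sqr normrM mulrC.
have b1 : 0 <= Num.min `|t| m <= m by rewrite le_min normr_ge0 m0 ge_min lexx orbT.
have b2 : 0 <= Num.min `|s| m <= m by rewrite le_min normr_ge0 m0 ge_min lexx orbT.
apply: ler_pM; rewrite ?normr_ge0//.
  move/andP: b1 => [? ?]; move/andP: b2 => [? ?].
  by rewrite ger0_norm ?addr_ge0//; lra.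
apply: le_trans (ler_dist_dist _ _).
move: `|t| `|s| => a b; rewrite /Num.min.
by case: ltP => h1; case: ltP => h2; rewrite ler_norml; have := ler_norm (a - b); have := ler_normr (b - a);
  rewrite ?(distrC b a); have := lerNnormlW (lexx `|a - b|); move=> ? ? ?; apply/andP; split; lra.
Qed.

(** Minkowski's inequality in the plane, for the root mean square. *)
Lemma mean_sqr_shift a b e : 0 <= a -> 0 <= b -> 0 <= e ->
  Num.sqrt (((a + e) ^+ 2 + (b + e) ^+ 2) / 2) <= Num.sqrt ((a ^+ 2 + b ^+ 2) / 2) + e.
Proof.
move=> a0 b0 e0; set s := Num.sqrt ((a ^+ 2 + b ^+ 2) / 2).
have s0 : 0 <= s by exact: sqrtr_ge0.
have s2 : s ^+ 2 = (a ^+ 2 + b ^+ 2) / 2 by rewrite sqr_sqrtr// divr_ge0// addr_ge0 ?sqr_ge0.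
have ab : a + b <= 2 * s.
  rewrite -(@ler_pXn2r _ 2)// ?nnegrE ?addr_ge0 ?mulr_ge0// exprMn s2.
  by have := sqr_ge0 (a - b); lra.
rewrite -[leRHS]ger0_norm ?addr_ge0// -sqrtr_sqr ler_wsqrtr//.
rewrite [leRHS]sqrrD s2 -mulr_natl; nra.
Qed.

Lemma le_mul_of_eps (x P S m : R) : 0 <= P -> 0 <= S -> 0 <= m ->
  (forall e, 0 < e -> e <= 1 -> x <= (P + e) * (S + e) + m * e) -> x <= P * S.
Proof.
move=> P0 S0 m0 h; apply/ler_addgt0Pr => e e0.
(* For e <= 1, the excess of the bound over P * S is at most (P + S + 1 + m) e. *)
pose K := P + S + 1 + m; have K0 : 0 < K by rewrite /K; lra.
have d0 : 0 < Num.min 1 (e / K) by rewrite lt_min ltr01 divr_gt0.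
apply: le_trans (h _ d0 _) _; first by rewrite ge_min lexx.
set d := Num.min _ _ in d0 *.
have d1 : d <= 1 by rewrite ge_min lexx.
have dK : d * K <= e by rewrite -ler_pdivlMr// ge_min lexx orbT.
by move: dK; rewrite /K; nra.
Qed.

Lemma norm_mul_le a b : `|a * b| <= a ^+ 2 + b ^+ 2.
Proof.
rewrite ler_norml; have := sqr_ge0 (a - b); have := sqr_ge0 (a + b).
by move=> ? ?; apply/andP; split; nra.
Qed.

End real_lemmas.

Section quartic.
Context {R : realType}.
Variable Omega : set (plane R).
Hypothesis oO : open Omega.
Implicit Types (x : plane R) (p q g phi psi : sfield R) (i : 'I_2).
Notation mplane := (measurableTypeR R * measurableTypeR R)%type.
Notation mu := (@leb2 R).
Let mO : measurable (Omega : set mplane) := open_measurable2 oO.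
Notation nrm := (snorm Omega).
Notation D := (wpartial Omega).

Lemma snorm_test_sqr phi : test_function Omega phi ->
  nrm (phi \* phi) <= nrm phi *
    Num.sqrt ((nrm (partial ord0 phi) ^+ 2 + nrm (partial ord_max phi) ^+ 2) / 2).
Proof.
move=> tphi; rewrite -sqrtrM ?ip_ge0//; apply: ler_wsqrtr.
have E (a b : sfield R) : nrm a ^+ 2 + nrm b ^+ 2 = ip mu Omega a a + ip mu Omega b b by rewrite (snorm_sqr _ a) (snorm_sqr _ b).
rewrite E; exact: (test_ladyzhenskaya tphi).
Qed.

(** |grad p| divided by the square root of 2: with this normalisation
Ladyzhenskaya's inequality reads |p^2| <= |p| [rmsgrad p]. *)
Definition rmsgrad p : R := Num.sqrt ((nrm (D ord0 p) ^+ 2 + nrm (D ord_max p) ^+ 2) / 2).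

Definition trunc2 (m : nat) p : sfield R := fun x => Num.min `|p x| m%:R ^+ 2.

Lemma trunc2_L2 m p : L2 mu Omega p -> L2 mu Omega (trunc2 m p).
Proof.
move=> Lp; apply: (L2_le mO _ (L2Z mO m%:R Lp)).
  apply: measurable_funX; apply: measurable_minr; last exact: measurable_cst.
  by apply: measurableT_comp => //; case: Lp.
move=> x _; have b0 : 0 <= Num.min `|p x| m%:R by rewrite le_min normr_ge0 ler0n.
rewrite /trunc2 normrX normrM !(ger0_norm b0) (ger0_norm (ler0n _ _)) expr2.
by apply: ler_pM => //; rewrite ge_min lexx ?orbT.
Qed.

(** The map taking [p] to the square of its truncation is Lipschitz in L^2, which
[p |-> p^2] is not; the bound therefore passes to the limit along approximating
test functions, with a right-hand side that does not depend on [m]. *)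
Lemma snorm_trunc2 m p : H10 Omega p -> nrm (trunc2 m p) <= nrm p * rmsgrad p.
Proof.
move=> hp; have Lp := H10_L2 hp; have Hp := H10_H1 hp; have /H10P[//|_ hp'] := hp.
apply: (@le_mul_of_eps _ _ _ _ (2 * m%:R)); rewrite ?sqrtr_ge0 ?mulr_ge0// => e e0 e1.
have [phi tphi [h0 hi]] := hp' e e0.
have Lphi := test_L2 oO tphi; have L2phi := test_L2 oO (testM tphi tphi).
have Lt := trunc2_L2 m Lp; have Ltphi := trunc2_L2 m Lphi.
have Ls := L2B mO Lp Lphi; have Lts := L2B mO Lt Ltphi.
have n1 : nrm (trunc2 m p) <= nrm (trunc2 m phi) + nrm (fun x => trunc2 m p x - trunc2 m phi x).
  apply: le_trans (snormD oO Ltphi Lts).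
  by have -> : (fun x => trunc2 m phi x + (trunc2 m p x - trunc2 m phi x)) = trunc2 m p by apply/funext => x; ring.
have n2 : nrm (trunc2 m phi) <= nrm (phi \* phi).
  apply: (snorm_le oO) => // x _; rewrite /trunc2 /= normrX normrM -expr2.
  have b0 : 0 <= Num.min `|phi x| m%:R by rewrite le_min normr_ge0 ler0n.
  by rewrite (ger0_norm b0) lerXn2r ?nnegrE// ge_min lexx.
have n3 : nrm (fun x => trunc2 m p x - trunc2 m phi x) <= 2 * m%:R * e.
  apply: (@le_trans _ _ (2 * m%:R * nrm (fun x => p x - phi x))).
    have -> : 2 * m%:R * nrm (fun x => p x - phi x) = nrm (fun x => (2 * m%:R) * (p x - phi x)).
      by rewrite snormZ// ger0_norm ?mulr_ge0.
    apply: (snorm_le oO) => //; first exact: L2Z.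
    move=> x _; rewrite [leRHS]normrM [`|2 * _|]ger0_norm ?mulr_ge0//.
    exact: truncation_lipschitz.
  by apply: ler_wpM2l; [rewrite mulr_ge0|exact: ltW].
have n4 := snorm_test_sqr tphi.
have n5 : nrm phi <= nrm p + e.
  have := snormD oO Lp (L2N mO Ls).
  have -> : (fun x => p x + - (p x - phi x)) = phi by apply/funext => x; ring.
  have -> : nrm (fun x => - (p x - phi x)) = nrm (fun x => p x - phi x).
    have := snormZ oO (-1) Ls; rewrite normrN1 mul1r => <-.
    by congr snorm; apply/funext => x; rewrite mulN1r.
  by move/le_trans; apply; rewrite lerD2l ltW.
have n6 i : nrm (partial i phi) <= nrm (D i p) + e.
  have Ldp := wpartial_L2 i Hp; have Ldphi := test_L2 oO (test_partial i tphi).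
  have Lds := L2B mO Ldp Ldphi.
  have := snormD oO Ldp (L2N mO Lds).
  have -> : (fun x => D i p x + - (D i p x - partial i phi x)) = partial i phi.
    by apply/funext => x; move: (D i p x) (partial i phi x) => a b; ring.
  have -> : nrm (fun x => - (D i p x - partial i phi x)) = nrm (fun x => D i p x - partial i phi x).
    have := snormZ oO (-1) Lds; rewrite normrN1 mul1r => <-.
    by congr snorm; apply/funext => x; rewrite mulN1r.
  by move/le_trans; apply; rewrite lerD2l ltW//; exact: hi.
apply: (le_trans n1); apply: lerD => //.
apply: (le_trans n2); apply: (le_trans n4); apply: ler_pM; rewrite ?sqrtr_ge0//.
apply: le_trans; last first.
  by apply: mean_sqr_shift; rewrite ?snorm_ge0// ltW.
apply: ler_wsqrtr; apply: ler_wpM2r; first by rewrite invr_ge0.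
by apply: lerD; apply: lerXn2r; rewrite ?nnegrE ?addr_ge0 ?snorm_ge0 ?(ltW e0)//; exact: n6.
Qed.

(** Monotone convergence in the level of truncation. *)
Lemma H10_quartic p : H10 Omega p ->
  L2 mu Omega (fun x => p x * p x) /\
  nrm (fun x => p x * p x) <= nrm p * rmsgrad p.
Proof.
move=> hp; have Lp := H10_L2 hp.
set K := nrm p * rmsgrad p; have K0 : 0 <= K by rewrite mulr_ge0 ?sqrtr_ge0.
have mp : measurable_fun (Omega : set mplane) p by case: Lp.
have mpp : measurable_fun (Omega : set mplane) (fun x => p x * p x) by exact: measurable_funM.
pose h m (x : mplane) := (trunc2 m p x ^+ 2)%:E.
have mh m : measurable_fun (Omega : set mplane) (h m).
  by apply/measurable_EFinP; apply: measurable_funX; case: (trunc2_L2 m Lp).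
have h0 m x : Omega x -> (0 <= h m x)%E by move=> _; rewrite lee_fin sqr_ge0.
have b0 m x : 0 <= Num.min `|p x| m%:R by rewrite le_min normr_ge0 ler0n.
have hnd x : Omega x -> nondecreasing_seq (h ^~ x).
  move=> _ m n mn; rewrite lee_fin /trunc2 -!exprM lerXn2r ?nnegrE//.
  by rewrite le_min !ge_min lexx/= ler_nat mn orbT.
have cv0 := cvg_monotone_convergence mO mh h0 hnd.
have E : (\int[mu]_(x in Omega) limn (h^~ x) = \int[mu]_(x in Omega) ((p x * p x) ^+ 2)%:E)%E.
  apply: eq_integral => x _; apply: lim_near_cst; first exact: ereal_hausdorff.
  near=> m; rewrite /h /trunc2 (_ : Num.min _ _ = `|p x|) ?real_normK ?num_real//.
  apply/min_idPl; near: m; exact: nbhs_infty_ger.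
have cv : (\int[mu]_(x in Omega) h m x)%E @[m --> \oo] --> (\int[mu]_(x in Omega) ((p x * p x) ^+ 2)%:E)%E.
  by rewrite -E; exact: cv0.
have lim_le : (\int[mu]_(x in Omega) ((p x * p x) ^+ 2)%:E <= (K ^+ 2)%:E)%E.
  rewrite -(cvg_lim (@ereal_hausdorff R) cv); apply: lime_le; first by apply/cvg_ex; eexists; exact: cv.
  near=> m; rewrite /h (ip_self_L2E mO (trunc2_L2 m Lp)) lee_fin -snorm_sqr.
  by rewrite lerXn2r ?nnegrE ?snorm_ge0//; exact: snorm_trunc2.
have Lpp : L2 mu Omega (fun x => p x * p x).
  by apply: L2_lt_pinfty => //; apply: le_lt_trans lim_le (ltry _).
split=> //.
move: lim_le; rewrite (ip_self_L2E mO Lpp) lee_fin -snorm_sqr.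
by rewrite ler_pXn2r ?nnegrE ?snorm_ge0.
Unshelve. all: by end_near. Qed.

(** (p q)^2 = p^2 q^2, and both factors are square integrable by [H10_quartic]. *)
Lemma H10_mul p q : H10 Omega p -> H10 Omega q ->
  L2 mu Omega (fun x => p x * q x) /\
  nrm (fun x => p x * q x) ^+ 2 <= (nrm p * rmsgrad p) * (nrm q * rmsgrad q).
Proof.
move=> hp hq; have [Lp np] := H10_quartic hp; have [Lq nq] := H10_quartic hq.
have Lpq : L2 mu Omega (fun x => p x * q x).
  apply: (L2_le mO _ (L2D mO Lp Lq)).
    by apply: measurable_funM; [case: (H10_L2 hp)|case: (H10_L2 hq)].
  by move=> x _; rewrite [leRHS]ger0_norm ?addr_ge0// -?expr2 ?sqr_ge0// norm_mul_le.
split; first exact: Lpq.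
have E : ip mu Omega (fun x => p x * q x) (fun x => p x * q x) =
   ip mu Omega (fun x => p x * p x) (fun x => q x * q x).
  by apply: eq_Rintegral => x _; rewrite mulrACA.
have C := le_trans (ler_norm _) (ip_CS mO Lp Lq).
rewrite snorm_sqr E; apply: (le_trans C).
apply: ler_pM; [exact: snorm_ge0|exact: snorm_ge0|exact: np|exact: nq].
Qed.

End quartic.

(** * The convection term *)

Lemma sum_sqrt_CS (R : realType) (n : nat) (a b : 'I_n -> R) :
  (forall i, 0 <= a i) -> (forall i, 0 <= b i) ->
  (\sum_i a i * b i) ^+ 2 <= (\sum_i a i ^+ 2) * (\sum_i b i ^+ 2).
Proof.
move=> a0 b0; apply: sqr_le_of_quadratic_ge0; last by apply: sumr_ge0 => i _; exact: sqr_ge0.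
move=> t.
have -> : \sum_i a i ^+ 2 + 2 * (\sum_i a i * b i) * t + (\sum_i b i ^+ 2) * t ^+ 2 =
   \sum_i (a i + t * b i) ^+ 2.
  rewrite mulr_sumr !mulr_suml -!big_split/=; apply: eq_bigr => i _; ring.
by apply: sumr_ge0 => i _; exact: sqr_ge0.
Qed.

Section trilinear.
Context {R : realType}.
Variable Omega : set (plane R).
Hypothesis oO : open Omega.
Implicit Types (p q phi psi : sfield R) (u v w z : vfield R) (i j : 'I_2).
Notation mplane := (measurableTypeR R * measurableTypeR R)%type.
Notation mu := (@leb2 R).
Let mO : measurable (Omega : set mplane) := open_measurable2 oO.
Notation nrm := (snorm Omega).
Notation D := (wpartial Omega).

(** The convection form is the L^2 product of the gradient of its second argument
with this field, so that it inherits bilinearity and Cauchy-Schwarz. *)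
Definition tensor u w : plane R -> 'M[R]_2 :=
  fun x => \matrix_(i, j) (u x ord0 i * w x ord0 j).

Lemma trilinE u v w : trilin Omega u v w = l2dot Omega (grad Omega v) (tensor u w).
Proof.
apply: eq_Rintegral => x _; rewrite big_ord1 [RHS]exchange_big/=.
apply: eq_bigr => j _; rewrite [(_ *m _) _ _]mxE mulr_suml; apply: eq_bigr => i _.
rewrite [tensor _ _ _ _ _]mxE; move: (grad Omega v x i j) => a.
by rewrite mulrCA mulrA.
Qed.

Definition vH10 u := forall j, H10 Omega (coord_fun u j).

Lemma vH10_mL2 u : vH10 u -> mL2 Omega u.
Proof. by move=> hu i j; rewrite (ord1 i); exact: (H10_L2 (hu j)). Qed.

Lemma vH10_grad u : vH10 u -> mL2 Omega (grad Omega u).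
Proof.
move=> hu i j; have := wpartial_L2 i (H10_H1 (hu j)).
by have -> : (fun x => grad Omega u x i j) = D i (coord_fun u j) by apply/funext => x; rewrite mxE.
Qed.

Lemma vH10_tensor u w : vH10 u -> vH10 w -> mL2 Omega (tensor u w).
Proof.
move=> hu hw i j; have [+ _] := H10_mul oO (hu i) (hw j).
by have -> : (fun x => tensor u w x i j) = (fun x => coord_fun u i x * coord_fun w j x) by apply/funext => x; rewrite mxE.
Qed.

Lemma l2norm_sumE m n (F : plane R -> 'M[R]_(m, n)) : mL2 Omega F ->
  l2norm Omega F ^+ 2 = \sum_i \sum_j nrm (fun x => F x i j) ^+ 2.
Proof.
move=> LF; rewrite l2norm_sqr (l2dotE oO LF LF); apply: eq_bigr => i _; apply: eq_bigr => j _.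
by rewrite snorm_sqr.
Qed.

(** Ladyzhenskaya's inequality for the four products of components, followed by the
Cauchy-Schwarz inequality for finite sums. *)
Lemma tensor_bound u w : vH10 u -> vH10 w ->
  (l2norm Omega (tensor u w) ^+ 2) <=
  1 / 2 * (l2norm Omega u * l2norm Omega (grad Omega u)) *
  (l2norm Omega w * l2norm Omega (grad Omega w)).
Proof.
move=> hu hw.
pose N v := \sum_i nrm (coord_fun v i) * rmsgrad Omega (coord_fun v i).
have N0 v : 0 <= N v by apply: sumr_ge0 => i _; rewrite mulr_ge0 ?sqrtr_ge0.
have Nle v : vH10 v -> N v ^+ 2 <= 1 / 2 * (l2norm Omega v * l2norm Omega (grad Omega v)) ^+ 2.
  move=> hv; rewrite exprMn.
  have -> : l2norm Omega v ^+ 2 = \sum_i nrm (coord_fun v i) ^+ 2.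
    by rewrite (l2norm_sumE (vH10_mL2 hv)) big_ord1.
  have -> : l2norm Omega (grad Omega v) ^+ 2 = 2 * \sum_i rmsgrad Omega (coord_fun v i) ^+ 2.
    rewrite (l2norm_sumE (vH10_grad hv)) exchange_big/= mulr_sumr; apply: eq_bigr => j _.
    rewrite sqr_sqrtr; last by rewrite divr_ge0// addr_ge0 ?sqr_ge0.
    rewrite mulrCA mulfV ?pnatr_eq0// mulr1 big_ord_recl big_ord1.
    have -> : lift ord0 ord0 = ord_max :> 'I_2 by apply/val_inj.
    by congr (_ ^+ 2 + _ ^+ 2); congr snorm; apply/funext => x; rewrite mxE.
  apply: le_trans (sum_sqrt_CS _ _) _; try by move=> i; exact: sqrtr_ge0.
  move: (\sum_i _) (\sum_i _) => a b; lra.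
have Nle' v : vH10 v -> N v <= Num.sqrt (1 / 2) * (l2norm Omega v * l2norm Omega (grad Omega v)).
  move=> hv; rewrite -(@ler_pXn2r _ 2)// ?nnegrE ?mulr_ge0 ?sqrtr_ge0//.
  by rewrite exprMn sqr_sqrtr ?divr_ge0//; exact: Nle.
apply: (@le_trans _ _ (N u * N w)).
  rewrite (l2norm_sumE (vH10_tensor hu hw)) mulr_suml; apply: ler_sum => i _.
  rewrite mulr_sumr; apply: ler_sum => j _; have [_] := H10_mul oO (hu i) (hw j).
  by have -> : (fun x => tensor u w x i j) = (fun x => coord_fun u i x * coord_fun w j x) by apply/funext => x; rewrite mxE.
have := ler_pM (N0 u) (N0 w) (Nle' u hu) (Nle' w hw).
have e : Num.sqrt (1 / 2) * Num.sqrt (1 / 2) = 1 / 2 :> R by rewrite -expr2 sqr_sqrtr// divr_ge0.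
by rewrite mulrACA e mulrA.
Qed.

Lemma trilin_bound u v w : vH10 u -> vH10 v -> vH10 w ->
  trilin Omega u v w ^+ 2 <= 1 / 2 * l2norm Omega (grad Omega v) ^+ 2 *
  (l2norm Omega u * l2norm Omega (grad Omega u)) *
  (l2norm Omega w * l2norm Omega (grad Omega w)).
Proof.
move=> hu hv hw; rewrite trilinE.
have C := l2dot_CS oO (vH10_grad hv) (vH10_tensor hu hw).
have B := tensor_bound hu hw.
move: C B (l2norm_ge0 Omega (grad Omega v)) (l2norm_ge0 Omega (tensor u w)).
move: (l2dot _ _ _) (l2norm _ (grad _ v)) (l2norm _ (tensor _ _)) (l2norm _ u * _) (l2norm _ w * _) => a b c d e C B b0 c0.
apply: (@le_trans _ _ (b ^+ 2 * c ^+ 2)).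
  by rewrite -exprMn -(real_normK (num_real a)) lerXn2r ?nnegrE ?mulr_ge0.
apply: (@le_trans _ _ (b ^+ 2 * (1 / 2 * d * e))); first by rewrite ler_wpM2l ?sqr_ge0.
by rewrite le_eqVlt; apply/orP; left; apply/eqP; ring.
Qed.

End trilinear.

(** * Skew-symmetry of the convection term *)

Lemma eq0_of_eps (R : realType) (x a : R) : 0 <= a ->
  (forall e, 0 < e -> e <= 1 -> `|x| <= a * e) -> x = 0.
Proof.
move=> a0 h; apply/eqP; rewrite -normr_le0.
have := @le_mul_of_eps R `|x| 0 0 a (lexx _) (lexx _) a0; rewrite mulr0; apply => e e0 e1.
rewrite add0r (le_trans (h e e0 e1))// lerDr; exact: mulr_ge0 (ltW e0) (ltW e0).
Qed.

(** The error estimate of [transport_antisym]: [a] and [b] bound the norms of the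
two arguments, [s] and [s'] those of the approximation errors. *)
Lemma norm_six_le (R : realType) (C a b s s' e y1 y2 y3 y4 y5 y6 : R) :
  0 <= C -> 0 <= a -> 0 <= b -> 0 <= s -> 0 <= s' -> s <= 3 * e -> s' <= 3 * e ->
  0 < e -> e <= 1 ->
  `|y1| <= C * (s * b) -> `|y2| <= C * (b * s) -> `|y3| <= C * (a * s') ->
  `|y4| <= C * (s' * a) -> `|y5| <= C * (s * s') -> `|y6| <= C * (s' * s) ->
  `|y1 + y2 + (y3 + y4) - (y5 + y6)| <= 2 * C * (3 * b + 3 * a + 9) * e.
Proof.
move=> C0 a0 b0 s0 s1 sv sz e0 e1 h1 h2 h3 h4 h5 h6.
have k1 : C * (s * b) <= C * (3 * e * b) by rewrite ler_wpM2l// ler_wpM2r.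
have k2 : C * (a * s') <= C * (a * (3 * e)) by rewrite ler_wpM2l// ler_wpM2l.
have k3 : C * (s * s') <= C * (9 * e).
  rewrite ler_wpM2l//; apply: (@le_trans _ _ (3 * e * (3 * e))); first exact: ler_pM.
  nra.
apply: (@le_trans _ _ (2 * (C * (s * b) + C * (a * s') + C * (s * s')))).
  move: h2 h4 h6; rewrite (mulrC b s) (mulrC s' a) (mulrC s' s) => h2 h4 h6.
  move: h1 h2 h3 h4 h5 h6; rewrite !ler_norml.
  move=> /andP[? ?] /andP[? ?] /andP[? ?] /andP[? ?] /andP[? ?] /andP[? ?].
  by apply/andP; split; lra.
move: k1 k2 k3; move: (C * (s * b)) (C * (a * s')) (C * (s * s')) => x1 x2 x3 k1 k2 k3.
lra.
Qed.

Lemma norm_six_cst_ge0 (R : realType) (C a b : R) : 0 <= C -> 0 <= a -> 0 <= b ->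
  0 <= 2 * C * (3 * b + 3 * a + 9).
Proof. by move=> C0 a0 b0; rewrite !mulr_ge0 ?addr_ge0// mulr_ge0. Qed.

(** For a bilinear form, written out with v = dv + phi and z = dz + psi; the terms
in (phi, psi) cancel by hypothesis. *)
Lemma antisym_split (R : realType)
  (vz av fz fdz ff vdz ddz zv zdv zf dzf ff' dzv dzdv : R) :
  vz = av + fz -> fz = fdz + ff -> vdz = ddz + fdz -> zv = zdv + zf ->
  zf = dzf + ff' -> dzv = dzdv + dzf -> ff + ff' = 0 ->
  vz + zv = (av + zdv) + (vdz + dzv) - (ddz + dzdv).
Proof. by lra. Qed.

Section transport.
Context {R : realType}.
Variable Omega : set (plane R).
Hypothesis oO : open Omega.
Variable w : vfield R.
Hypothesis hw : vH10 Omega w.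
Implicit Types (p q v z phi psi : sfield R) (i j : 'I_2).
Notation mplane := (measurableTypeR R * measurableTypeR R)%type.
Notation mu := (@leb2 R).
Let mO : measurable (Omega : set mplane) := open_measurable2 oO.
Notation nrm := (snorm Omega).
Notation D := (wpartial Omega).

(** The integral of (w . grad v) z, for scalar functions. *)
Definition transport v z : R :=
  \sum_i ip mu Omega (D i v) (fun x => coord_fun w i x * z x).

Lemma transport_mul_L2 z i : H10 Omega z -> L2 mu Omega (fun x => coord_fun w i x * z x).
Proof. by move=> hz; have [] := H10_mul oO (hw i) hz. Qed.

Lemma transportDZl v v' k z : H10 Omega v -> H10 Omega v' -> H10 Omega z ->
  transport (fun x => v x + k * v' x) z = transport v z + k * transport v' z.
Proof.
move=> hv hv' hz; rewrite /transport mulr_sumr -big_split/=; apply: eq_bigr => i _.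
have Lz := transport_mul_L2 i hz.
have L1 := wpartial_L2 i (H10_H1 hv); have L3 := wpartial_L2 i (H10_H1 hv').
have H3 := H1Z oO k (H10_H1 hv').
have L4 := wpartial_L2 i H3.
have L5 := wpartial_L2 i (H1D oO (H10_H1 hv) H3).
apply: (@etrans _ _ (ip mu Omega (fun x => D i v x + k * D i v' x) (fun x => coord_fun w i x * z x))).
  apply: (ae_ipl mO); [by case: L5|by case: (L2D mO L1 (L2Z mO k L3))|by case: Lz|].
  have A1 := wpartialD oO i (H10_H1 hv) H3; have A2 := wpartialZ oO k i (H10_H1 hv').
  by apply: (ae_imp2 A1 A2) => x h1 h2 Ox; rewrite h1// h2.
by rewrite (ipDl mO L1 (L2Z mO k L3) Lz) (ipZl mO k L3 Lz).
Qed.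

Lemma transportDZr v z k z' : H10 Omega v -> H10 Omega z -> H10 Omega z' ->
  transport v (fun x => z x + k * z' x) = transport v z + k * transport v z'.
Proof.
move=> hv hz hz'; rewrite /transport mulr_sumr -big_split/=; apply: eq_bigr => i _.
have Lz := transport_mul_L2 i hz; have Lz' := transport_mul_L2 i hz'.
have L1 := wpartial_L2 i (H10_H1 hv).
rewrite !(ipC mu Omega (D i v)).
rewrite -(ipZl mO k Lz' L1) -(ipDl mO Lz (L2Z mO k Lz') L1).
by congr ip; apply/funext => x; rewrite mulrDr mulrCA.
Qed.

Definition h1sum p : R := nrm p + (nrm (D ord0 p) + nrm (D ord_max p)).

Lemma h1sum_ge0 p : 0 <= h1sum p.
Proof. by rewrite /h1sum !addr_ge0 ?snorm_ge0. Qed.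

Lemma wpartial_le_h1sum p i : nrm (D i p) <= h1sum p.
Proof.
rewrite /h1sum; elim/ord2P: i.
  by rewrite addrCA lerDl addr_ge0 ?snorm_ge0.
by rewrite addrA lerDr addr_ge0 ?snorm_ge0.
Qed.

Lemma rms_le (a b c : R) : 0 <= a -> 0 <= b -> 0 <= c ->
  a * Num.sqrt ((b ^+ 2 + c ^+ 2) / 2) <= (a + (b + c)) ^+ 2.
Proof.
move=> a0 b0 c0.
have h : Num.sqrt ((b ^+ 2 + c ^+ 2) / 2) <= b + c.
  rewrite -[leRHS]ger0_norm ?addr_ge0// -sqrtr_sqr ler_wsqrtr//.
  have h1 := mulr_ge0 b0 c0; have h2 := sqr_ge0 b; have h3 := sqr_ge0 c.
  by rewrite [leRHS]sqrrD -mulr_natl; lra.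
apply: (@le_trans _ _ (a * (b + c))); first by rewrite ler_wpM2l.
have h1 := mulr_ge0 a0 (addr_ge0 b0 c0); have h2 := sqr_ge0 a; have h3 := sqr_ge0 (b + c).
by rewrite [leRHS]sqrrD -mulr_natl; lra.
Qed.

Definition transport_cst : R := \sum_i Num.sqrt (nrm (coord_fun w i) * rmsgrad Omega (coord_fun w i)).

Lemma transport_cst_ge0 : 0 <= transport_cst.
Proof. by apply: sumr_ge0 => i _; exact: sqrtr_ge0. Qed.

Lemma transport_bound v z : H10 Omega v -> H10 Omega z ->
  `|transport v z| <= transport_cst * (h1sum v * h1sum z).
Proof.
move=> hv hz; apply: le_trans (ler_norm_sum _ _ _) _.
rewrite /transport_cst mulr_suml; apply: ler_sum => i _.
have Lz := transport_mul_L2 i hz; have L1 := wpartial_L2 i (H10_H1 hv).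
apply: le_trans (ip_CS mO L1 Lz) _.
rewrite -/(snorm Omega (D i v)) -/(snorm Omega (fun x => coord_fun w i x * z x)).
rewrite mulrCA; apply: ler_pM; [exact: snorm_ge0|exact: snorm_ge0|exact: wpartial_le_h1sum|].
have [_ h] := H10_mul oO (hw i) hz.
have N0 : 0 <= nrm (coord_fun w i) * rmsgrad Omega (coord_fun w i) by rewrite mulr_ge0 ?sqrtr_ge0.
rewrite -(ger0_norm (snorm_ge0 _ _)) -sqrtr_sqr.
apply: le_trans (ler_wsqrtr h) _; rewrite sqrtrM//; apply: ler_wpM2l; first exact: sqrtr_ge0.
rewrite -[leRHS](ger0_norm (h1sum_ge0 z)) -sqrtr_sqr; apply: ler_wsqrtr.
by apply: rms_le; exact: snorm_ge0.
Qed.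

Lemma test_H10 phi : test_function Omega phi -> H10 Omega phi.
Proof.
move=> tphi; apply/H10P => //; split; first exact: test_H1.
move=> e e0; exists phi => //.
have n0 : nrm (fun=> 0) = 0.
  have := snormZ oO 0 (L2_0 mu Omega); rewrite normr0 => h.
  apply: (@etrans _ _ (0 * nrm (fun=> 0))); last exact: mul0r.
  by rewrite -h; congr snorm; apply/funext => x; rewrite mul0r.
split.
  have -> : (fun x => phi x - phi x) = (fun=> 0) by apply/funext => x; rewrite subrr.
  by rewrite n0.
move=> i; have L1 := wpartial_L2 i (test_H1 oO tphi); have L3 := test_L2 oO (test_partial i tphi).
rewrite (@snorm_ae _ _ oO _ (fun=> 0)) ?n0//; first by case: (L2B mO L1 L3).
by apply: (ae_imp (wpartial_test oO i tphi)) => x h Ox; rewrite h// subrr.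
Qed.

Hypothesis div_w : div_free Omega w.

(** The divergence of [w] vanishes against the test function [phi * psi], whose
gradient is given by the Leibniz rule. *)
Lemma transport_test phi psi : test_function Omega phi -> test_function Omega psi ->
  transport phi psi + transport psi phi = 0.
Proof.
move=> tphi tpsi; have tM := testM tphi tpsi.
have Lw := vH10_mL2 hw.
have Lr : mL2 Omega (fun x => \row_i partial i (phi \* psi) x).
  move=> i j; have := test_L2 oO (test_partial j tM).
  by have -> : (fun x => (\row_i0 partial i0 (phi \* psi) x) i j) = partial j (phi \* psi) by apply/funext => x; rewrite mxE.
have := div_w tM; rewrite (l2dotE oO Lw Lr) big_ord1 => <-.
rewrite /transport -big_split/=; apply: eq_bigr => i _.
have Lphi := transport_mul_L2 i (test_H10 tphi); have Lpsi := transport_mul_L2 i (test_H10 tpsi).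
have L1 := wpartial_L2 i (test_H1 oO tphi); have L3 := test_L2 oO (test_partial i tphi).
have L2' := wpartial_L2 i (test_H1 oO tpsi); have L4 := test_L2 oO (test_partial i tpsi).
have -> : ip mu Omega (D i phi) (fun x => coord_fun w i x * psi x) = ip mu Omega (partial i phi) (fun x => coord_fun w i x * psi x).
  by apply: (ae_ipl mO); [case: L1|case: L3|case: Lpsi|exact: wpartial_test].
have -> : ip mu Omega (D i psi) (fun x => coord_fun w i x * phi x) = ip mu Omega (partial i psi) (fun x => coord_fun w i x * phi x).
  by apply: (ae_ipl mO); [case: L2'|case: L4|case: Lphi|exact: wpartial_test].
have := RintegralD mO (L2_integrableM mO L3 Lpsi) (L2_integrableM mO L4 Lphi).
rewrite /ip => <-; apply: eq_Rintegral => x _.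
rewrite [(\row_ _ _) _ _]mxE partialM; [|by case: tphi|by case: tpsi].
by rewrite /coord_fun/=; ring.
Qed.

Lemma h1sum_sub_test v phi e : H10 Omega v -> test_function Omega phi ->
  nrm (fun x => v x - phi x) < e ->
  (forall i, nrm (fun x => D i v x - partial i phi x) < e) ->
  h1sum (fun x => v x + (-1) * phi x) <= 3 * e.
Proof.
move=> hv tphi h0 hi.
have -> : (fun x => v x + (-1) * phi x) = (fun x => v x - phi x) by apply/funext => x; rewrite mulN1r.
have hD i : nrm (D i (fun x => v x - phi x)) <= e.
  by apply: ltW; rewrite (wpartial_sub_test oO i (H10_H1 hv) tphi); exact: hi.
have -> : 3 * e = e + (e + e) by ring.
apply: lerD; first exact: ltW h0.
by apply: lerD; exact: hD.
Qed.

(** Continuity of [transport] in the H^1 norm and density of test functions. *)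
Lemma transport_antisym v z : H10 Omega v -> H10 Omega z ->
  transport v z + transport z v = 0.
Proof.
move=> hv hz.
have C0 := transport_cst_ge0; have a0 := h1sum_ge0 v; have b0 := h1sum_ge0 z.
apply: (eq0_of_eps (norm_six_cst_ge0 C0 a0 b0)).
move=> e e0 e1.
have [_ /(_ e e0)[phi tphi [p0 pi]]] := (H10P oO v).1 hv.
have [_ /(_ e e0)[psi tpsi [q0 qi]]] := (H10P oO z).1 hz.
have hphi := test_H10 tphi; have hpsi := test_H10 tpsi.
pose dv x := v x + (-1) * phi x; pose dz x := z x + (-1) * psi x.
have hdv : H10 Omega dv by exact: (H10D oO hv (H10Z oO (-1) hphi)).
have hdz : H10 Omega dz by exact: (H10D oO hz (H10Z oO (-1) hpsi)).
have sv : h1sum dv <= 3 * e by exact: h1sum_sub_test.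
have sz : h1sum dz <= 3 * e by exact: h1sum_sub_test.
have t1 := transport_test tphi tpsi.
have vE : v = (fun x => dv x + 1 * phi x) by apply/funext => x; rewrite /dv; ring.
have zE : z = (fun x => dz x + 1 * psi x) by apply/funext => x; rewrite /dz; ring.
have B1 := transport_bound hdv hz; have B2 := transport_bound hz hdv.
have B3 := transport_bound hv hdz; have B4 := transport_bound hdz hv.
have B5 := transport_bound hdv hdz; have B6 := transport_bound hdz hdv.
have e1' : transport v z = transport dv z + transport phi z.
  by have := transportDZl 1 hdv hphi hz; rewrite -vE mul1r.
have e2 : transport phi z = transport phi dz + transport phi psi.
  by have := transportDZr 1 hphi hdz hpsi; rewrite -zE mul1r.
have e3 : transport v dz = transport dv dz + transport phi dz.
  by have := transportDZl 1 hdv hphi hdz; rewrite -vE mul1r.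
have e4 : transport z v = transport z dv + transport z phi.
  by have := transportDZr 1 hz hdv hphi; rewrite -vE mul1r.
have e5 : transport z phi = transport dz phi + transport psi phi.
  by have := transportDZl 1 hdz hpsi hphi; rewrite -zE mul1r.
have e6 : transport dz v = transport dz dv + transport dz phi.
  by have := transportDZr 1 hdz hdv hphi; rewrite -vE mul1r.
have -> : transport v z + transport z v =
  (transport dv z + transport z dv) + (transport v dz + transport dz v)
  - (transport dv dz + transport dz dv).
  exact: antisym_split e1' e2 e3 e4 e5 e6 t1.
have s0 := h1sum_ge0 dv; have s1 := h1sum_ge0 dz.
exact: (norm_six_le C0 a0 b0 s0 s1 sv sz e0 e1 B1 B2 B3 B4 B5 B6).
Qed.

End transport.

(** * Divergence-free fields *)

Lemma square_regroup (R : realType) (a b c : R) : a + 2 * b + c = a + b + (b + c).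
Proof. ring. Qed.

Section solenoidal.
Context {R : realType}.
Variable Omega : set (plane R).
Hypothesis oO : open Omega.
Implicit Types (p q phi psi : sfield R) (u v w z : vfield R) (i j : 'I_2) (k : R).
Notation mplane := (measurableTypeR R * measurableTypeR R)%type.
Notation mu := (@leb2 R).
Let mO : measurable (Omega : set mplane) := open_measurable2 oO.
Notation D := (wpartial Omega).
Notation V := (in_V Omega).

Lemma in_V_vH10 u : V u -> vH10 Omega u.
Proof. by case. Qed.

Lemma coord_funD u v j : coord_fun (u + v) j = (fun x => coord_fun u j x + coord_fun v j x).
Proof. by apply/funext => x; rewrite /coord_fun mxE. Qed.

Lemma coord_funZ k u j : coord_fun (k *: u) j = (fun x => k * coord_fun u j x).
Proof. by apply/funext => x; rewrite /coord_fun mxE. Qed.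

Lemma mL2_row_partial phi : test_function Omega phi ->
  mL2 Omega (fun x => \row_i partial i phi x).
Proof.
move=> tphi i j; have := test_L2 oO (test_partial j tphi).
by have -> : (fun x => (\row_i0 partial i0 phi x) i j) = partial j phi by apply/funext => x; rewrite mxE.
Qed.

Lemma in_VD u v : V u -> V v -> V (u + v).
Proof.
move=> Vu Vv; have [hu du] := Vu; have [hv dv] := Vv; split.
  by move=> j; rewrite coord_funD; exact: (H10D oO (hu j) (hv j)).
move=> phi tphi.
by rewrite (l2dotDl oO (vH10_mL2 hu) (vH10_mL2 hv) (mL2_row_partial tphi)) du// dv// addr0.
Qed.

Lemma in_VZ k u : V u -> V (k *: u).
Proof.
move=> Vu; have [hu du] := Vu; split.
  by move=> j; rewrite coord_funZ; exact: (H10Z oO k (hu j)).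
move=> phi tphi.
by rewrite (l2dotZl oO k (vH10_mL2 hu) (mL2_row_partial tphi)) du// mulr0.
Qed.

Lemma in_V_mL2 u : V u -> mL2 Omega u. Proof. by case=> hu _; exact: vH10_mL2. Qed.

Lemma in_V_grad u : V u -> mL2 Omega (grad Omega u).
Proof. by case=> hu _; exact: vH10_grad. Qed.

Lemma gradD_ae u v i j : V u -> V v ->
  ae_eq mu Omega (fun x => grad Omega (u + v) x i j) (fun x => (grad Omega u x + grad Omega v x) i j).
Proof.
move=> [hu _] [hv _].
have -> : (fun x => grad Omega (u + v) x i j) = D i (fun x => coord_fun u j x + coord_fun v j x).
  by apply/funext => x; rewrite mxE coord_funD.
have -> : (fun x => (grad Omega u x + grad Omega v x) i j) = (fun x => D i (coord_fun u j) x + D i (coord_fun v j) x).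
  by apply/funext => x; rewrite !mxE.
exact: (wpartialD oO i (H10_H1 (hu j)) (H10_H1 (hv j))).
Qed.

Lemma gradZ_ae k u i j : V u ->
  ae_eq mu Omega (fun x => grad Omega (k *: u) x i j) (fun x => (k *: grad Omega u x) i j).
Proof.
move=> [hu _].
have -> : (fun x => grad Omega (k *: u) x i j) = D i (fun x => k * coord_fun u j x).
  by apply/funext => x; rewrite mxE coord_funZ.
have -> : (fun x => (k *: grad Omega u x) i j) = (fun x => k * D i (coord_fun u j) x).
  by apply/funext => x; rewrite !mxE.
exact: (wpartialZ oO k i (H10_H1 (hu j))).
Qed.

Lemma stokesDl u v w : V u -> V v -> V w ->
  stokes Omega (u + v) w = stokes Omega u w + stokes Omega v w.
Proof.
move=> Vu Vv Vw; have Lu := in_V_grad Vu; have Lv := in_V_grad Vv; have Lw := in_V_grad Vw.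
rewrite /stokes -(l2dotDl oO Lu Lv Lw).
apply: (l2dot_ae oO (in_V_grad (in_VD Vu Vv)) (mL2D oO Lu Lv) Lw) => i j.
exact: gradD_ae.
Qed.

Lemma stokesZl k u w : V u -> V w -> stokes Omega (k *: u) w = k * stokes Omega u w.
Proof.
move=> Vu Vw; have Lu := in_V_grad Vu; have Lw := in_V_grad Vw.
rewrite /stokes -(l2dotZl oO k Lu Lw).
apply: (l2dot_ae oO (in_V_grad (in_VZ k Vu)) (mL2Z oO k Lu) Lw) => i j.
exact: gradZ_ae.
Qed.

Lemma stokesC u v : stokes Omega u v = stokes Omega v u.
Proof. exact: l2dotC. Qed.

Lemma l2norm_gradD u v : V u -> V v ->
  l2norm Omega (grad Omega u + grad Omega v) ^+ 2 = stokes Omega (u + v) (u + v).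
Proof.
move=> Vu Vv; have Lu := in_V_grad Vu; have Lv := in_V_grad Vv.
rewrite l2norm_sqr (l2dot_sqrD oO Lu Lv).
have Vs := in_VD Vu Vv.
rewrite (stokesDl Vu Vv Vs) (stokesC u) (stokesC v) (stokesDl Vu Vv Vu) (stokesDl Vu Vv Vv).
rewrite /stokes (l2dotC _ (grad Omega v) (grad Omega u)).
exact: square_regroup.
Qed.

Lemma trilinDr u v w z : V u -> V v -> V w -> V z ->
  trilin Omega u v (w + z) = trilin Omega u v w + trilin Omega u v z.
Proof.
move=> Vu Vv Vw Vz; rewrite !trilinE.
have Lg := in_V_grad Vv.
have Lw := vH10_tensor oO (in_V_vH10 Vu) (in_V_vH10 Vw); have Lz := vH10_tensor oO (in_V_vH10 Vu) (in_V_vH10 Vz).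
rewrite !(l2dotC _ (grad Omega v)) -(l2dotDl oO Lw Lz Lg).
by congr l2dot; apply/funext => x; apply/matrixP => i j; rewrite !mxE mulrDr.
Qed.

Lemma trilinZr u v k w : V u -> V v -> V w ->
  trilin Omega u v (k *: w) = k * trilin Omega u v w.
Proof.
move=> Vu Vv Vw; rewrite !trilinE.
have Lg := in_V_grad Vv; have Lw := vH10_tensor oO (in_V_vH10 Vu) (in_V_vH10 Vw).
rewrite !(l2dotC _ (grad Omega v)) -(l2dotZl oO k Lw Lg).
by congr l2dot; apply/funext => x; apply/matrixP => i j; rewrite !mxE mulrCA.
Qed.

Lemma trilin_transport u v w : V u -> V v -> V w ->
  trilin Omega u v w = \sum_j transport Omega u (coord_fun v j) (coord_fun w j).
Proof.
move=> Vu Vv Vw; rewrite trilinE.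
rewrite (l2dotE oO (in_V_grad Vv) (vH10_tensor oO (in_V_vH10 Vu) (in_V_vH10 Vw))) exchange_big/=.
apply: eq_bigr => j _; apply: eq_bigr => i _.
by congr ip; apply/funext => x; rewrite mxE.
Qed.

Lemma trilin_antisym u v w : V u -> V v -> V w ->
  trilin Omega u v w = - trilin Omega u w v.
Proof.
move=> Vu Vv Vw; apply/eqP; rewrite -addr_eq0; apply/eqP.
rewrite (trilin_transport Vu Vv Vw) (trilin_transport Vu Vw Vv) -big_split/=.
rewrite big1// => j _; apply: (transport_antisym oO (in_V_vH10 Vu)); first by case: Vu.
  exact: in_V_vH10 Vv j.
exact: in_V_vH10 Vw j.
Qed.

End solenoidal.

(** * Energy estimates for the two-step scheme *)

(** Young's inequality in the form used throughout: x <= 2 sqrt (a b) <= a + b. *)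
Lemma le_add_of_sqr (R : realType) (x a b : R) : 0 <= a -> 0 <= b ->
  x ^+ 2 <= 4 * (a * b) -> x <= a + b.
Proof.
move=> a0 b0 h; apply: le_trans (ler_norm _) _.
rewrite -(@ler_pXn2r _ 2)// ?nnegrE ?addr_ge0// real_normK ?num_real//.
by apply: (le_trans h); have := sqr_ge0 (a - b); rewrite -subr_ge0 => ?; nra.
Qed.

(** The constant c / eps is the fixed point of h |-> (h + c) / (1 + eps). *)
Lemma discrete_gronwall (R : realType) (h : nat -> R) (eps c : R) : 0 < eps -> 0 <= c ->
  (forall n, (1 <= n)%N -> (1 + eps) * h n.+1 <= h n + c) ->
  forall n, h n.+1 <= h 1%N / (1 + eps) ^+ n + c / eps.
Proof.
move=> e0 c0 hs; have k0 : 0 < 1 + eps by rewrite addr_gt0.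
elim=> [|n IH]; first by rewrite expr0 divr1 lerDl divr_ge0// ltW.
have := hs n.+1 isT; rewrite mulrC -ler_pdivlMr// => /le_trans; apply.
rewrite ler_pdivrMr//.
have -> : (h 1%N / (1 + eps) ^+ n.+1 + c / eps) * (1 + eps) = h 1%N / (1 + eps) ^+ n + c / eps + c.
  by rewrite exprS; field; rewrite !gt_eqF// exprn_gt0.
by rewrite lerD2r.
Qed.

Lemma telescope_step (R : realType) (ds s s1 g0 g g' dn e0 e e' B b1 c D d1 cf m nd W w1 : R) (k : nat) :
  ds * s + g + dn * e + B + c * D <= g0 + dn * e0 + k%:R * cf + m * (nd * W) ->
  ds * s1 + (g' - g) + dn * (e' - e) + b1 + c * d1 <= cf + m * (nd * w1) ->
  ds * (s + s1) + g' + dn * e' + (B + b1) + c * (D + d1) <=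
    g0 + dn * e0 + k.+1%:R * cf + m * (nd * (W + w1)).
Proof.
move=> h1 h2; have := lerD h1 h2; rewrite -addn1 natrD -subr_ge0 => h.
by rewrite -subr_ge0; apply: le_trans h _; rewrite le_eqVlt; apply/orP; left; apply/eqP; ring.
Qed.

Section coefficients.
Context {R : realType}.
Variable theta : R.
Hypothesis th : 0 < theta < 1.

Lemma beta_sum : beta0 theta + beta1 theta + beta2 theta = 1.
Proof. by rewrite /beta0 /beta1 /beta2; field. Qed.

Lemma beta0_gt0 : 0 < beta0 theta.
Proof. by move/andP: th => [t0 t1]; rewrite /beta0 divr_gt0//; nra. Qed.

Lemma beta1_ge0 : 0 <= beta1 theta.
Proof. by rewrite /beta1 divr_ge0// sqr_ge0. Qed.

Lemma delta_gt0 : 0 < 2 * beta2 theta - 1.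
Proof. by move/andP: th => [t0 t1]; rewrite /beta2; have := mulr_gt0 t0 (ltac:(lra) : 0 < 1 - theta); lra. Qed.

Lemma beta2_gt0 : 0 < beta2 theta.
Proof. by have := delta_gt0; lra. Qed.

Lemma a1_sqr : a1 theta ^+ 2 = theta * (1 - theta ^+ 2) / 2.
Proof.
move/andP: th => [t0 t1]; rewrite /a1 sqrrN sqr_sqrtr// divr_ge0// mulr_ge0 ?ltW// subr_gt0.
by rewrite expr_lt1 ?ltW.
Qed.

Lemma h11_bound_gt0 : 0 < h11_bound theta.
Proof.
move/andP: th => [t0 t1]; rewrite /h11_bound; apply: mulr_gt0; last by nra.
by rewrite divr_gt0 ?exprn_gt0.
Qed.

End coefficients.

(** What the estimates use of the spaces H and V: [S] is the space V, [L] and [A]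
are the L^2 and the Dirichlet form, [T] the convection form and [lambda] the
Poincare constant. *)
Record energy_space {R : realType} {V : lmodType R} (S : V -> Prop)
    (L A : V -> V -> R) (nL nA : V -> R) (T : V -> V -> V -> R) (lambda : R) : Prop := {
  es_add : forall u v, S u -> S v -> S (u + v);
  es_scale : forall k u, S u -> S (k *: u);
  es_LC : forall u v, L u v = L v u;
  es_AC : forall u v, A u v = A v u;
  es_LD : forall u v w, S u -> S v -> S w -> L (u + v) w = L u w + L v w;
  es_LZ : forall k u w, S u -> S w -> L (k *: u) w = k * L u w;
  es_AD : forall u v w, S u -> S v -> S w -> A (u + v) w = A u w + A v w;
  es_AZ : forall k u w, S u -> S w -> A (k *: u) w = k * A u w;
  es_L_ge0 : forall u, 0 <= nL u;
  es_A_ge0 : forall u, 0 <= nA u;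
  es_L_norm : forall u, nL u ^+ 2 = L u u;
  es_A_norm : forall u, nA u ^+ 2 = A u u;
  es_T_antisym : forall u v w, S u -> S v -> S w -> T u v w = - T u w v;
  es_TD : forall u v w z, S u -> S v -> S w -> S z -> T u v (w + z) = T u v w + T u v z;
  es_TZ : forall u v k w, S u -> S v -> S w -> T u v (k *: w) = k * T u v w;
  es_T_bound : forall u v w, S u -> S v -> S w ->
    T u v w ^+ 2 <= 1 / 2 * nA v ^+ 2 * (nL u * nA u) * (nL w * nA w);
  es_lambda_gt0 : 0 < lambda;
  es_poincare : forall v, S v -> nL v <= (Num.sqrt lambda)^-1 * nA v }.

Section energy.
Context {R : realType} {V : lmodType R}.
Variables (S : V -> Prop) (L A : V -> V -> R) (nL nA : V -> R) (T : V -> V -> V -> R).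
Variable lambda : R.
Hypothesis ES : energy_space S L A nL nA T lambda.
Implicit Types (u v w z p q r : V).

Let SD := es_add ES.
Let SZ := es_scale ES.
Let LC := es_LC ES.
Let AC := es_AC ES.
Let LD := es_LD ES.
Let LZ := es_LZ ES.
Let AD := es_AD ES.
Let AZ := es_AZ ES.
Let nL0 := es_L_ge0 ES.
Let nA0 := es_A_ge0 ES.
Let nLE := es_L_norm ES.
Let nAE := es_A_norm ES.
Let TN := es_T_antisym ES.
Let TD := es_TD ES.
Let TZ := es_TZ ES.
Let Tbound := es_T_bound ES.
Let lambda0 := es_lambda_gt0 ES.
Let poincare := es_poincare ES.

Lemma L_ge0 u : 0 <= L u u. Proof. by rewrite -nLE sqr_ge0. Qed.
Lemma A_ge0 u : 0 <= A u u. Proof. by rewrite -nAE sqr_ge0. Qed.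

Lemma poincare_sqr v : S v -> lambda * L v v <= A v v.
Proof.
move=> Sv; have l0 : 0 < Num.sqrt lambda by rewrite sqrtr_gt0.
have := poincare Sv; rewrite mulrC ler_pdivlMr// => h.
rewrite -nLE -nAE -(sqr_sqrtr (ltW lambda0)) -exprMn mulrC lerXn2r ?nnegrE ?mulr_ge0//.
Qed.

Lemma comb_S a b c r q p : S r -> S q -> S p -> S (a *: r + b *: q + c *: p).
Proof. by move=> *; apply: (SD (SD _ _)); exact: SZ. Qed.

Lemma comb_L a b c r q p v : S r -> S q -> S p -> S v ->
  L (a *: r + b *: q + c *: p) v = a * L r v + b * L q v + c * L p v.
Proof. by move=> Sr Sq Sp Sv; rewrite !LD ?LZ//; do ?[exact: SD|exact: SZ|apply: SD]. Qed.

Lemma comb_A a b c r q p v : S r -> S q -> S p -> S v ->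
  A (a *: r + b *: q + c *: p) v = a * A r v + b * A q v + c * A p v.
Proof. by move=> Sr Sq Sp Sv; rewrite !AD ?AZ//; do ?[exact: SD|exact: SZ|apply: SD]. Qed.

Lemma comb_LL a b c a' b' c' r q p : S r -> S q -> S p ->
  L (a *: r + b *: q + c *: p) (a' *: r + b' *: q + c' *: p) =
  a * a' * L r r + b * b' * L q q + c * c' * L p p + (a * b' + b * a') * L q r
  + (a * c' + c * a') * L p r + (b * c' + c * b') * L p q.
Proof.
move=> Sr Sq Sp; have Sv := comb_S a' b' c' Sr Sq Sp.
rewrite comb_L// !(LC _ (a' *: r + b' *: q + c' *: p)) !comb_L//.
by rewrite (LC r q) (LC r p) (LC q p); ring.
Qed.

Section theta.
Variable theta : R.
Hypothesis th : 0 < theta < 1.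

Notation Gn p q := ((1 + theta) / 4 * nL p ^+ 2 + (1 - theta) / 4 * nL q ^+ 2).

(** Both sides are quadratic forms in [r], [q], [p], so it suffices to compare
coefficients; those of the last square are multiples of a_1^2 = theta (1 - theta^2) / 2. *)
Lemma G_stability r q p : S r -> S q -> S p ->
  L (alpha0 theta *: r + alpha1 theta *: q + alpha2 theta *: p)
    (beta0 theta *: r + beta1 theta *: q + beta2 theta *: p) =
  Gn p q - Gn q r + nL (a0 theta *: r + a1 theta *: q + a2 theta *: p) ^+ 2.
Proof.
move=> Sr Sq Sp; rewrite !nLE !comb_LL// /a0 /a2.
rewrite /alpha0 /alpha1 /alpha2 /beta0 /beta1 /beta2.
have := a1_sqr th; move: (a1 theta) => a ha.
have -> : - (a / 2) * - (a / 2) * L r r + a * a * L q q + - (a / 2) * - (a / 2) * L p p +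
  (- (a / 2) * a + a * - (a / 2)) * L q r + (- (a / 2) * - (a / 2) + - (a / 2) * - (a / 2)) * L p r +
  (a * - (a / 2) + - (a / 2) * a) * L p q =
  a ^+ 2 * (L r r / 4 + L q q + L p p / 4 - L q r + L p r / 2 - L p q) by field.
by rewrite ha; field.
Qed.

(** Polarise each product as 2 (x, y) = |x|^2 + |y|^2 - |x - y|^2. *)
Lemma alpha_identity r q p : S r -> S q -> S p ->
  L (alpha0 theta *: r + alpha1 theta *: q + alpha2 theta *: p) p =
  Gn p q - Gn q r + theta / 2 * nL (p - q) ^+ 2 + (1 - theta) / 4 * nL (p - r) ^+ 2.
Proof.
move=> Sr Sq Sp; rewrite comb_L//.
(* Written as three-term combinations, so that [comb_LL] expands the squares. *)
have e1 : p - q = 0 *: r + (-1) *: q + 1 *: p by rewrite scale0r add0r scaleN1r scale1r addrC.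
have e2 : p - r = (-1) *: r + 0 *: q + 1 *: p by rewrite scale0r addr0 scaleN1r scale1r addrC.
rewrite e1 e2 !nLE !comb_LL// /alpha0 /alpha1 /alpha2 (LC r p) (LC q p).
by field.
Qed.

(** Polarise each product as 2 (x, y) = |x + y|^2 - |x|^2 - |y|^2; the
coefficients sum to 1 by consistency ([beta_sum]). *)
Lemma grad_identity r q p : S r -> S q -> S p ->
  A (beta0 theta *: r + beta1 theta *: q + beta2 theta *: p) p =
  (3 * beta2 theta - 1) / 2 * A p p - beta1 theta / 2 * A q q - beta0 theta / 2 * A r r
  + beta1 theta / 2 * nA (p + q) ^+ 2 + beta0 theta / 2 * nA (p + r) ^+ 2.
Proof.
move=> Sr Sq Sp; rewrite comb_A// !nAE.
have Spq := SD Sp Sq; have Spr := SD Sp Sr.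
rewrite (AD Sp Sq Spq) (AD Sp Sr Spr) !(AC _ (p + q)) !(AC _ (p + r)).
rewrite (AD Sp Sq Sp) (AD Sp Sq Sq) (AD Sp Sr Sp) (AD Sp Sr Sr) (AC r p) (AC q p).
have e := beta_sum theta; have -> : beta0 theta = 1 - beta1 theta - beta2 theta by lra.
by field.
Qed.

Lemma comb2_sqr (B : V -> V -> R) b c q r :
  (forall u, 0 <= B u u) -> (forall u v, B u v = B v u) ->
  (forall u v w, S u -> S v -> S w -> B (u + v) w = B u w + B v w) ->
  (forall k u w, S u -> S w -> B (k *: u) w = k * B u w) -> S q -> S r ->
  B (b *: q + c *: r) (b *: q + c *: r) <= (b ^+ 2 + c ^+ 2) * (B q q + B r r).
Proof.
move=> B0 BC BD BZ Sq Sr.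
have E (s t : R) : B (s *: q + t *: r) (s *: q + t *: r) = s ^+ 2 * B q q + 2 * s * t * B q r + t ^+ 2 * B r r.
  have Sz : S (s *: q + t *: r) by apply: SD; exact: SZ.
  rewrite (BD _ _ _ (SZ _ Sq) (SZ _ Sr) Sz) !BZ// !(BC _ (s *: q + t *: r)).
  by rewrite !BD ?BZ ?(BC r q)//; first ring; exact: SZ.
have := B0 (c *: q + (- b) *: r); rewrite !E.
by move: (B q q) (B q r) (B r r) => x y z; rewrite sqrrN; lra.
Qed.

(** Convexity of the square of a seminorm. *)
Lemma comb3_sqr_le b0 b1 b2 r q p (M : R) : S r -> S q -> S p ->
  0 <= b0 -> 0 <= b1 -> 0 <= b2 -> b0 + b1 + b2 = 1 ->
  L r r <= M -> L q q <= M -> L p p <= M ->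
  L (b0 *: r + b1 *: q + b2 *: p) (b0 *: r + b1 *: q + b2 *: p) <= M.
Proof.
move=> Sr Sq Sp h0 h1 h2 hs hr hq hp; rewrite comb_LL//.
have sq u v : S u -> S v -> 2 * L u v <= L u u + L v v.
  move=> Su Sv; have := L_ge0 (u + (-1) *: v).
  have S1 := SZ (-1) Sv; have S2 := SD Su S1.
  rewrite (LD Su S1 S2) (LZ _ Sv S2) !(LC _ (u + _)) !(LD Su S1)// !(LZ _ Sv)// (LC v u); lra.
have s1 := sq _ _ Sq Sr; have s2 := sq _ _ Sp Sr; have s3 := sq _ _ Sp Sq.
have e0 : b0 = 1 - b1 - b2 by lra.
have m1 := mulr_ge0 h0 h1; have m2 := mulr_ge0 h0 h2; have m3 := mulr_ge0 h1 h2.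
apply: (@le_trans _ _ (b0 * L r r + b1 * L q q + b2 * L p p)); last first.
  have k1 : b0 * L r r <= b0 * M by rewrite ler_wpM2l.
  have k2 : b1 * L q q <= b1 * M by rewrite ler_wpM2l.
  have k3 : b2 * L p p <= b2 * M by rewrite ler_wpM2l.
  by apply: le_trans (lerD (lerD k1 k2) k3) _; rewrite -!mulrDl hs mul1r.
rewrite -subr_ge0.
have -> : b0 * L r r + b1 * L q q + b2 * L p p - (b0 * b0 * L r r + b1 * b1 * L q q + b2 * b2 * L p p +
   (b0 * b1 + b1 * b0) * L q r + (b0 * b2 + b2 * b0) * L p r + (b1 * b2 + b2 * b1) * L p q) =
   b0 * b1 * (L q q + L r r - 2 * L q r) + b0 * b2 * (L p p + L r r - 2 * L p r) + b1 * b2 * (L p p + L q q - 2 * L p q).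
  rewrite e0; ring.
by rewrite !addr_ge0// mulr_ge0// subr_ge0.
Qed.


Section scheme.
Variables (nu dt nf : R) (u : nat -> V) (F : nat -> V -> R).
Hypotheses (nu0 : 0 < nu) (dt0 : 0 < dt).
Hypothesis Su : forall n, S (u n).
Hypothesis Fbound : forall n v, (1 <= n)%N -> S v -> `|F n v| <= nf * nL v.

Notation w := (at_beta theta u).
Notation be0 := (beta0 theta).
Notation be1 := (beta1 theta).
Notation be2 := (beta2 theta).
Notation delta := (2 * be2 - 1).

Hypothesis dln : forall n v, (1 <= n)%N -> S v ->
  dt^-1 * L (at_alpha theta u n) v + nu * A (w n) v + T (w n) (w n) v = F n v.

Lemma w_S n : S (w n).
Proof. exact: comb_S. Qed.

Lemma T_self v z : S v -> S z -> T v z z = 0.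
Proof. by move=> Sv Sz; have := TN Sv Sz Sz; lra. Qed.

(** By the Poincare inequality, the forcing is bounded by |f| |grad v|; the weight
[s] says how much dissipation is spent on absorbing it. *)
Lemma force_young n v s : (1 <= n)%N -> S v -> 0 < s ->
  F n v <= s * A v v + nf ^+ 2 / (4 * s * lambda).
Proof.
move=> n1 Sv s0; apply: le_add_of_sqr.
- by rewrite mulr_ge0 ?A_ge0// ltW.
- by rewrite divr_ge0 ?sqr_ge0// !mulr_ge0// ltW.
have -> : 4 * (s * A v v * (nf ^+ 2 / (4 * s * lambda))) = nf ^+ 2 * (A v v / lambda).
  by field; rewrite !gt_eqF.
have := Fbound n1 Sv => h.
rewrite -(real_normK (num_real (F n v))).
apply: (@le_trans _ _ ((nf * nL v) ^+ 2)).
  by rewrite lerXn2r ?nnegrE// (le_trans _ h).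
rewrite exprMn ler_wpM2l ?sqr_ge0// nLE ler_pdivlMr// mulrC.
exact: poincare_sqr.
Qed.

(** The scheme tested with the beta-average: convection vanishes and half of the
dissipation absorbs the forcing. *)
Lemma step_energy n : (1 <= n)%N ->
  Gn (u n.+1) (u n) - Gn (u n) (u n.-1) + nL (at_a theta u n) ^+ 2
  + nu * dt / 2 * A (w n) (w n) <= dt * (nf ^+ 2 / (2 * nu * lambda)).
Proof.
move=> n1; have := dln n1 (w_S n); rewrite T_self ?addr0; try exact: w_S.
have -> : L (at_alpha theta u n) (w n) = Gn (u n.+1) (u n) - Gn (u n) (u n.-1) + nL (at_a theta u n) ^+ 2.
  exact: G_stability.
have := force_young n1 (w_S n) (divr_gt0 nu0 (ltr0Sn R 1)).
have -> : 4 * (nu / 2) * lambda = 2 * nu * lambda by field.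
set X := _ + nL _ ^+ 2; set c := nf ^+ 2 / _; set Aw := A _ _ => h1 h2.
have {h1} h1 : dt^-1 * X <= c - nu / 2 * Aw by lra.
move: h1; rewrite mulrC ler_pdivrMr// => h1.
have -> : nu * dt / 2 * Aw = nu / 2 * Aw * dt by ring.
lra.
Qed.

Lemma G_ge0 p q : 0 <= Gn p q.
Proof.
move/andP: th => [t0 t1].
by apply: addr_ge0; apply: mulr_ge0; rewrite ?sqr_ge0//; apply: divr_ge0 => //; lra.
Qed.

(** Telescoping of [step_energy].  The G-norm at the final time is kept on the left
for the induction. *)
Lemma dissipation_bound i k : (1 <= i)%N ->
  nu * dt * \sum_(i <= n < i + k) nA (w n) ^+ 2 + 2 * Gn (u (i + k)%N) (u (i + k).-1)
  <= 2 * Gn (u i) (u i.-1) + k%:R * dt / (nu * lambda) * nf ^+ 2.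
Proof.
move=> i1; elim: k => [|k IH].
  by rewrite addn0 big_geq// mulr0 !mul0r add0r addr0.
have ik : (1 <= i + k)%N by rewrite (leq_trans i1)// leq_addr.
rewrite addnS big_nat_recr ?leq_addr//= nAE.
have := step_energy ik; have := sqr_ge0 (nL (at_a theta u (i + k))).
have -> : k.+1%:R * dt / (nu * lambda) * nf ^+ 2 = k%:R * dt / (nu * lambda) * nf ^+ 2 + 2 * (dt * (nf ^+ 2 / (2 * nu * lambda))).
  by rewrite -addn1 natrD; field; rewrite !gt_eqF.
by rewrite mulrDr; lra.
Qed.

Lemma dissipation_le i N : (1 <= i)%N -> (i <= N)%N ->
  nu * dt * \sum_(i <= n < N) nA (w n) ^+ 2
  <= 2 * Gn (u i) (u i.-1) + (N - i)%:R * dt / (nu * lambda) * nf ^+ 2.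
Proof.
move=> i1 iN; have := dissipation_bound (N - i) i1; rewrite subnKC//.
by have := G_ge0 (u N) (u N.-1); lra.
Qed.

Section boundedness.
Variables (eps a b c h11 h22 Ch Ceps : R).
Hypotheses (eps0 : 0 < eps) (h11p : h11_bound theta < h11) (h22p : 0 < h22).
Hypotheses (hCh : Num.max h11 h22 < Ch) (heps : 1 / eps < Ceps / (nu * lambda * dt)).
Hypothesis aux : forall n, (1 <= n)%N ->
  Gn (u n.+1) (u n) - Gn (u n) (u n.-1) + nL (at_a theta u n) ^+ 2
  + nu * dt * lambda / 2 * nL (w n) ^+ 2
  = (1 + eps) * (h11 * nL (u n.+1) ^+ 2 + h22 * nL (u n) ^+ 2)
  - (h11 * nL (u n) ^+ 2 + h22 * nL (u n.-1) ^+ 2)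
  + nL (a *: u n.+1 + b *: u n + c *: u n.-1) ^+ 2.

Notation Hn n := (h11 * nL (u n) ^+ 2 + h22 * nL (u n.-1) ^+ 2).

(** The auxiliary identity bounds the left-hand side of [step_energy] from below by
(1 + eps) H_(n+1) - H_n; the bound on 1 / eps turns c / eps into a constant
independent of the time step. *)
Lemma H_decay N : (1 <= N)%N ->
  Hn N <= 1 / (1 + eps) ^+ (N - 1) * Hn 1%N + Ceps / (2 * nu ^+ 2 * lambda ^+ 2) * nf ^+ 2.
Proof.
case: N => // n _; rewrite subn1 /=.
set cc := dt * (nf ^+ 2 / (2 * nu * lambda)).
have nf20 : 0 <= nf ^+ 2 / (2 * nu * lambda).
  by rewrite divr_ge0 ?sqr_ge0// !mulr_ge0// ltW.
have cc0 : 0 <= cc by rewrite mulr_ge0// ltW.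
have step m : (1 <= m)%N -> (1 + eps) * Hn m.+1 <= Hn m + cc.
  move=> m1; have := step_energy m1; have := aux m1; rewrite -/cc.
  have := sqr_ge0 (nL (a *: u m.+1 + b *: u m + c *: u m.-1)).
  have := poincare_sqr (w_S m); rewrite -nLE => p1 h1 h2 h3.
  have p2 : nu * dt * lambda / 2 * nL (w m) ^+ 2 <= nu * dt / 2 * A (w m) (w m).
    have -> : nu * dt * lambda / 2 * nL (w m) ^+ 2 = nu * dt / 2 * (lambda * nL (w m) ^+ 2) by ring.
    by rewrite ler_wpM2l// divr_ge0// mulr_ge0// ltW.
  rewrite /=; lra.
have := discrete_gronwall (h := fun n => Hn n) eps0 cc0 step n => /= /le_trans; apply.
rewrite mul1r [_^-1 * _]mulrC lerD2l.
have -> : Ceps / (2 * nu ^+ 2 * lambda ^+ 2) * nf ^+ 2 = cc * (Ceps / (nu * lambda * dt)).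
  by rewrite /cc; field; rewrite !gt_eqF.
by rewrite ler_wpM2l// -[eps^-1]mul1r ltW.
Qed.

Definition energy_K1 : R := Ch * (nL (u 1%N) ^+ 2 + nL (u 0%N) ^+ 2)
  + Ceps / (2 * nu ^+ 2 * lambda ^+ 2) * nf ^+ 2.

Lemma Ceps_gt0 : 0 < Ceps.
Proof.
have k0 : 0 < nu * lambda * dt by rewrite !mulr_gt0.
have : 0 < Ceps / (nu * lambda * dt) by apply: lt_trans heps; rewrite divr_gt0.
by rewrite pmulr_lgt0// invr_gt0.
Qed.

Lemma tail_ge0 : 0 <= Ceps / (2 * nu ^+ 2 * lambda ^+ 2) * nf ^+ 2.
Proof.
rewrite mulr_ge0 ?sqr_ge0// divr_ge0 ?(ltW Ceps_gt0)//.
by apply: mulr_ge0 (sqr_ge0 _); apply: mulr_ge0 (sqr_ge0 _).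
Qed.

Lemma Ch_bounds : h11 < Ch /\ h22 < Ch.
Proof. by move: hCh; rewrite gt_max => /andP. Qed.

(** For n = 0 the bound is direct, since h11_bound < h11 < Ch; for n >= 1 it follows
from the decay of the H-norm. *)
Lemma L_le_K2 n : h11_bound theta * L (u n) (u n) <= energy_K1.
Proof.
have hb := h11_bound_gt0 th; have [c1 c2] := Ch_bounds; have t0 := tail_ge0.
have small (m m' : nat) : h11_bound theta * L (u m) (u m) <=
   Ch * (nL (u m) ^+ 2 + nL (u m') ^+ 2) + Ceps / (2 * nu ^+ 2 * lambda ^+ 2) * nf ^+ 2.
  rewrite -nLE -[leLHS]addr0 lerD//; apply: (@le_trans _ _ (Ch * nL (u m) ^+ 2)).
    by rewrite ler_wpM2r ?sqr_ge0// ltW// (lt_trans h11p).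
  rewrite mulrDr lerDl mulr_ge0 ?sqr_ge0// ltW//.
  by rewrite (lt_trans hb)// (lt_trans h11p).
case: n => [|n]; first by rewrite /energy_K1 addrC -(addrC (nL (u 0%N) ^+ 2)) addrC; exact: small.
apply: (@le_trans _ _ (Hn n.+1)).
  rewrite -nLE -[leLHS]addr0 lerD//; last by rewrite mulr_ge0 ?sqr_ge0// ltW.
  by rewrite ler_wpM2r ?sqr_ge0// ltW.
apply: le_trans (H_decay (ltn0Sn n)) _; rewrite /energy_K1 lerD2r /=.
have e1 : 1 <= (1 + eps) ^+ (n.+1 - 1) by rewrite exprn_ege1// lerDl ltW.
apply: (@le_trans _ _ (h11 * nL (u 1%N) ^+ 2 + h22 * nL (u 0%N) ^+ 2)).
  rewrite ler_piMl//.
    apply: addr_ge0; apply: mulr_ge0; rewrite ?sqr_ge0 ?(ltW h22p)//.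
    by rewrite ltW// (lt_trans hb).
  by rewrite div1r invf_le1// (lt_le_trans ltr01).
by rewrite mulrDr; apply: lerD; rewrite ler_wpM2r ?sqr_ge0// ltW.
Qed.

Lemma norm_le_K2 n : nL (u n) <= Num.sqrt (energy_K1 / h11_bound theta).
Proof.
rewrite -[leLHS]ger0_norm// -sqrtr_sqr ler_wsqrtr// ler_pdivlMr ?h11_bound_gt0//.
by rewrite mulrC nLE L_le_K2.
Qed.

End boundedness.

Section gradient_bound.
Variable K : R.
Hypothesis uK : forall n, nL (u n) <= K.
Notation M := (K ^+ 4 * (be0 ^+ 2 + be1 ^+ 2) ^+ 2 / (2 * nu ^+ 4 * delta ^+ 3)).
Notation En p q := (1 / 4 * nA p ^+ 2 + (be0 / 2 + delta / 8) * nA q ^+ 2).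

Lemma K_ge0 : 0 <= K. Proof. exact: le_trans (nL0 (u 0%N)) (uK _). Qed.

Lemma L_le_Ksqr n : L (u n) (u n) <= K ^+ 2.
Proof. by rewrite -nLE lerXn2r ?nnegrE ?K_ge0. Qed.

(** The convection term is T(w, u_(n+1), z) with z = be1 u_n + be0 u_(n-1).  With
Q = be0^2 + be1^2 one has |w| <= K, |z|^2 <= 2 Q K^2 and |grad z|^2 <= Q D2, and
Young's inequality is applied twice: to separate |grad u_(n+1)|^2, then D2 from
|grad w|^2. *)
Lemma convection_bound n :
  - T (w n) (w n) (u n.+1) <= nu * delta / 2 * A (u n.+1) (u n.+1)
   + (nu * delta / 8 * (A (u n) (u n) + A (u n.-1) (u n.-1)) + nu * M * A (w n) (w n)).
Proof.
have d0 := delta_gt0 th; have b00 := beta0_gt0 th; have b10 := beta1_ge0 theta; have b20 := beta2_gt0 th.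
set z := be1 *: u n + be0 *: u n.-1.
have Sz : S z by apply: SD; exact: SZ.
have wz : w n = z + be2 *: u n.+1.
  by rewrite /at_beta /three_step /z [be0 *: _ + _]addrC.
have Sw := w_S n; have Sp := Su n.+1.
have -> : - T (w n) (w n) (u n.+1) = T (w n) (u n.+1) z.
  rewrite (TN Sw Sw Sp) opprK {2}wz TD//; last exact: SZ.
  by rewrite TZ// T_self// mulr0 addr0.
have Lw : L (w n) (w n) <= K ^+ 2.
  apply: comb3_sqr_le => //; try exact: ltW; try exact: L_le_Ksqr.
  exact: beta_sum.
set Q := be0 ^+ 2 + be1 ^+ 2.
have Q0 : 0 <= Q by rewrite addr_ge0 ?sqr_ge0.
set D2 := A (u n) (u n) + A (u n.-1) (u n.-1).
have D20 : 0 <= D2 by rewrite addr_ge0 ?A_ge0.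
have Lz : L z z <= Q * (2 * K ^+ 2).
  have := @comb2_sqr L be1 be0 (u n) (u n.-1) L_ge0 LC LD LZ (Su _) (Su _).
  move=> /le_trans; apply; rewrite [be1 ^+ 2 + _]addrC ler_wpM2l//.
  by have := L_le_Ksqr n; have := L_le_Ksqr n.-1; lra.
have Az : A z z <= Q * D2.
  have := @comb2_sqr A be1 be0 (u n) (u n.-1) A_ge0 AC AD AZ (Su _) (Su _).
  by rewrite [be1 ^+ 2 + _]addrC.
have K2 := sqr_ge0 K.
set Ap := A (u n.+1) (u n.+1); have Ap0 : 0 <= Ap := A_ge0 _.
set Aw := A (w n) (w n); have Aw0 : 0 <= Aw := A_ge0 _.
set Y := (nL (w n) * nA (w n)) * (nL z * nA z).
have Y0 : 0 <= Y by rewrite !mulr_ge0.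
have Y2 : Y ^+ 2 <= 2 * (K ^+ 2 * Q) ^+ 2 * (D2 * Aw).
  have -> : Y ^+ 2 = (L (w n) (w n) * Aw) * (L z z * A z z) by rewrite /Y !exprMn !nLE !nAE.
  have -> : 2 * (K ^+ 2 * Q) ^+ 2 * (D2 * Aw) = (K ^+ 2 * Aw) * ((Q * (2 * K ^+ 2)) * (Q * D2)) by ring.
  by apply: ler_pM; rewrite ?mulr_ge0 ?L_ge0 ?A_ge0//; [rewrite ler_wpM2r|apply: ler_pM; rewrite ?L_ge0 ?A_ge0].
have nd : 0 < nu * delta by rewrite mulr_gt0.
have M0 : 0 <= M.
  by rewrite divr_ge0 ?mulr_ge0 ?exprn_ge0 ?K_ge0 ?sqr_ge0// ltW.
set B := nu * delta / 8 * D2 + nu * M * Aw.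
have B0 : 0 <= B.
  apply: addr_ge0; apply: mulr_ge0 => //; first by apply: divr_ge0 => //; exact: ltW.
  by apply: mulr_ge0 => //; exact: ltW.
(* 4 nu delta B is the sum of a multiple of D2 and a multiple of |grad w|^2, whose
   product dominates Y^2. *)
have YB : Y <= 4 * (nu * delta) * B.
  have -> : 4 * (nu * delta) * B = (nu * delta) ^+ 2 / 2 * D2 + 2 * (K ^+ 2 * Q) ^+ 2 / (nu * delta) ^+ 2 * Aw.
    by rewrite /B -/Q; field; rewrite !gt_eqF.
  apply: le_add_of_sqr.
  - by rewrite mulr_ge0// divr_ge0 ?sqr_ge0.
  - by apply: mulr_ge0 => //; apply: divr_ge0; rewrite ?sqr_ge0//; apply: mulr_ge0 => //; exact: sqr_ge0.
  have -> : 4 * ((nu * delta) ^+ 2 / 2 * D2 * (2 * (K ^+ 2 * Q) ^+ 2 / (nu * delta) ^+ 2 * Aw)) =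
     2 * (2 * (K ^+ 2 * Q) ^+ 2 * (D2 * Aw)) by field; rewrite !gt_eqF.
  apply: (le_trans Y2); rewrite ler_peMl ?ler1n//.
  by apply: mulr_ge0; [apply: mulr_ge0 => //; exact: sqr_ge0|exact: mulr_ge0].
apply: le_add_of_sqr => //; first by rewrite mulr_ge0// divr_ge0// ltW.
apply: le_trans (Tbound Sw Sp Sz) _.
have -> : 1 / 2 * nA (u n.+1) ^+ 2 * (nL (w n) * nA (w n)) * (nL z * nA z) = 1 / 2 * Ap * Y.
  by rewrite nAE /Y !mulrA.
have -> : 4 * (nu * delta / 2 * Ap * B) = 1 / 2 * Ap * (4 * (nu * delta) * B) by field.
by rewrite ler_wpM2l// mulr_ge0.
Qed.

(** The scheme tested with u_(n+1).  Of the dissipation of weight nu delta, one half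
is spent on |grad u_(n+1)|^2 and two eighths on |grad u_n|^2 and
|grad u_(n-1)|^2 in [convection_bound], one eighth on the forcing, and one eighth
is kept; the functional En is designed so that the shifted eighths telescope. *)
Lemma step_gradient n : (1 <= n)%N ->
  dt * (nu * delta / 8) * nA (u n.+1) ^+ 2
  + (Gn (u n.+1) (u n) - Gn (u n) (u n.-1))
  + dt * nu * (En (u n.+1) (u n) - En (u n) (u n.-1))
  + (theta / 2 * nL (u n.+1 - u n) ^+ 2 + 1 / 4 * (1 - theta) * nL (u n.+1 - u n.-1) ^+ 2)
  + nu * dt * (be1 / 2 * nA (u n.+1 + u n) ^+ 2 + be0 / 2 * nA (u n.+1 + u n.-1) ^+ 2)
  <= dt * (2 * nf ^+ 2 / (nu * delta * lambda)) + M * (nu * dt * nA (w n) ^+ 2).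
Proof.
move=> n1; have d0 := delta_gt0 th; have nd : 0 < nu * delta by rewrite mulr_gt0.
have := dln n1 (Su n.+1).
have -> : L (at_alpha theta u n) (u n.+1) = Gn (u n.+1) (u n) - Gn (u n) (u n.-1)
   + theta / 2 * nL (u n.+1 - u n) ^+ 2 + (1 - theta) / 4 * nL (u n.+1 - u n.-1) ^+ 2.
  exact: alpha_identity.
have -> : A (w n) (u n.+1) = (3 * be2 - 1) / 2 * A (u n.+1) (u n.+1) - be1 / 2 * A (u n) (u n)
   - be0 / 2 * A (u n.-1) (u n.-1)
  + be1 / 2 * nA (u n.+1 + u n) ^+ 2 + be0 / 2 * nA (u n.+1 + u n.-1) ^+ 2.
  exact: grad_identity.
have := convection_bound n.
have := force_young n1 (Su n.+1) (divr_gt0 nd (ltr0Sn R 7)).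
have -> : nf ^+ 2 / (4 * (nu * delta / 8) * lambda) = 2 * nf ^+ 2 / (nu * delta * lambda).
  by field; rewrite !gt_eqF.
rewrite !(nAE (u _)) (nAE (w n)).
have e1 : be1 = 1 - be0 - be2 by have := beta_sum theta; lra.
move: (T _ _ _) (F _ _) (2 * nf ^+ 2 / _) M => t ff cf m.
move: (A (u n.+1) (u n.+1)) (A (u n) (u n)) (A (u n.-1) (u n.-1)) (A (w n) (w n)) => x y z aw.
move: (nA (u n.+1 + u n) ^+ 2) (nA (u n.+1 + u n.-1) ^+ 2) (nL (u n.+1 - u n) ^+ 2) (nL (u n.+1 - u n.-1) ^+ 2) => s1 s2 s3 s4.
move: (Gn (u n.+1) (u n)) (Gn (u n) (u n.-1)) => g1 g2 hF hT E.
set X := g1 - g2 + theta / 2 * s3 + (1 - theta) / 4 * s4 in E.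
have {}E : X = dt * (ff - nu * ((3 * be2 - 1) / 2 * x - be1 / 2 * y - be0 / 2 * z + be1 / 2 * s1 + be0 / 2 * s2) - t).
  by rewrite -E; field; rewrite gt_eqF.
have hS := lerD hF hT.
have := ler_wpM2l (ltW dt0) hS.
rewrite -subr_ge0 => h; rewrite -subr_ge0; apply: le_trans h _.
rewrite le_eqVlt; apply/orP; left; apply/eqP.
have -> : g1 = X + g2 - theta / 2 * s3 - (1 - theta) / 4 * s4 by rewrite /X; ring.
by rewrite E e1; field.
Qed.

(** Telescoping of [step_gradient]. *)
Lemma gradient_bound i k : (1 <= i)%N ->
  dt * (nu * delta / 8) * \sum_(i <= j < i + k) nA (u j.+1) ^+ 2
  + Gn (u (i + k)%N) (u (i + k).-1) + dt * nu * En (u (i + k)%N) (u (i + k).-1)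
  + \sum_(i <= j < i + k) (theta / 2 * nL (u j.+1 - u j) ^+ 2 + 1 / 4 * (1 - theta) * nL (u j.+1 - u j.-1) ^+ 2)
  + nu * dt * \sum_(i <= j < i + k) (be1 / 2 * nA (u j.+1 + u j) ^+ 2 + be0 / 2 * nA (u j.+1 + u j.-1) ^+ 2)
  <= Gn (u i) (u i.-1) + dt * nu * En (u i) (u i.-1)
   + k%:R * (dt * (2 * nf ^+ 2 / (nu * delta * lambda))) + M * (nu * dt * \sum_(i <= n < i + k) nA (w n) ^+ 2).
Proof.
move=> i1; elim: k => [|k IH].
  by rewrite addn0 !big_geq// !mulr0 mul0r !addr0 add0r.
have ik : (1 <= i + k)%N by rewrite (leq_trans i1)// leq_addr.
rewrite addnS !big_nat_recr ?leq_addr//=.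
exact: telescope_step IH (step_gradient ik).
Qed.

(** The sum of |grad w_n|^2 left over by [gradient_bound] is estimated by
[dissipation_le]; this produces the factors 1 + 2 M and 2 + ... of (iv). *)
Lemma gradient_le i N : (1 <= i)%N -> (i <= N)%N ->
  dt * (nu * delta / 8) * \sum_(i <= j < N) nA (u j.+1) ^+ 2
  + Gn (u N) (u N.-1) + dt * nu * En (u N) (u N.-1)
  + \sum_(i <= j < N) (theta / 2 * nL (u j.+1 - u j) ^+ 2 + 1 / 4 * (1 - theta) * nL (u j.+1 - u j.-1) ^+ 2)
  + nu * dt * \sum_(i <= j < N) (be1 / 2 * nA (u j.+1 + u j) ^+ 2 + be0 / 2 * nA (u j.+1 + u j.-1) ^+ 2)
  <= (1 + K ^+ 4 * (be0 ^+ 2 + be1 ^+ 2) ^+ 2 / (nu ^+ 4 * delta ^+ 3)) * Gn (u i) (u i.-1)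
   + dt * nu * En (u i) (u i.-1)
   + (N - i)%:R * dt / (nu * delta * lambda)
     * (2 + K ^+ 4 * (be0 ^+ 2 + be1 ^+ 2) ^+ 2 / (2 * nu ^+ 4 * delta ^+ 2)) * nf ^+ 2.
Proof.
move=> i1 iN; have d0 := delta_gt0 th.
have h1 := gradient_bound (N - i) i1; have h2 := dissipation_le i1 iN.
rewrite subnKC// in h1; apply: (le_trans h1).
have M0 : 0 <= M.
  apply: divr_ge0; first by apply: mulr_ge0; [exact: exprn_ge0 K_ge0|exact: sqr_ge0].
  by apply/ltW; apply: mulr_gt0; [apply: mulr_gt0 => //; exact: exprn_gt0|exact: exprn_gt0].
have := ler_wpM2l M0 h2 => h3.
apply: (@le_trans _ _ (Gn (u i) (u i.-1) + dt * nu * En (u i) (u i.-1)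
   + (N - i)%:R * (dt * (2 * nf ^+ 2 / (nu * delta * lambda)))
   + M * (2 * Gn (u i) (u i.-1) + (N - i)%:R * dt / (nu * lambda) * nf ^+ 2))).
  by rewrite lerD2l.
move: (Gn _ _) (En _ _) => g e.
rewrite le_eqVlt; apply/orP; left; apply/eqP; field.
by rewrite !gt_eqF.
Qed.

End gradient_bound.
End scheme.
End theta.
End energy.

(** * Boundedness of the discrete solutions *)

Lemma navier_stokes_energy_space (R : realType) (Omega : set (plane R)) (lambda : R) :
  open Omega -> 0 < lambda ->
  (forall v, in_V Omega v ->
    l2norm Omega v <= (Num.sqrt lambda)^-1 * l2norm Omega (grad Omega v)) ->
  energy_space (in_V Omega) (l2dot Omega) (stokes Omega) (l2norm Omega)
    (fun v => l2norm Omega (grad Omega v)) (trilin Omega) lambda.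
Proof.
move=> oO l0 poi; split.
- by move=> u v; exact: in_VD.
- by move=> k u; exact: in_VZ.
- exact: l2dotC.
- exact: stokesC.
- by move=> u v w Vu Vv Vw; exact: (l2dotDl oO (in_V_mL2 Vu) (in_V_mL2 Vv) (in_V_mL2 Vw)).
- by move=> k u w Vu Vw; exact: (l2dotZl oO k (in_V_mL2 Vu) (in_V_mL2 Vw)).
- by move=> u v w Vu Vv Vw; exact: stokesDl.
- by move=> k u w Vu Vw; exact: stokesZl.
- by move=> u; exact: l2norm_ge0.
- by move=> u; exact: l2norm_ge0.
- by move=> u; exact: l2norm_sqr.
- by move=> u; exact: l2norm_sqr.
- by move=> u v w Vu Vv Vw; exact: trilin_antisym.
- by move=> u v w z Vu Vv Vw Vz; exact: trilinDr.
- by move=> u v k w Vu Vv Vw; exact: trilinZr.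
- by move=> u v w [hu _] [hv _] [hw _]; exact: (trilin_bound oO hu hv hw).
- exact: l0.
- exact: poi.
Qed.

(** The intermediate times are convex combinations of mesh points, so the forcing
is evaluated where it is known to be square integrable. *)
Lemma t_beta_ge0 (R : realType) (theta dt : R) n : 0 < theta < 1 -> 0 < dt -> (1 <= n)%N ->
  0 <= t_beta theta dt n.
Proof.
move=> th dt0 n1.
have nonneg (k : R) (m : nat) : 0 <= k -> 0 <= k * (m%:R * dt).
  by move=> k0; rewrite mulr_ge0// mulr_ge0// ltW.
apply: (addr_ge0 (addr_ge0 (nonneg _ n.-1 _) (nonneg _ n _)) (nonneg _ n.+1 _)).
- by rewrite ltW// beta0_gt0.
- exact: beta1_ge0.
- by rewrite ltW// beta2_gt0.
Qed.

Theorem theorem3p1 (R : realType) (C_h C_eps : R -> R)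
    (Omega : set (plane R)) (nu lambda1 : R) (f : R -> vfield R)
    (theta dt : R) (u : nat -> vfield R) (eps a b c h11 h22 : R)
    (Omega_dom : C2_domain Omega) (nu_gt0 : 0 < nu)
    (lambda1_gt0 : 0 < lambda1)
    (lambda1_eig : smallest_stokes_eigenvalue Omega lambda1)
    (poincare : forall v, in_V Omega v ->
      l2norm Omega v <= (Num.sqrt lambda1)^-1 * l2norm Omega (grad Omega v))
    (f_Linfty : Linfty_H Omega f)
    (f_values : forall n, (1 <= n)%N ->
      l2norm Omega (f (t_beta theta dt n)) <= Linfty_norm Omega f)
    (theta_itv : 0 < theta < 1) (dt_itv : 0 < dt < C_dt nu lambda1 theta)
    (u_V : forall n, in_V Omega (u n))
    (u_dln : dln_scheme Omega nu theta dt f u)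
    (aux : auxiliary_quantities Omega nu lambda1 theta dt u
      (C_h theta) (C_eps theta) eps a b c h11 h22) :
  let normf := Linfty_norm Omega f in
  let K2 := K2 Omega nu lambda1 theta (C_h theta) (C_eps theta) f u in
  let G := Gnorm2 Omega theta in
  let H := Hnorm2 Omega h11 h22 in
  let g n := grad Omega (u n) in
  let be0 := beta0 theta in
  let be1 := beta1 theta in
  let be2 := beta2 theta in
  [/\ forall N, (2 <= N)%N ->
        H (u N) (u N.-1) <=
          1 / (1 + eps) ^+ (N - 1) * H (u 1%N) (u 0%N)
          + C_eps theta / (2 * nu ^+ 2 * lambda1 ^+ 2) * normf ^+ 2,
      forall N, (2 <= N)%N -> l2norm Omega (u N) <= K2,
      forall N i, (1 <= N)%N -> (1 <= i <= N - 1)%N ->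
        nu * dt * \sum_(i <= n < N)
                    l2norm Omega (grad Omega (at_beta theta u n)) ^+ 2
        <= 2 * G (u i) (u i.-1)
           + (N - i)%:R * dt / (nu * lambda1) * normf ^+ 2
    & forall N i, (1 <= N)%N -> (1 <= i <= N - 1)%N ->
        dt * (nu * (2 * be2 - 1) / 8)
          * \sum_(i <= j < N) l2norm Omega (g j.+1) ^+ 2
        + G (u N) (u N.-1)
        + dt * nu * (1 / 4 * l2norm Omega (g N) ^+ 2
            + (be0 / 2 + (2 * be2 - 1) / 8) * l2norm Omega (g N.-1) ^+ 2)
        + \sum_(i <= j < N)
            (theta / 2 * l2norm Omega (u j.+1 - u j) ^+ 2
             + 1 / 4 * (1 - theta) * l2norm Omega (u j.+1 - u j.-1) ^+ 2)
        + nu * dt * \sum_(i <= j < N)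
            (be1 / 2 * l2norm Omega (g j.+1 + g j) ^+ 2
             + be0 / 2 * l2norm Omega (g j.+1 + g j.-1) ^+ 2)
        <= (1 + K2 ^+ 4 * (be0 ^+ 2 + be1 ^+ 2) ^+ 2
                / (nu ^+ 4 * (2 * be2 - 1) ^+ 3)) * G (u i) (u i.-1)
           + dt * nu * (1 / 4 * l2norm Omega (g i) ^+ 2
               + (be0 / 2 + (2 * be2 - 1) / 8) * l2norm Omega (g i.-1) ^+ 2)
           + (N - i)%:R * dt / (nu * (2 * be2 - 1) * lambda1)
             * (2 + K2 ^+ 4 * (be0 ^+ 2 + be1 ^+ 2) ^+ 2
                    / (2 * nu ^+ 4 * (2 * be2 - 1) ^+ 2)) * normf ^+ 2].
Proof.
move=> normf K2 G H g be0 be1 be2.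
have oO : open Omega by case: Omega_dom.
have ES := navier_stokes_energy_space oO lambda1_gt0 poincare.
have /andP[dt0 _] := dt_itv.
have [[Ch0 Ceps0 eps0 h110 h220] [h11p _ hCh] /andP[_ heps] auxE] := aux.
pose F n v := l2dot Omega (f (t_beta theta dt n)) v.
have Fb n v : (1 <= n)%N -> in_V Omega v -> `|F n v| <= normf * l2norm Omega v.
  move=> n1 Vv; have [fH _ _] := f_Linfty.
  have [fL2 _ _] := fH _ (t_beta_ge0 theta_itv dt0 n1).
  have Lf : mL2 Omega (f (t_beta theta dt n)) by move=> i j; rewrite (ord1 i); exact: fL2.
  apply: le_trans (l2dot_CS oO Lf (in_V_mL2 Vv)) _.
  by apply: ler_wpM2r; [exact: l2norm_ge0|exact: f_values].
have dln n v : (1 <= n)%N -> in_V Omega v ->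
    dt^-1 * l2dot Omega (at_alpha theta u n) v + nu * stokes Omega (at_beta theta u n) v
    + trilin Omega (at_beta theta u n) (at_beta theta u n) v = F n v.
  by move=> n1 Vv; exact: u_dln.
have hK n : l2norm Omega (u n) <= K2.
  exact: (norm_le_K2 ES theta_itv nu_gt0 dt0 u_V Fb dln eps0 h11p h220 hCh heps auxE).
split.
- move=> N N2.
  exact: (H_decay ES theta_itv nu_gt0 dt0 u_V Fb dln eps0 heps auxE (ltnW N2)).
- by move=> N _; exact: hK.
- move=> N i _ /andP[i1 iN].
  exact: (dissipation_le ES theta_itv nu_gt0 dt0 u_V Fb dln i1 (leq_trans iN (leq_subr _ _))).
- move=> N i _ /andP[i1 iN].
  have iN' := leq_trans iN (leq_subr _ _).
  have := gradient_le ES theta_itv nu_gt0 dt0 u_V Fb dln hK i1 iN'.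
  apply: le_trans; rewrite lerD2l; apply: ler_wpM2l; first by apply: mulr_ge0; exact: ltW.
  rewrite le_eqVlt; apply/orP; left; apply/eqP; apply: eq_bigr => j _.
  congr (_ * _ + _ * _).
    exact: (etrans (l2norm_gradD oO (u_V _) (u_V _)) (esym (l2norm_sqr _ _))).
  exact: (etrans (l2norm_gradD oO (u_V _) (u_V _)) (esym (l2norm_sqr _ _))).
Qed.
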